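(* Let $A,S\in\mathcal M_3^s(\mathbb R)$ with $S=C^HA$. Consider the Lagrangian $\tilde{\mathcal L}:\mathbb L^2_{\#s}\times LP_0\to\mathbb R\cup\{+\infty\}$ defined by $$\tilde{\mathcal L}(\sigma,v)=\frac12\int_Y\langle D\sigma,\sigma\rangle\,dy+\langle\Lambda\sigma,v\rangle-\mathcal I_S^\star(v)\qquad\forall(\sigma,v)\in\mathbb L^2_{\#s}\times LP_0.$$ Then $$\inf_{\sigma\in\mathbb L^2_{\#s}}G(\sigma)=\inf_{\sigma\in\mathbb L^2_{\#s}}\ \sup_{v\in LP_0}\tilde{\mathcal L}(\sigma,v)=\tilde{\mathcal L}(\sigma_S,u_A)=\sup_{v\in LP_0}\ \inf_{\sigma\in\mathbb L^2_{\#s}}\tilde{\mathcal L}(\sigma,v),$$ where $\sigma_S$ is the solution of both minimization problems $\inf_{\sigma\in\mathbb T(S)}g(\sigma)$ and $\inf_{\sigma\in\mathbb L^2_{\#s}}G(\sigma)$, and $\nabla_s u_A$ is the solution of the minimization problem $\inf_{e\in\mathbb T(0)^\perp}k(e)$ with $k(e)=\frac12\int_Y\langle Ce,e\rangle\,dy-\langle S,\int_Y e\,dy\rangle$.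
   Context: Let $\mathcal G\subset\mathbb R^3$ be the lattice (additive group) generated by three linearly independent vectors $g_1,g_2,g_3$, and let $Y=\{s_1g_1+s_2g_2+s_3g_3: s_1,s_2,s_3\in[0,1]\}$. A function on $\mathbb R^3$ is $\mathcal G$-periodic if it is invariant under translations by vectors of $\mathcal G$. $\mathcal M_3^s(\mathbb R)$ is the space of real symmetric $3\times3$ matrices, $\langle\cdot,\cdot\rangle$ between matrices is the Frobenius inner product (also used for the duality pairing), $\nabla_s v$ is the symmetric part of the gradient of $v$, and $(\operatorname{div}\mu)_i=\sum_j\partial_j\mu_{ij}$ in the sense of distributions on $\mathbb R^3$. $H^1_\#$ is the space of $\mathcal G$-periodic vector fields in $H^1_{\rm loc}(\mathbb R^3,\mathbb R^3)$, with the $H^1(Y)$ norm; $H^1_{\#0}=\{v\in H^1_\#\mid\int_Y v\,dy=0\}$. For $A\in\mathcal M_3^s(\mathbb R)$, $LP(A)=\{u \mid u(y)=Ay+\varphi(y),\ \varphi\in H^1_\#\}$; $LP=\bigcup_{A\in\mathcal M_3^s(\mathbb R)}LP(A)$, a Hilbert space with dual $(LP)^\star$; $LP_0=\{v\in LP\mid\int_Y v\,dy=0\}$. $\mathbb L^2_{\#s}$ is the space of $\mathcal G$-periodic symmetric $3\times 3$ matrix fields in $L^2_{\rm loc}(\mathbb R^3)$, with the $L^2(Y)$ norm. $\mathbb T(S)=\{\mu\in\mathbb L^2_{\#s}\mid\operatorname{div}\mu=0,\ \frac1{|Y|}\int_Y\mu\,dy=S\}$ and $\mathbb T(0)^\perp=\{e\in\mathbb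 L^2_{\#s}\mid\int_Y\langle e,\mu\rangle\,dy=0\ \forall\mu\in\mathbb T(0)\}$. The rigidity tensor $C$ is a $\mathcal G$-periodic, measurable, essentially bounded field of fourth-order tensors on $\mathbb R^3$, with the usual symmetries of elasticity (for a.e. $y$, $C(y)$ is a self-adjoint linear map of $\mathcal M_3^s(\mathbb R)$ into itself), and uniformly positive definite: there is $\alpha>0$ with $\langle C(y)\xi,\xi\rangle\ge\alpha|\xi|^2$ for all $\xi\in\mathcal M_3^s(\mathbb R)$ and a.e. $y$. The compliance tensor is $D(y)=C(y)^{-1}$ (inverse on $\mathcal M_3^s(\mathbb R)$). $u_A\in LP_0\cap LP(A)$ is the unique solution of $\int_Y\langle C\,\nabla_s u_A,\nabla_s v\rangle\,dy=0$ for all $v\in H^1_{\#0}$. The homogenized tensor $C^H$ is the (invertible) linear map on $\mathcal M_3^s(\mathbb R)$ given by $C^HA=\frac1{|Y|}\int_Y C\,\nabla_s u_A\,dy$. $\Lambda:\mathbb L^2_{\#s}\to(LP)^\star$ is $\langle\Lambda\sigma,v\rangle=\int_Y\langle\sigma,\nabla_s v\rangle\,dy$; $\eta_S=\Lambda S$, i.e. $\eta_S(v)=\int_Y\langle S,\nabla_s v\rangle\,dy$; $\mathcal I_S(\eta)=0$ if $\eta=\eta_S$ and $+\infty$ otherwise, for $\eta\in(LP)^\star$; its Legendre–Fenchel transform is $\mathcal I_S^\star(v)=\sup_{\eta\in(LP)^\star}\{\langle\eta,v\rangle-\mathcal I_S(\eta)\}=\eta_S(v)$ for $v\in LP$. For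 $\sigma\in\mathbb L^2_{\#s}$: $g(\sigma)=\frac12\int_Y\langle D\sigma,\sigma\rangle\,dy$ and $G(\sigma)=g(\sigma)+\mathcal I_S(\Lambda\sigma)$. *)

(* Defs.v *)
(* Elements of Lebesgue and Sobolev spaces are represented by Borel functions;
   every space below is stable under modification on a null set (among Borel
   functions), and equality of elements is almost everywhere equality. *)
From HB Require Import structures.
From mathcomp Require Import all_boot all_order all_algebra.
From mathcomp Require Import all_classical all_reals all_analysis.

Set Implicit Arguments.
Unset Strict Implicit.
Unset Printing Implicit Defensive.

Import Order.TTheory GRing.Theory Num.Theory.
Import numFieldNormedType.Exports.

Local Open Scope classical_set_scope.
Local Open Scope ring_scope.

Section Space.
Context {R : realType}.

Definition R3 : Type :=
  (measurableTypeR R * measurableTypeR R * measurableTypeR R)%type.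

Definition leb3 : {measure set R3 -> \bar R} :=
  ((@lebesgue_measure R \x @lebesgue_measure R) \x @lebesgue_measure R)%E.

Definition vec (y : R3) : 'cV[R]_3 := \col_i [:: y.1.1; y.1.2; y.2]`_i.

Definition unit_vec (i : 'I_3) : R3 :=
  ((i == 0%N :> nat)%:R, (i == 1%N :> nat)%:R, (i == 2%N :> nat)%:R).

Definition frob m n (M N : 'M[R]_(m, n)) : R :=
  \sum_i \sum_j M i j * N i j.

Definition mx_sym (M : 'M[R]_3) : Prop := M^T = M.

Definition sym_part (M : 'M[R]_3) : 'M[R]_3 := 2^-1 *: (M + M^T).

Definition vfield : Type := R3 -> 'cV[R]_3.
Definition mfield : Type := R3 -> 'M[R]_3.

Definition ae_eq_field (s t : mfield) : Prop :=
  {ae leb3, forall y, s y = t y}.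

(* Components T_ijkl of a fourth-order tensor. *)
Definition tensor4 : Type := 'I_3 -> 'I_3 -> 'I_3 -> 'I_3 -> R.

Definition tapp (T : tensor4) (xi : 'M[R]_3) : 'M[R]_3 :=
  \matrix_(i, j) \sum_k \sum_l T i j k l * xi k l.

(* The value at [xi] of the inverse of [T] on symmetric matrices. *)
Definition compliance (T : tensor4) (xi : 'M[R]_3) : 'M[R]_3 :=
  get [set zeta | mx_sym zeta /\ tapp T zeta = xi].

Definition partial (i : 'I_3) (phi : R3 -> R) : R3 -> R :=
  fun y => 'D_(unit_vec i) phi y.

Definition smooth (phi : R3 -> R) : Prop :=
  forall l : seq 'I_3,
    continuous (foldr partial phi l) /\
    forall i y, derivable (foldr partial phi l) y (unit_vec i).

Definition test_function (phi : R3 -> R) : Prop :=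
  smooth phi /\ compact (closure [set y | phi y != 0]).

Definition L2loc (f : R3 -> R) : Prop :=
  measurable_fun setT f /\
  forall K : set R3, compact K ->
    (\int[leb3]_(y in K) ((f y) ^+ 2)%:E < +oo)%E.

Definition L2loc_mx m n (F : R3 -> 'M[R]_(m, n)) : Prop :=
  forall i j, L2loc (fun y => F y i j).

(* [Du y i j] is the distributional derivative of [u_i] along [j]. *)
Definition weak_gradient (u : vfield) (Du : mfield) : Prop :=
  forall (i j : 'I_3) phi, test_function phi ->
    \int[leb3]_y (u y i ord0 * partial j phi y) =
    - \int[leb3]_y (Du y i j * phi y).

Definition H1loc (u : vfield) : Prop :=
  L2loc_mx u /\ exists2 Du, L2loc_mx Du & weak_gradient u Du.

(* A representative of the weak gradient. *)
Definition grad (u : vfield) : mfield :=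
  get [set Du | L2loc_mx Du /\ weak_gradient u Du].

Definition sgrad (u : vfield) : mfield := fun y => sym_part (grad u y).

Definition div_free (mu : mfield) : Prop :=
  forall (i : 'I_3) phi, test_function phi ->
    \sum_j \int[leb3]_y (mu y i j * partial j phi y) = 0.

End Space.
Arguments R3 : clear implicits.
Arguments vfield : clear implicits.
Arguments mfield : clear implicits.
Arguments tensor4 : clear implicits.

Section Periodic.
Context {R : realType}.
Implicit Types (g : 'I_3 -> R3 R) (A S : 'M[R]_3).

Definition lin_indep g : Prop := row_free (\matrix_(i, j) vec (g i) j ord0).

Definition cell g : set (R3 R) :=
  [set y | exists2 s : 'I_3 -> R, (forall i, 0 <= s i <= 1) &
           y = \sum_i s i *: g i].

Definition cell_vol g : R := fine (leb3 (cell g)).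

(* Periodicity under the lattice generated by [g], up to null sets. *)
Definition lattice_periodic g (X : Type) (f : R3 R -> X) : Prop :=
  forall k : 'I_3 -> int,
    {ae leb3, forall y, f (y + \sum_i g i *~ k i) = f y}.

Definition cell_int g m n (F : R3 R -> 'M[R]_(m, n)) : 'M[R]_(m, n) :=
  \matrix_(i, j) \int[leb3]_(y in cell g) F y i j.

Definition pairing g m n (F H : R3 R -> 'M[R]_(m, n)) : R :=
  \int[leb3]_(y in cell g) frob (F y) (H y).

Definition H1per g : set (vfield R) := [set v | lattice_periodic g v /\ H1loc v].

Definition H1per0 g : set (vfield R) :=
  [set v | H1per g v /\ cell_int g v = 0].

Definition LPof g A : set (vfield R) :=
  [set u | exists2 phi, H1per g phi & forall y, u y = A *m vec y + phi y].

Definition LP g : set (vfield R) :=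
  [set u | exists2 A, mx_sym A & LPof g A u].

Definition LP0 g : set (vfield R) := [set u | LP g u /\ cell_int g u = 0].

Definition H1norm g (u : vfield R) : R :=
  Num.sqrt (pairing g u u + pairing g (grad u) (grad u)).

(* The bounded linear functionals on [LP g]; only their values on [LP g]
   matter.  Boundedness makes them insensitive to null sets. *)
Definition LPdual g : set (vfield R -> R) :=
  [set eta |
    (forall (a : R) u v, LP g u -> LP g v ->
       eta (fun y => a *: u y + v y) = a * eta u + eta v) /\
    exists c : R, forall u, LP g u -> `|eta u| <= c * H1norm g u].

Definition L2per g : set (mfield R) :=
  [set s | [/\ lattice_periodic g s, L2loc_mx s & {ae leb3, forall y, mx_sym (s y)}]].

(* The set T(S). *)
Definition admissible g S : set (mfield R) :=
  [set mu | [/\ L2per g mu, div_free mu &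
             (cell_vol g)^-1 *: cell_int g mu = S]].

(* The set T(0)^perp. *)
Definition compatible g : set (mfield R) :=
  [set e | L2per g e /\ forall mu, admissible g 0 mu -> pairing g e mu = 0].

End Periodic.

Section Homogenization.
Context {R : realType}.
Implicit Types (g : 'I_3 -> R3 R) (C : R3 R -> tensor4 R) (A S : 'M[R]_3).
Implicit Types (s e : mfield R) (u v : vfield R).

Record rigidity g C : Prop := {
  rigidity_periodic : lattice_periodic g C;
  rigidity_measurable :
    forall i j k l, measurable_fun setT (fun y => C y i j k l);
  rigidity_bounded : exists M : R,
    {ae leb3, forall y, forall i j k l, `|C y i j k l| <= M};
  rigidity_symmetric : {ae leb3, forall y, forall i j k l,
    C y i j k l = C y j i k l /\ C y i j k l = C y k l i j};
  rigidity_coercive : exists2 alpha : R, 0 < alpha &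
    {ae leb3, forall y, forall xi, mx_sym xi ->
       alpha * frob xi xi <= frob (tapp (C y) xi) xi} }.

Definition corrector g C A u : Prop :=
  [/\ LP0 g u, LPof g A u &
    forall v, H1per0 g v ->
      pairing g (fun y => tapp (C y) (sgrad u y)) (sgrad v) = 0].

(* C^H A; the value does not depend on the corrector which is picked, as
   correctors for [A] have a.e. equal strains. *)
Definition homogenized g C A : 'M[R]_3 :=
  let u := get [set u | corrector g C A u] in
  (cell_vol g)^-1 *: cell_int g (fun y => tapp (C y) (sgrad u y)).

Definition Lambda g s : vfield R -> R := fun v => pairing g s (sgrad v).

Definition eta_of g S : vfield R -> R := Lambda g (fun=> S).

Definition indic_of g S (eta : vfield R -> R) : \bar R :=
  if `[< forall v, LP g v -> eta v = eta_of g S v >] then 0%E else +oo%E.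

(* Legendre-Fenchel transform of [indic_of g S]. *)
Definition indic_of_star g S v : \bar R :=
  ereal_sup [set ((eta v)%:E - indic_of g S eta)%E | eta in LPdual g].

Definition stress_energy g C s : R :=
  2^-1 * pairing g (fun y => compliance (C y) (s y)) s.

Definition total_energy g C S s : \bar R :=
  ((stress_energy g C s)%:E + indic_of g S (Lambda g s))%E.

Definition lagrangian g C S s v : \bar R :=
  ((stress_energy g C s)%:E + (Lambda g s v)%:E - indic_of_star g S v)%E.

Definition strain_energy g C S e : R :=
  2^-1 * pairing g (fun y => tapp (C y) (e y)) e - frob S (cell_int g e).

Definition minimizer (E : set (mfield R)) (F : mfield R -> \bar R) s : Prop :=
  E s /\ forall t, E t -> (F s <= F t)%E.

Definition unique_minimizer (E : set (mfield R)) (F : mfield R -> \bar R) s :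
    Prop :=
  minimizer E F s /\ forall t, minimizer E F t -> ae_eq_field t s.

End Homogenization.

(* Main.v *)
(* The stress sigma = C (sgrad uA) is divergence free, because periodizations of test functions
   are allowed in the corrector equation, and its mean is S, because correctors have a.e. equal
   strains.  A div-curl lemma on the cell (a divergence free periodic field is orthogonal to
   periodic gradients) then gives Lambda s = eta_S on LP for every s in T(S), and sgrad uA in
   T(0)^perp.  If s = C e, completing the square gives
     g(s) = g(sigma) + <C (e - sgrad uA), e - sgrad uA> / 2 + (Lambda s - eta_S)(uA),
   and coercivity of C yields the three minimization results.  On LP the Lagrangian is
   g(s) + (Lambda s - eta_S)(v): its supremum over v is G(s), and its infimum over s at v = - uA
   is g(sigma) by the displayed identity. *)

(* The fields are merely square integrable, so the div-curl lemma cannot be obtained by integrating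
   by parts directly. No convergence of mollified fields is established: the pairing of two fields
   is the value at 0 of their correlation, a function of a translation [z]. This function is
   continuous because translations are continuous in L2, and its integrals against test functions
   involve only smooth kernels, on which integration by parts is legitimate. The passage from the
   whole space to the cell uses a smooth partition of unity indexed by the lattice, with a half-open
   cell as fundamental domain.

   [grad] and [compliance] are choices: identities on the former go through uniqueness of weak
   gradients, and the latter is replaced by an explicit inverse matrix, which depends measurably on
   the tensor.

   As the coupling enters the Lagrangian with a plus sign, a saddle point is [(sigma, - uA)]; the
   value at [(sigma, uA)] is the same because the Lagrangian at [sigma] does not depend on the field
   of [LP0]. *)
Require Import Defs.
From HB Require Import structures.
From mathcomp Require Import all_boot all_order all_algebra.
From mathcomp Require Import all_classical all_reals all_analysis.
From mathcomp Require Import measurable_realfun zify ring lra.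
Set Implicit Arguments.
Unset Strict Implicit.
Unset Printing Implicit Defensive.
Import Order.TTheory GRing.Theory Num.Theory.
Import numFieldNormedType.Exports.
Local Open Scope classical_set_scope.
Local Open Scope ring_scope.

(** * Lebesgue measure on the space *)

Section SigmaFiniteProducts.
Context {R : realType}.

(* The product measures below are convertible to those hidden in [leb3]; naming them lets their
   sigma-finiteness be declared, as Fubini's theorem and uniqueness of products require. *)
Definition leb2 : set (measurableTypeR R * measurableTypeR R) -> \bar R :=
  (@lebesgue_measure R \x @lebesgue_measure R)%E.

HB.instance Definition _ := Measure.on leb2.

Let leb2_sigma_finite : sigma_finite setT leb2.
Proof.
exists (fun n => `[- n%:R, n%:R]%classic `*` `[- n%:R, n%:R]%classic).
  apply/esym/seteqP; split => // -[x y] _.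
  have h (t : R) : `|t| <= (Num.bound `|t|)%:R by exact/ltW/archi_boundP.
  exists (maxn (Num.bound `|x|) (Num.bound `|y|)) => //.
  rewrite /= !in_itv/= -!ler_norml.
  split; [apply: le_trans (h x) _|apply: le_trans (h y) _].
    by rewrite ler_nat leq_maxl.
  by rewrite ler_nat leq_maxr.
move=> n; split; first by apply: measurableX; exact: measurable_itv.
rewrite /leb2 product_measure1E; [|exact: measurable_itv|exact: measurable_itv].
rewrite /= lebesgue_measure_itv /=; case: ifP => _; last by rewrite !mul0e.
by rewrite -!EFinB -!EFinM ltry.
Qed.

HB.instance Definition _ := Measure_isSigmaFinite.Build _ _ _ leb2
  leb2_sigma_finite.

Definition leb3s : set (R3 R) -> \bar R := (leb2 \x @lebesgue_measure R)%E.

HB.instance Definition _ := Measure.on leb3s.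

End SigmaFiniteProducts.

Section R3basics.
Context {R : realType}.
Implicit Types (y z a : R3 R) (f : R3 R -> R).

Lemma measurable_coord1 : measurable_fun setT (fun y : R3 R => y.1.1 : R).
Proof. exact: (measurableT_comp measurable_fst measurable_fst). Qed.

Lemma measurable_coord2 : measurable_fun setT (fun y : R3 R => y.1.2 : R).
Proof. exact: (measurableT_comp measurable_snd measurable_fst). Qed.

Lemma measurable_coord3 : measurable_fun setT (fun y : R3 R => y.2 : R).
Proof. exact: measurable_snd. Qed.

Lemma ball_R3E y (e : R) :
  ball y e = (ball (y.1.1 : R) e `*` ball (y.1.2 : R) e) `*` ball (y.2 : R) e.
Proof. by []. Qed.

Lemma measurable_ball_R3 y (e : R) : measurable (ball y e : set (R3 R)).
Proof.
rewrite ball_R3E; apply: measurableX; last exact: (measurable_realfun.measurable_ball).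
by apply: measurableX; exact: (measurable_realfun.measurable_ball).
Qed.

(** The measurable sets are those of the product sigma-algebra. Balls of the sup norm are products
    of intervals, and an open set is the union of the countably many balls of rational centre and
    radius [1 / (n + 1)] that it contains. *)
Lemma open_measurable_R3 (U : set (R3 R)) : open U -> measurable U.
Proof.
move=> oU.
pose q (r : rat * rat * rat) : R3 R := (ratr r.1.1, ratr r.1.2, ratr r.2).
pose B (p : rat * rat * rat * nat) : set (R3 R) := ball (q p.1) (p.2.+1%:R^-1).
have -> : U = \bigcup_(p in [set p | B p `<=` U]) B p.
  apply/seteqP; split => [y Uy|y [p pU]]; last exact: pU.
  have /nbhs_ballP[e /= e0 eU] : nbhs y U by exact: open_nbhs_nbhs.
  have [n ne] : exists n : nat, n.+1%:R^-1 < e / 2.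
    have /= := near_infty_natSinv_lt (PosNum (divr_gt0 e0 (ltr0n R 2))).
    by case=> n _ /(_ n (leqnn n)) ?; exists n.
  have h (t : R) : exists r : rat, ball (ratr r : R) n.+1%:R^-1 t.
    have /rat_in_itvoo[r] : t - n.+1%:R^-1 < t + n.+1%:R^-1.
      by rewrite ltrD2l gtrN// invr_gt0.
    by rewrite in_itv/= => tr; exists r; rewrite /ball/= ltr_distl.
  have [r1 h1] := h y.1.1; have [r2 h2] := h y.1.2; have [r3 h3] := h y.2.
  have By : B (r1, r2, r3, n) y by rewrite /B ball_R3E.
  exists (r1, r2, r3, n) => // z Bz; apply: eU.
  rewrite [e](_ : _ = e / 2 + e / 2); last by field.
  apply: (@ball_triangle _ _ (q (r1, r2, r3))).
    by apply: ball_sym; apply: le_ball By; exact: ltW.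
  by apply: le_ball Bz; exact: ltW.
rewrite bigcup_mkcond; apply: countable_bigcupT_measurable => // p.
by case: ifPn => // _; exact: measurable_ball_R3.
Qed.

Lemma continuous_measurable_R3 f : continuous f -> measurable_fun setT f.
Proof.
move=> /continuousP cf; apply: (measurability _ (measurable_realfun.RGenOpens.measurableE R)).
move=> _ [_ [a [b ->] <-]]; rewrite setTI; apply: open_measurable_R3.
exact/cf/interval_open.
Qed.

(** The closed ball of the sup norm, as a product: its compactness, measurability and volume come
    from the factors. *)
Definition box (r : R) : set (R3 R) :=
  (`[- r, r]%classic `*` `[- r, r]%classic) `*` `[- r, r]%classic.

Lemma boxE r y : box r y <-> `|y| <= r.
Proof.
rewrite /box /= !in_itv /= -!ler_norml !prod_normE !ge_max.
by split => [[[-> ->] ->]|/andP[/andP[]]].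
Qed.

Lemma compact_box r : compact (box r).
Proof.
apply: compact_setX; last exact: segment_compact.
by apply: compact_setX; exact: segment_compact.
Qed.

Lemma measurable_box r : measurable (box r).
Proof.
by apply: measurableX; [apply: measurableX|]; exact: measurable_itv.
Qed.

Lemma compact_sub_box (K : set (R3 R)) : compact K -> exists r, K `<=` box r.
Proof.
move=> /compact_bounded [M [_ hM]]; exists (M + 1) => y Ky; apply/boxE.
by apply: hM => //; rewrite ltrDl.
Qed.

Lemma measurable_compact (K : set (R3 R)) : compact K -> measurable K.
Proof.
move=> cK; rewrite -(setCK K); apply: measurableC; apply: open_measurable_R3.
by rewrite openC; exact: compact_closed cK.
Qed.

Lemma leb3_box_lty r : (leb3 (box r) < +oo)%E.
Proof.
rewrite /leb3 /box [X in (X < _)%E]product_measure1E; [|by apply: measurableX; exact: measurable_itv|exact: measurable_itv].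
rewrite [X in (X * _)%E]product_measure1E; [|exact: measurable_itv|exact: measurable_itv].
rewrite /= lebesgue_measure_itv /=; case: ifP => _; last by rewrite !mul0e.
by rewrite -!EFinB -!EFinM ltry.
Qed.

Definition translate a y : R3 R := y + a.

Lemma measurable_translate a : measurable_fun setT (translate a).
Proof.
have sh (b : R) : measurable_fun setT (fun t : measurableTypeR R => t + b : measurableTypeR R).
  exact: measurable_funD.
apply: measurable_fun_pair; last first.
  exact: (measurableT_comp (sh a.2) measurable_coord3).
apply: measurable_fun_pair.
  exact: (measurableT_comp (sh a.1.1) measurable_coord1).
exact: (measurableT_comp (sh a.1.2) measurable_coord2).
Qed.

Let shift1 (b : R) (t : measurableTypeR R) : measurableTypeR R := t + b.

Let shift2 (b : R * R) (t : measurableTypeR R * measurableTypeR R) :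
  measurableTypeR R * measurableTypeR R := t + b.

Let measurable_shift1 b : measurable_fun setT (shift1 b).
Proof. exact: measurable_funD. Qed.

Let measurable_shift2 b : measurable_fun setT (shift2 b).
Proof.
apply: measurable_fun_pair.
  exact: (measurableT_comp (measurable_shift1 b.1) measurable_fst).
exact: (measurableT_comp (measurable_shift1 b.2) measurable_snd).
Qed.

Let lebesgue_measure_shift (b : R) (A : set (measurableTypeR R)) :
  measurable A ->
  pushforward lebesgue_measure (shift1 b) A = lebesgue_measure A.
Proof.
move=> mA; apply/esym/lebesgue_measure_unique => //= _ [[x y]] _ <-.
rewrite /pushforward /=.
rewrite (_ : _ @^-1` _ = `]x - b, y - b]%classic); last first.
  by apply/seteqP; split => t /=; rewrite !in_itv/= ltrBlDr lerBrDr.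
rewrite !lebesgue_measure_itv/= !lte_fin ltrD2r; case: ifP => // _.
by rewrite -!EFinB; congr EFin; ring.
Qed.

Let leb2_shift (b : R * R) (A : set (measurableTypeR R * measurableTypeR R)) :
  measurable A -> pushforward leb2 (shift2 b) A = leb2 A.
Proof.
move=> mA; apply/esym.
have := @product_measure_unique _ _ _ _ _ (@lebesgue_measure R)
  (@lebesgue_measure R)
  (measure_function_pushforward__canonical__measure_function_Measure leb2
    (measurable_shift2 b)).
apply => // X Y mX mY; transitivity (pushforward lebesgue_measure (shift1 b.1) X *
  pushforward lebesgue_measure (shift1 b.2) Y)%E; last first.
  by congr (_ * _)%E; exact: lebesgue_measure_shift.
apply: (@product_measure1E _ _ _ _ _ (@lebesgue_measure R)
  (@lebesgue_measure R)).
  by rewrite -[X in measurable X]setTI; exact: measurable_shift1.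
by rewrite -[X in measurable X]setTI; exact: measurable_shift1.
Qed.

(** The pushforward under a translation agrees with the measure on products of measurable sets, by
    invariance in each factor; uniqueness of the product measure extends this to all measurable
    sets. *)
Lemma leb3_translate a (A : set (R3 R)) : measurable A ->
  leb3 (translate a @^-1` A) = leb3 A.
Proof.
move=> mA; apply/esym.
have := @product_measure_unique _ _
  (measurableTypeR R * measurableTypeR R)%type (measurableTypeR R) R leb2 (@lebesgue_measure R)
  (measure_function_pushforward__canonical__measure_function_Measure leb3
    (measurable_translate a)).
apply => // X Y mX mY; transitivity (pushforward leb2 (shift2 a.1) X *
  pushforward lebesgue_measure (shift1 a.2) Y)%E; last first.
  by congr (_ * _)%E; [exact: leb2_shift|exact: lebesgue_measure_shift].
apply: (@product_measure1E _ _ (measurableTypeR R * measurableTypeR R)%type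
  (measurableTypeR R) R leb2 (@lebesgue_measure R)).
  by rewrite -[X in measurable X]setTI; exact: measurable_shift2.
by rewrite -[X in measurable X]setTI; exact: measurable_shift1.
Qed.

Lemma ge0_integral_translate a (D : set (R3 R)) (f : R3 R -> \bar R) : measurable D ->
  measurable_fun D f -> (forall y, D y -> 0 <= f y)%E ->
  (\int[leb3]_(y in translate a @^-1` D) f (translate a y) = \int[leb3]_(y in D) f y)%E.
Proof.
move=> mD mf f0.
have f0' : {in D, forall y, (0 <= f y)%E} by move=> y; rewrite inE => /f0.
apply: etrans (esym (ge0_integral_pushforward (measurable_translate a) leb3
  mD mf f0')) _.
apply: (@eq_measure_integral _ _ _ _ leb3
  (measure_function_pushforward__canonical__measure_function_Measure leb3
    (measurable_translate a))) => A mA _.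
exact: leb3_translate.
Qed.

Lemma integral_translate a (D : set (R3 R)) (f : R3 R -> R) : measurable D ->
  measurable_fun D f ->
  \int[leb3]_(y in translate a @^-1` D) f (translate a y) = \int[leb3]_(y in D) f y.
Proof.
move=> mD mf; rewrite /Rintegral; congr fine.
have mf' : measurable_fun D (EFin \o f) by exact/measurable_EFinP.
have E1 := ge0_integral_translate a mD (measurable_funepos mf')
  (fun y _ => funepos_ge0 (EFin \o f) y).
have E2 := ge0_integral_translate a mD (measurable_funeneg mf')
  (fun y _ => funeneg_ge0 (EFin \o f) y).
rewrite integralE [RHS]integralE.
congr (_ - _)%E.
  by apply: etrans _ E1; apply: eq_integral => y _; rewrite !funeposE.
by apply: etrans _ E2; apply: eq_integral => y _; rewrite !funenegE.
Qed.

Lemma integrable_translate a (D : set (R3 R)) (f : R3 R -> R) : measurable D ->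
  measurable_fun setT f -> leb3.-integrable D (EFin \o f) ->
  leb3.-integrable (translate a @^-1` D) (EFin \o (fun y => f (translate a y))).
Proof.
move=> mD mf /integrableP[_ fi]; apply/integrableP; split.
  apply/measurable_EFinP; apply: measurable_funTS.
  exact: (measurableT_comp mf (measurable_translate a)).
apply: le_lt_trans fi; rewrite le_eqVlt; apply/orP; left; apply/eqP.
apply: (@ge0_integral_translate a D (fun y => `|(f y)%:E|%E)) => //.
by apply: measurableT_comp => //; apply/measurable_EFinP; exact: measurable_funTS.
Qed.

End R3basics.

(** * Smooth functions and test functions *)

Section Smooth.
Context {R : realType}.
Implicit Types (f g : R3 R -> R) (y v a : R3 R) (i j : 'I_3) (n k : nat).

(** Reduces directional derivatives to derivatives in one real variable, where the chain rule and
    the mean value theorem are available. *)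
Lemma is_derive_line f v y (t d : R) :
  is_derive (t *: v + y) v f d <-> is_derive t 1 (fun s : R => f (s *: v + y)) d.
Proof.
have E : (fun h : R => h^-1 *: ((f \o shift (t *: v + y)) (h *: v) - f (t *: v + y)))
    = (fun h : R => h^-1 *: (((fun s : R => f (s *: v + y)) \o shift t) (h *: (1 : R)) -
        f (t *: v + y))).
  apply/funext => h /=; congr (_ *: (f _ - _)).
  by rewrite [h *: (1 : R)]mulr1 scalerDl addrA.
split=> -[]; rewrite /derivable /derive.
  by rewrite E => df dfE; split.
by rewrite /derivable /derive -E => df dfE; split; rewrite /derivable /derive.
Qed.

Lemma is_derive_along f v y (d : R) :
  is_derive y v f d <-> is_derive (0 : R) 1 (fun s : R => f (s *: v + y)) d.
Proof. by rewrite -is_derive_line scale0r add0r. Qed.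

Lemma is_derive_affine f v y a (s d : R) : is_derive (s *: y + a) v f d ->
  is_derive y v (fun y => f (s *: y + a)) (s * d).
Proof.
move=> h; apply/is_derive_along.
rewrite (_ : (fun _ => _) = (fun t : R => f (t *: v + (s *: y + a))) \o (fun t : R => s * t)); last first.
  by apply/funext => t /=; rewrite scalerDr scalerA addrA.
rewrite mulrC; apply: is_derive1_comp.
  by rewrite mulr0; apply/is_derive_along.
apply: (@is_derive_eq _ _ _ _ _ _ _ (s *: (1 : R))); last by rewrite [LHS]mulr1.
Qed.

Lemma is_derive_comp (h : R -> R) f v y (d e : R) :
  is_derive y v f d -> is_derive (f y) 1 h e -> is_derive y v (h \o f) (e * d).
Proof.
move=> /is_derive_along fd hd; apply/is_derive_along.
by apply: (@is_derive1_comp _ h (fun s : R => f (s *: v + y))) => //; rewrite scale0r add0r.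
Qed.

(* Unlike [smooth], this is by recursion on the order and accepts any expression of the
   derivatives, which makes closure properties provable by induction. *)
Fixpoint smooth_to n f : Prop :=
  continuous f /\
  if n is k.+1 then
    forall i, exists2 g, (forall y, is_derive y (unit_vec i) f (g y)) & smooth_to k g
  else True.

Lemma smooth_to_continuous n f : smooth_to n f -> continuous f.
Proof. by case: n => [|n] []. Qed.

Lemma smooth_toS n f : smooth_to n.+1 f -> smooth_to n f.
Proof.
elim: n f => [|n IHn] f; first by case.
move=> [cf h]; split=> // i; have [g gd sg] := h i.
by exists g => //; apply: IHn.
Qed.

Lemma smoothP f : smooth f <-> forall n, smooth_to n f.
Proof.
split=> [sf n|sf].
  elim: n f sf => [|n IHn] f sf; first by split=> //; exact: (sf [::]).1.
  split; first exact: (sf [::]).1.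
  move=> i; exists (partial i f).
    by move=> y; apply: DeriveDef => //; exact: (sf [::]).2.
  by apply: IHn => l; have := sf (rcons l i); rewrite foldr_rcons.
(* [foldr] applies the last index of the list first, so the innermost derivative is peeled off at
   the right end. *)
move=> l; elim/last_ind: l f sf => [|l i IHl] f sf.
  split; first exact: smooth_to_continuous (sf 0%N).
  by move=> i y; have [_ /(_ i)[g gd _]] := sf 1%N; have [] := gd y.
rewrite foldr_rcons; apply: IHl => n; have [_ /(_ i)[g gd sg]] := sf n.+1.
by rewrite (_ : partial i f = g)//; apply/funext => y; have [] := gd y.
Qed.

Lemma smooth_is_derive f i y : smooth f -> is_derive y (unit_vec i) f (partial i f y).
Proof. by move=> sf; apply: DeriveDef => //; exact: (sf [::]).2. Qed.

Lemma smooth_partial f i : smooth f -> smooth (partial i f).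
Proof. by move=> sf l; have := sf (rcons l i); rewrite foldr_rcons. Qed.

Lemma smooth_continuous f : smooth f -> continuous f.
Proof. by move=> sf; exact: (sf [::]).1. Qed.

Lemma is_derive_partial f i y d : is_derive y (unit_vec i) f d -> partial i f y = d.
Proof. by case. Qed.

Lemma smooth_to_cst n (c : R) : smooth_to n (fun=> c).
Proof.
elim: n c => [|n IHn] c; split=> //; try exact: cst_continuous.
by move=> i; exists (fun=> 0) => // y; exact: is_derive_cst.
Qed.

Lemma smooth_toD n f g : smooth_to n f -> smooth_to n g -> smooth_to n (fun y => f y + g y).
Proof.
elim: n f g => [|n IHn] f g [cf hf] [cg hg]; split=> //; try by move=> y; exact: cvgD (cf y) (cg y).
move=> i; have [f' fd sf] := hf i; have [g' gd sg] := hg i.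
by exists (fun y => f' y + g' y) => [y|]; [exact: is_deriveD|exact: IHn].
Qed.

Lemma smooth_toM n f g : smooth_to n f -> smooth_to n g -> smooth_to n (fun y => f y * g y).
Proof.
elim: n f g => [|n IHn] f g sf sg; have [cf hf] := sf; have [cg hg] := sg.
  split; last by [].
  move=> y; apply: cvgM; first exact: cf. exact: cg.
split; first by move=> y; apply: cvgM; [exact: cf|exact: cg].
move=> i; have [f' fd sf'] := hf i; have [g' gd sg'] := hg i.
exists (fun y => f y * g' y + g y * f' y) => [y|]; first exact: is_deriveM.
by apply: smooth_toD; apply: IHn => //; exact: smooth_toS.
Qed.

Lemma smooth_toV n f : (forall y, f y != 0) -> smooth_to n f ->
  smooth_to n (fun y => (f y)^-1).
Proof.
move=> f0; elim: n => [|n IHn] sf; have [cf hf] := sf.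
  split; last by [].
  move=> y; apply: cvgV; first exact: f0. exact: cf.
split; first by move=> y; apply: cvgV; [exact: f0|exact: cf].
move=> i; have [f' fd sf'] := hf i.
exists (fun y => -1 * ((f y)^-1 * (f y)^-1) * f' y) => [y|].
  have [df dfE] := fd y; apply: DeriveDef; first exact: derivableV.
  by rewrite deriveV// dfE mulN1r -exprVn expr2.
have /IHn sV := smooth_toS sf.
apply: smooth_toM => //; apply: smooth_toM; last exact: smooth_toM.
exact: smooth_to_cst.
Qed.

Lemma smooth_to_affine n f (s : R) a : smooth_to n f ->
  smooth_to n (fun y => f (s *: y + a)).
Proof.
have caf : continuous (fun y : R3 R => s *: y + a).
  move=> y; apply: cvgD; last exact: cvg_cst.
  by apply: cvgZr; exact: cvg_id.
elim: n f => [|n IHn] f [cf hf]; split=> //;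
  try by move=> y; apply: (continuous_comp (caf y)); exact: cf.
move=> i; have [g gd sg] := hf i; exists (fun y => s * g (s *: y + a)).
  by move=> y; exact: is_derive_affine.
by apply: smooth_toM; [exact: smooth_to_cst|exact: IHn].
Qed.

Lemma is_derive_additive_homogeneous f v y :
  (forall (h : R) z, f (h *: v + z) = h * f v + f z) -> is_derive y v f (f v).
Proof.
move=> fl; apply/is_derive_along.
rewrite (_ : (fun _ => _) = (fun s : R => s * f v + f y)); last first.
  by apply/funext => s; rewrite fl.
apply: (@is_derive_eq _ _ _ _ _ _ _ (1 * f v + 0)); last by rewrite mul1r addr0.
apply: is_deriveD.
have := @is_deriveM _ _ id (cst (f v)) (0 : R) 1 1 0 (is_derive_id _ _) (is_derive_cst _ _ _).
by rewrite scaler0 add0r [_ *: _]mulrC.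
Qed.

Lemma smooth_to_linear n f : continuous f ->
  (forall (h : R) v z, f (h *: v + z) = h * f v + f z) -> smooth_to n f.
Proof.
move=> cf fl; case: n => [|n]; split=> // i.
exists (fun=> f (unit_vec i)) => [y|]; last exact: smooth_to_cst.
exact: is_derive_additive_homogeneous.
Qed.

End Smooth.

(** * A flat exponential, bumps and smooth steps *)

Section SpecialFunctions.
Context {R : realType}.
Implicit Types (f g : R3 R -> R) (y v a : R3 R) (i j : 'I_3) (n k : nat).

(* Keeping the power of [t^-1] as a parameter makes this family stable under derivation. *)
Definition flat k (t : R) : R :=
  if 0 < t then t^-1 ^+ k * expR (- t^-1) else 0.

Lemma flat_gt0 k t : 0 < t -> 0 < flat k t.
Proof. by move=> t0; rewrite /flat t0 mulr_gt0 ?expR_gt0// exprn_gt0// invr_gt0. Qed.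

Lemma flat_le0 k t : t <= 0 -> flat k t = 0.
Proof. by rewrite /flat leNgt => /negbTE ->. Qed.

Lemma flat_ge0 k t : 0 <= flat k t.
Proof. by have [/(flat_gt0 k)/ltW//|/(flat_le0 k)->] := ltP 0 t. Qed.

Lemma flatS k t : flat k.+1 t = t^-1 * flat k t.
Proof. by rewrite /flat; case: ifP => _; rewrite ?mulr0// exprS mulrA. Qed.

(** With [x = t^-1], the bound [x ^+ (k + 2) <= (k + 2)! * expR x] gives quadratic decay at 0. Hence
    every [flat k] has derivative 0 there, whatever the power of [t^-1]. *)
Lemma flat_le_sqr k (t : R) : flat k t <= k.+2`!%:R * t ^+ 2.
Proof.
have [t0|t0] := ltP 0 t; last by rewrite flat_le0// mulr_ge0// sqr_ge0.
rewrite /flat t0 expRN; set x := t^-1.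
have x0 : 0 < x by rewrite invr_gt0.
have tx : t * x = 1 by rewrite mulfV// gt_eqF.
rewrite ler_pdivrMr ?expR_gt0//.
have -> : x ^+ k = t ^+ 2 * x ^+ k.+2.
  have -> : x ^+ k.+2 = x ^+ k * x ^+ 2 by rewrite -exprD addn2.
  by rewrite mulrCA -exprMn tx expr1n mulr1.
rewrite (_ : _ * expR x = t ^+ 2 * (k.+2`!%:R * expR x)); last by ring.
apply: ler_wpM2l; first exact: sqr_ge0.
rewrite -ler_pdivrMl ?ltr0n ?fact_gt0//.
by apply: le_trans (expR_ge1Dxn k.+1 (ltW x0)); rewrite mulrC lerDr.
Qed.

Lemma is_derive_limit (V W : normedModType R) (f : V -> W) (a v : V) (d : W) :
  h^-1 *: ((f \o shift a) (h *: v) - f a) @[h --> 0^'] --> d -> is_derive a v f d.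
Proof.
move=> h; apply: DeriveDef; first by apply/cvg_ex; exists d.
exact: (cvg_lim (@norm_hausdorff _ _) h).
Qed.

Lemma is_derive_flat0 k : is_derive (0 : R) 1 (flat k) 0.
Proof.
apply: is_derive_limit; apply/cvgr0Pnorm_lt => e e0.
rewrite /= (flat_le0 k (lexx 0)).
have c0 : 0 < k.+2`!%:R :> R by rewrite ltr0n fact_gt0.
near=> h.
have h0 : h != 0 by near: h; exact: nbhs_dnbhs_neq.
rewrite subr0 normrM normrV ?unitfE// addr0 [h *: _]mulr1.
rewrite (ger0_norm (flat_ge0 _ _)) mulrC ltr_pdivrMr ?normr_gt0//.
apply: le_lt_trans (flat_le_sqr _ _) _.
rewrite -(real_normK (num_real h)) expr2 mulrA ltr_pM2r ?normr_gt0//.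
rewrite mulrC -ltr_pdivlMr//.
near: h; apply: dnbhs0_lt; exact: divr_gt0.
Unshelve. all: by end_near. Qed.

Lemma is_derive_flat k (t : R) :
  is_derive t 1 (flat k) (flat k.+2 t - k%:R * flat k.+1 t).
Proof.
have [t0|t0|->] := ltgtP t 0; last first.
- by apply: (is_derive_eq (is_derive_flat0 k)); rewrite !flat_le0// mulr0 subr0.
- elim: k => [|k IHk].
    apply: (@near_eq_is_derive R R R (fun s : R => expR (- s^-1)) (flat 0) t 1).
      near=> s; rewrite /flat ifT ?expr0 ?mul1r//; near: s; exact: lt_nbhsr.
    have t1 : t != 0 by rewrite gt_eqF.
    have dV := @is_deriveV R id t 1 1 t1 (is_derive_id _ _).
    have dN : is_derive t 1 (fun s : R => - s^-1) (- (- t ^- 2 *: (1 : R))).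
      exact: is_deriveN dV.
    have dC : is_derive t 1 (fun s : R => expR (- s^-1))
        (expR (- t^-1) * - (- t ^- 2 *: (1 : R))).
      by apply: (@is_derive1_comp _ expR (fun s : R => - s^-1)); exact: is_derive_expR.
    apply: (is_derive_eq dC).
    rewrite /flat t0 mul0r subr0 mulrC; congr (_ * _).
    by rewrite [_ *: _]mulr1 opprK exprVn.
  rewrite (_ : flat k.+1 = (fun s => s^-1) * flat k); last first.
    by apply/funext => s; rewrite flatS.
  have t1 : t != 0 by rewrite gt_eqF.
  have dV := @is_deriveV R id t 1 1 t1 (is_derive_id _ _).
  apply: (is_derive_eq (is_deriveM dV IHk)).
  rewrite /= !flatS [- _ *: 1]mulr1 -natr1 -exprVn.
  rewrite -![_ *: _]/(_ * _); ring.
apply: (@near_eq_is_derive R R R (cst 0) (flat k) t 1).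
  near=> s; rewrite flat_le0//; apply: ltW; near: s; exact: lt_nbhsl.
by apply: (is_derive_eq (is_derive_cst _ _ _)); rewrite !flat_le0 ?ltW// mulr0 subr0.
Unshelve. all: by end_near. Qed.

Lemma continuous_flat k : continuous (flat k).
Proof.
move=> t; apply: differentiable_continuous; apply/derivable1_diffP.
by have [] := is_derive_flat k t.
Qed.

Lemma smooth_to_flat n k f : smooth_to n f -> smooth_to n (fun y => flat k (f y)).
Proof.
elim: n k f => [|n IHn] k f sf; have [cf hf] := sf.
  by split; [move=> y; apply: continuous_comp; [exact: cf|exact: continuous_flat]|].
split; first by move=> y; apply: continuous_comp; [exact: cf|exact: continuous_flat].
move=> i; have [f' fd sf'] := hf i.
exists (fun y => (flat k.+2 (f y) + (- k%:R) * flat k.+1 (f y)) * f' y).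
  move=> y; rewrite mulNr; apply: (@is_derive_comp _ (flat k)) => //.
  exact: is_derive_flat.
have sf0 := smooth_toS sf.
apply: smooth_toM => //; apply: smooth_toD; first exact: IHn.
by apply: smooth_toM; [exact: smooth_to_cst|exact: IHn].
Qed.

Lemma smooth_to_coord n :
  [/\ smooth_to n (fun y : R3 R => y.1.1 : R), smooth_to n (fun y : R3 R => y.1.2 : R)
    & smooth_to n (fun y : R3 R => y.2 : R)].
Proof.
split; apply: smooth_to_linear => //.
- by move=> y; apply: continuous_comp; [exact: cvg_fst|exact: cvg_fst].
- by move=> y; apply: continuous_comp; [exact: cvg_fst|exact: cvg_snd].
- by move=> y; exact: cvg_snd.
Qed.

(** For [r > 0], a bump which is positive exactly on the open ball of radius [r] of the sup norm.
    Its integral is not normalised: only its sign and its support matter. *)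
Definition mollifier (r : R) y : R :=
  flat 0 (1 - (r^-1 * y.1.1) ^+ 2) * flat 0 (1 - (r^-1 * y.1.2) ^+ 2) *
  flat 0 (1 - (r^-1 * y.2) ^+ 2).

Lemma smooth_mollifier r : smooth (mollifier r).
Proof.
apply/smoothP => n; have [s1 s2 s3] := smooth_to_coord n.
have s (f : R3 R -> R) : smooth_to n f -> smooth_to n (fun y => flat 0 (1 - (r^-1 * f y) ^+ 2)).
  move=> sf; apply: smooth_to_flat.
  rewrite (_ : (fun _ => _) = (fun y => 1 + (- (r^-1 * r^-1)) * (f y * f y))); last first.
    by apply/funext => y; ring.
  apply: smooth_toD; first exact: smooth_to_cst.
  by apply: smooth_toM; [exact: smooth_to_cst|exact: smooth_toM].
by apply: smooth_toM; [apply: smooth_toM|]; exact: s.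
Qed.

Lemma mollifier_ge0 r y : 0 <= mollifier r y.
Proof. by rewrite /mollifier !mulr_ge0// flat_ge0. Qed.

Let flat_neq0 (r t : R) : 0 < r -> (0 < flat 0 (1 - (r^-1 * t) ^+ 2)) = (`|t| < r).
Proof.
move=> r0; have -> : (0 < flat 0 (1 - (r^-1 * t) ^+ 2)) = (0 < 1 - (r^-1 * t) ^+ 2).
  apply/idP/idP => [|/flat_gt0//]; apply: contraTT; rewrite -!leNgt => h.
  by rewrite flat_le0.
rewrite subr_gt0 -(real_normK (num_real (_ * _))) expr_lt1// normrM normfV.
by rewrite (gtr0_norm r0) mulrC ltr_pdivrMr// mul1r.
Qed.

Lemma mollifier_gt0 r y : 0 < r -> (0 < mollifier r y) = (`|y| < r).
Proof.
move=> r0; rewrite !prod_normE !gt_max -!(flat_neq0 _ r0) /mollifier.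
rewrite !lt_def !mulf_eq0 !negb_or !mulr_ge0 ?flat_ge0// !andbT.
by [].
Qed.

(** The denominator never vanishes, as [t] and [1 - t] are not both nonpositive. The function rises
    from 0 to 1 over [[0, 1]], so that sums of differences of its unit translates telescope to 1. *)
Definition smooth_step (t : R) : R := flat 0 t / (flat 0 t + flat 0 (1 - t)).

Let step_den t : flat 0 t + flat 0 (1 - t) != 0.
Proof.
rewrite gt_eqF//; have [t0|t0] := ltP 0 t.
  by rewrite ltr_wpDr ?flat_ge0 ?flat_gt0.
by rewrite ltr_wpDl ?flat_ge0// flat_gt0//; lra.
Qed.

Lemma smooth_step_le0 t : t <= 0 -> smooth_step t = 0.
Proof. by move=> t0; rewrite /smooth_step flat_le0// mul0r. Qed.

Lemma smooth_step_ge1 t : 1 <= t -> smooth_step t = 1.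
Proof.
move=> t1; have := step_den t; rewrite /smooth_step (_ : flat 0 (1 - t) = 0); last first.
  by rewrite flat_le0//; lra.
by rewrite addr0 => h; rewrite divff.
Qed.

Lemma smooth_to_step n f : smooth_to n f -> smooth_to n (fun y => smooth_step (f y)).
Proof.
move=> sf; have s0 := smooth_to_flat 0 sf.
apply: smooth_toM => //; apply: smooth_toV => [y|]; first exact: step_den.
apply: smooth_toD => //; apply: smooth_to_flat.
apply: smooth_toD; first exact: smooth_to_cst.
rewrite (_ : (fun _ => _) = (fun y => -1 * f y)); last by apply/funext => y; rewrite mulN1r.
by apply: smooth_toM => //; exact: smooth_to_cst.
Qed.

End SpecialFunctions.

(** * Integrals of real-valued functions *)

Section RealIntegrable.
Context d (T : measurableType d) (R : realType) (mu : {measure set T -> \bar R}).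
Context (D : set T) (mD : measurable D).
Implicit Types f g : T -> R.

Lemma integrable_realD f g : mu.-integrable D (EFin \o f) ->
  mu.-integrable D (EFin \o g) -> mu.-integrable D (EFin \o (fun x => f x + g x)).
Proof. by move=> fi gi; have := integrableD mD fi gi. Qed.

Lemma integrable_realB f g : mu.-integrable D (EFin \o f) ->
  mu.-integrable D (EFin \o g) -> mu.-integrable D (EFin \o (fun x => f x - g x)).
Proof. by move=> fi gi; have := integrableB mD fi gi. Qed.

Lemma integrable_realZ (k : R) f : mu.-integrable D (EFin \o f) ->
  mu.-integrable D (EFin \o (fun x => k * f x)).
Proof. by move=> fi; have := integrableZl mD k fi. Qed.

Lemma integrable_real0 : mu.-integrable D (EFin \o (fun=> 0 : R)).
Proof. exact: integrable0. Qed.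

Lemma integrable_real_sum (I : Type) (s : seq I) (P : pred I) (F : I -> T -> R) :
  (forall i, P i -> mu.-integrable D (EFin \o F i)) ->
  mu.-integrable D (EFin \o (fun x => \sum_(i <- s | P i) F i x)).
Proof.
move=> h; have := integrable_sum mD s h; apply: eq_integrable => // x _ /=.
by rewrite sumEFin.
Qed.

Lemma Rintegral_sum (I : Type) (s : seq I) (P : pred I) (F : I -> T -> R) :
  (forall i, P i -> mu.-integrable D (EFin \o F i)) ->
  \int[mu]_(x in D) (\sum_(i <- s | P i) F i x) =
  \sum_(i <- s | P i) \int[mu]_(x in D) F i x.
Proof.
move=> h; elim: s => [|i s IHs].
  rewrite big_nil; under eq_Rintegral do rewrite big_nil.
  by rewrite /Rintegral integral0.
rewrite big_cons; under eq_Rintegral do rewrite big_cons.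
case: ifPn => // Pi; rewrite RintegralD ?IHs//; first exact: h.
exact: integrable_real_sum.
Qed.

Lemma Rintegral_dominated_cvg (F : nat -> T -> R) f g :
  (forall n, measurable_fun D (F n)) -> measurable_fun D f ->
  {ae mu, forall x, D x -> F n x @[n --> \oo] --> f x} ->
  mu.-integrable D (EFin \o g) -> (forall n x, D x -> `|F n x| <= g x) ->
  mu.-integrable D (EFin \o f) /\
  \int[mu]_(x in D) F n x @[n --> \oo] --> \int[mu]_(x in D) f x.
Proof.
move=> mF mf Ff ig Fg.
have iF n : mu.-integrable D (EFin \o F n).
  apply: (le_integrable mD _ _ ig) => [|x Dx]; first exact/measurable_EFinP.
  by rewrite /= lee_fin; apply: le_trans (Fg n x Dx) (ler_norm _).
have [if_ _ cF] : [/\ mu.-integrable D (EFin \o f),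
    (\int[mu]_(x in D) `|(F n x)%:E - (f x)%:E|)%E @[n --> \oo] --> 0%E &
    (\int[mu]_(x in D) (F n x)%:E)%E @[n --> \oo] --> (\int[mu]_(x in D) (f x)%:E)%E].
  apply: (@dominated_convergence _ _ _ _ _ mD (fun n => EFin \o F n) (EFin \o f)
    (EFin \o g)) => //.
  - by move=> n; exact/measurable_EFinP.
  - exact/measurable_EFinP.
  - by apply: filterS Ff => x h Dx; apply: cvg_EFin (h Dx); near=> n.
  - by apply: aeW => x n Dx; rewrite /= lee_fin Fg.
split => //; apply: fine_cvg; rewrite fineK//; exact: integrable_fin_num.
Unshelve. all: by end_near. Qed.

End RealIntegrable.

Section TestFunctions.
Context {R : realType}.
Implicit Types (f g phi : R3 R -> R) (y v a : R3 R) (i j : 'I_3) (r : R).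

(** A radius in place of a compact closure: the radii of products, affine images and convolution
    kernels are then explicit. *)
Definition supported_in r f : Prop := forall y, f y != 0 -> `|y| <= r.

Lemma supported_in_eq0 r f y : supported_in r f -> r < `|y| -> f y = 0.
Proof. by move=> fr; apply: contraTeq => /fr; rewrite -leNgt. Qed.

Lemma closed_box r : closed (box r : set (R3 R)).
Proof.
have -> : box r = (fun y : R3 R => `|y|) @^-1` [set t | t <= r].
  by apply/seteqP; split => y /boxE.
apply: closed_comp; last exact: closed_le.
by move=> y _; exact: (@norm_continuous _ (R3 R)).
Qed.

Lemma test_functionP phi :
  test_function phi <-> smooth phi /\ exists2 r, 0 <= r & supported_in r phi.
Proof.
split=> -[sphi] => [cphi|[r r0 pr]]; split=> //.
  have [r hr] := compact_sub_box cphi; exists `|r| => // y y0.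
  by apply: le_trans (ler_norm r); apply/boxE/hr/subset_closure.
apply: (@subclosed_compact _ _ (box r)); [exact: closed_closure|exact: compact_box|].
rewrite [X in _ `<=` X](iffLR (closure_id _) (@closed_box r)).
by apply: closure_subset => y /pr /boxE.
Qed.

Lemma supported_partial r phi i : supported_in r phi -> supported_in r (partial i phi).
Proof.
move=> pr y; apply: contraNle => ry; apply/eqP.
apply: is_derive_partial; apply: (@near_eq_is_derive R (R3 R) R (cst 0) phi).
have : nbhs y [set z : R3 R | r < `|z|].
  have cn : {for y, continuous (fun z : R3 R => `|z|)} by exact: (@norm_continuous _ (R3 R)).
  by apply: (cn [set t | r < t]); exact: lt_nbhsr.
by apply: filterS => z; rewrite /= => rz; rewrite (supported_in_eq0 pr rz).
Qed.

Lemma test_function_partial phi i : test_function phi -> test_function (partial i phi).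
Proof.
move=> /test_functionP[sphi [r r0 pr]]; apply/test_functionP; split.
  exact: smooth_partial.
by exists r => //; exact: supported_partial.
Qed.

Lemma smoothM f g : smooth f -> smooth g -> smooth (fun y => f y * g y).
Proof. by move=> /smoothP sf /smoothP sg; apply/smoothP => n; exact: smooth_toM. Qed.

Lemma smooth_cst c : smooth (fun=> c : R).
Proof. by apply/smoothP => n; exact: smooth_to_cst. Qed.

Lemma smooth_affine f (s : R) a : smooth f -> smooth (fun y => f (s *: y + a)).
Proof. by move=> /smoothP sf; apply/smoothP => n; exact: smooth_to_affine. Qed.

Lemma test_function_mulr phi f : smooth f -> test_function phi ->
  test_function (fun y => phi y * f y).
Proof.
move=> sf /test_functionP[sphi [r r0 pr]]; apply/test_functionP; split.
  exact: smoothM.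
by exists r => // y; rewrite mulf_eq0 negb_or => /andP[/pr].
Qed.

Lemma test_function_affine phi (s : R) a : s != 0 -> test_function phi ->
  test_function (fun y => phi (s *: y + a)).
Proof.
move=> s0 /test_functionP[sphi [r r0 pr]]; apply/test_functionP; split.
  exact: smooth_affine.
exists (`|s|^-1 * (r + `|a|)).
  by rewrite mulr_ge0 ?invr_ge0// addr_ge0.
move=> y /pr h; rewrite ler_pdivlMl ?normr_gt0// -normrZ.
rewrite -lerBlDr; apply: le_trans h; rewrite lerBlDr.
by apply: le_trans (ler_normB _ _); rewrite addrK.
Qed.

Lemma partialM f g i y : smooth f -> smooth g ->
  partial i (fun y => f y * g y) y = f y * partial i g y + g y * partial i f y.
Proof.
by move=> sf sg; apply: is_derive_partial; apply: is_deriveM; exact: smooth_is_derive.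
Qed.

Lemma partial_affine f (s : R) a i y : smooth f ->
  partial i (fun y => f (s *: y + a)) y = s * partial i f (s *: y + a).
Proof.
by move=> sf; apply: is_derive_partial; apply: is_derive_affine; exact: smooth_is_derive.
Qed.

Lemma bounded_of_test phi : test_function phi -> exists2 M, 0 <= M & forall y, `|phi y| <= M.
Proof.
move=> /test_functionP[sphi [r r0 pr]].
have [M [Mr hM]] : bounded_set (phi @` box r).
  apply: compact_bounded; apply: continuous_compact; last exact: compact_box.
  by apply: continuous_subspaceT; exact: smooth_continuous.
exists (`|M| + 1); first by rewrite addr_ge0.
move=> y; have [p0|/pr yr] := eqVneq (phi y) 0.
  by rewrite p0 normr0 addr_ge0.
apply: hM; first by rewrite (le_lt_trans (ler_norm M))// ltrDl.
by exists y => //; apply/boxE.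
Qed.

Lemma measurable_smooth f : smooth f -> measurable_fun setT f.
Proof. by move=> sf; apply: continuous_measurable_R3; exact: smooth_continuous. Qed.

Lemma supported_restrict r f : supported_in r f -> f \_ (box r) = f.
Proof.
move=> fr; apply/funext => y; rewrite patchE; case: ifPn => // yr.
apply/esym; apply: contraNeq yr => /fr yr; apply/mem_set; exact/boxE.
Qed.

Lemma integrable_supported r (M : R) f : measurable_fun setT f ->
  (forall y, `|f y| <= M) -> supported_in r f -> leb3.-integrable setT (EFin \o f).
Proof.
move=> mf fM fr; rewrite -(supported_restrict fr).
have := @integrable_mkcond _ _ _ leb3 _ (EFin \o f) (measurable_box r).
rewrite -restrict_EFin => <-; apply: measurable_bounded_integrable.
- exact: measurable_box.
- exact: leb3_box_lty.
- exact: measurable_funTS.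
- exists M; split; first exact: num_real.
  by move=> x Mx y _; apply: le_trans (fM y) (ltW Mx).
Qed.

Lemma integrable_test phi : test_function phi -> leb3.-integrable setT (EFin \o phi).
Proof.
move=> tphi; have [M _ hM] := bounded_of_test tphi.
have /test_functionP[sphi [r r0 pr]] := tphi.
by apply: integrable_supported hM pr; exact: measurable_smooth.
Qed.

Lemma norm_unit_vec i : `|unit_vec i : R3 R| <= 1.
Proof.
rewrite !prod_normE !ge_max /unit_vec /= !normr_nat.
by do !case: eqP => _; rewrite ?lexx ?ler01.
Qed.

(* The difference quotients have integral zero, by translation invariance. *)
Lemma integral_partial phi i : test_function phi -> \int[leb3]_y partial i phi y = 0.
Proof.
move=> tphi; have tdphi := test_function_partial i tphi.
have [M M0 hM] := bounded_of_test tdphi.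
have /test_functionP[sphi [r r0 pr]] := tphi.
have /test_functionP[sdphi _] := tdphi.
pose h n : R := n.+1%:R^-1.
have h0 n : 0 < h n by rewrite invr_gt0.
have h1 n : h n <= 1 by rewrite invf_le1// ler1n.
pose F n y := (h n)^-1 * (phi (h n *: unit_vec i + y) - phi y).
have mtr n : measurable_fun setT (fun y => phi (h n *: unit_vec i + y)).
  under eq_fun do rewrite addrC.
  by apply: (measurableT_comp (measurable_smooth sphi)); exact: measurable_translate.
have mphi := measurable_smooth sphi.
have mF n : measurable_fun setT (F n).
  by apply: measurable_funM => //; apply: measurable_funB.
have iphi := integrable_test tphi.
have itr n : leb3.-integrable setT (EFin \o (fun y => phi (h n *: unit_vec i + y))).
  under eq_fun do rewrite addrC.
  exact: (integrable_translate (h n *: unit_vec i) measurableT mphi iphi).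
have iF n : \int[leb3]_y F n y = 0.
  rewrite /F RintegralZl//; last exact: integrable_realB.
  rewrite RintegralB//; under eq_Rintegral do rewrite addrC.
  have /= := integral_translate (h n *: unit_vec i) measurableT mphi.
  by rewrite preimage_setT /translate => ->; rewrite subrr mulr0.
(* The mean value theorem bounds the quotients by [M]; they vanish outside the enlarged box because
   the increment [h n] is at most 1. *)
have FM n y : `|F n y| <= M * \1_(box (r + 1)) y.
  have [/mem_set yr|yr] := pselect (box (r + 1) y).
    rewrite indicE yr mulr1 /F normrM normfV (gtr0_norm (h0 n)).
    rewrite ler_pdivrMl//.
    have dl (t : R) : is_derive t 1 (fun s : R => phi (s *: unit_vec i + y))
        (partial i phi (t *: unit_vec i + y)).
      by apply/is_derive_line; exact: smooth_is_derive.
    have [|c _ /=] := MVT (h0 n) (fun t _ => dl t).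
      apply: derivable_within_continuous => t _; by have [] := dl t.
    rewrite scale0r add0r subr0 => ->.
    by rewrite normrM (gtr0_norm (h0 n)) mulrC ler_pM2l.
  rewrite indicE memNset// mulr0 /F.
  have ry : r + 1 < `|y| by rewrite ltNge; apply/negP => /boxE.
  rewrite (supported_in_eq0 pr (lt_trans _ ry)) ?ltrDl//.
  rewrite (supported_in_eq0 pr); first by rewrite subrr mulr0 normr0.
  rewrite -(ltrD2r 1); apply: lt_le_trans ry _.
  rewrite -[in leLHS](addKr (h n *: unit_vec i) y) addrC.
  apply: le_trans (ler_normB _ _) _; rewrite lerD2l normrZ (gtr0_norm (h0 n)).
  by apply: mulr_ile1 => //; [exact: ltW (h0 n)|exact: norm_unit_vec].
have iM : leb3.-integrable setT (EFin \o (fun y => M * \1_(box (r + 1)) y)).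
  apply: (@integrable_supported (r + 1) M).
  - by apply: measurable_funM => //; apply: measurable_indic; exact: measurable_box.
  - by move=> y; rewrite indicE; case: (_ \in _); rewrite ?mulr1 ?mulr0 ?normr0// ger0_norm.
  - move=> y; rewrite indicE; case: (boolP (_ \in _)) => [|_]; last by rewrite mulr0 eqxx.
    by rewrite inE => /boxE.
have cvF y : F n y @[n --> \oo] --> partial i phi y.
  have d1 : h^-1 *: ((phi \o shift y) (h *: unit_vec i) - phi y) @[h --> 0^']
    --> partial i phi y := @ex_derive _ _ _ _ _ _ _ (smooth_is_derive i y sphi).
  move=> A /d1 /= hA.
  have hB : \forall n \near \oo, @harmonic R n != 0 ->
      A ((harmonic n)^-1 *: (phi (harmonic n *: unit_vec i + y) - phi y)).
    exact: (@cvg_harmonic R _ hA).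
  suff : \forall n \near \oo, A (F n y) by [].
  by apply: filterS hB => n; apply; rewrite gt_eqF// h0.
have [_] := @Rintegral_dominated_cvg _ _ _ leb3 _ measurableT F (partial i phi) _
  (fun n => mF n) (measurable_smooth sdphi) (aeW _ (fun y _ => cvF y)) iM
  (fun n y _ => FM n y).
under eq_fun do rewrite iF.
by move/cvg_lim; rewrite lim_cst// => <-.
Qed.

End TestFunctions.

(** * Square integrable functions and their translates *)

Section SquareIntegrable.
Context {R : realType}.
Implicit Types (f g h u v w : R3 R -> R) (y z a : R3 R) (D : set (R3 R)).

(** Measurability is asked on the whole space and integrability on [D] only, so that passing to a
    smaller domain or translating raises no question of relative measurability. *)
Definition sq_integrable D f : Prop :=
  measurable_fun setT f /\ leb3.-integrable D (EFin \o (fun y => f y ^+ 2)).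

Lemma measurable_translated a f : measurable_fun setT f ->
  measurable_fun setT (fun y => f (y + a)).
Proof. by move=> mf; exact: (measurableT_comp mf (measurable_translate a)). Qed.

Lemma sq_integrable_le D f g : measurable D -> measurable_fun setT g ->
  (forall y, D y -> g y ^+ 2 <= f y) -> leb3.-integrable D (EFin \o f) ->
  sq_integrable D g.
Proof.
move=> mD mg gf fi; split => //.
apply: (le_integrable mD _ _ fi) => [|y Dy].
  by apply/measurable_EFinP; apply: measurable_funTS; exact: measurable_funX.
rewrite /= lee_fin ger0_norm ?sqr_ge0//.
by apply: le_trans (gf y Dy) (ler_norm _).
Qed.

Lemma sq_integrableM D f g : measurable D -> sq_integrable D f -> sq_integrable D g ->
  leb3.-integrable D (EFin \o (fun y => f y * g y)).
Proof.
move=> mD [mf fi] [mg gi].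
apply: (le_integrable mD _ _ (integrable_realD mD fi gi)) => [|y Dy].
  by apply/measurable_EFinP; apply: measurable_funTS; exact: measurable_funM.
rewrite /= lee_fin; apply: le_trans _ (ler_norm _).
by rewrite ler_norml; apply/andP; split; nra.
Qed.

Lemma sq_integrableD D f g : measurable D -> sq_integrable D f -> sq_integrable D g ->
  sq_integrable D (fun y => f y + g y).
Proof.
move=> mD [mf fi] [mg gi].
apply: (@sq_integrable_le _ (fun y => 2 * (f y ^+ 2 + g y ^+ 2))) => //.
- exact: measurable_funD.
- by move=> y _; have := sqr_ge0 (f y - g y); nra.
- exact/integrable_realZ/integrable_realD.
Qed.

Lemma sq_integrable_bounded D f g (M : R) : measurable D -> measurable_fun setT g ->
  (forall y, `|g y| <= M) -> sq_integrable D f -> sq_integrable D (fun y => g y * f y).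
Proof.
move=> mD mg gM [mf fi].
apply: (@sq_integrable_le _ (fun y => M ^+ 2 * (f y ^+ 2))) => //.
- exact: measurable_funM.
- move=> y _; rewrite exprMn ler_wpM2r ?sqr_ge0// -real_normK ?num_real//.
  by rewrite ler_sqr ?nnegrE//; apply: le_trans (gM y).
- exact/integrable_realZ.
Qed.

Lemma sq_integrableZ D (k : R) f : measurable D -> sq_integrable D f ->
  sq_integrable D (fun y => k * f y).
Proof.
by move=> mD; apply: (@sq_integrable_bounded _ _ (fun=> k) `|k|).
Qed.

Lemma sq_integrableB D f g : measurable D -> sq_integrable D f -> sq_integrable D g ->
  sq_integrable D (fun y => f y - g y).
Proof.
move=> mD hf hg; under eq_fun do rewrite -mulN1r.
by apply: sq_integrableD => //; exact: sq_integrableZ.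
Qed.

Lemma sq_integrable0 D : measurable D -> sq_integrable D (fun=> 0).
Proof.
move=> mD; split => //; under eq_fun do rewrite expr0n /=.
exact: integrable_real0.
Qed.

Lemma sq_integrable_cst D (c : R) : measurable D -> (leb3 D < +oo)%E ->
  sq_integrable D (fun=> c).
Proof.
move=> mD Doo; split => //; apply: measurable_bounded_integrable => //.
exists (c ^+ 2); split; first exact: num_real.
by move=> x cx y _; rewrite ger0_norm ?sqr_ge0// ltW.
Qed.

Lemma sq_integrable_integrable D f : measurable D -> (leb3 D < +oo)%E ->
  sq_integrable D f -> leb3.-integrable D (EFin \o f).
Proof.
move=> mD Doo hf; have := sq_integrableM mD (sq_integrable_cst 1 mD Doo) hf.
by under eq_fun do rewrite mul1r.
Qed.

Lemma sq_integrableS D E f : measurable D -> measurable E -> E `<=` D ->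
  sq_integrable D f -> sq_integrable E f.
Proof. by move=> mD mE ED [mf fi]; split => //; exact: (integrableS mD mE ED fi). Qed.

Lemma sq_integrable_translate D a f : measurable D -> sq_integrable D f ->
  sq_integrable (translate a @^-1` D) (fun y => f (y + a)).
Proof.
move=> mD [mf fi]; split; first exact: measurable_translated.
apply: (integrable_translate a mD _ fi); exact: measurable_funX.
Qed.

Lemma sq_integrable_translateT a f : sq_integrable setT f ->
  sq_integrable setT (fun y => f (y + a)).
Proof. by move=> hf; have := sq_integrable_translate a measurableT hf; rewrite preimage_setT. Qed.

Lemma integral_translateT a f : measurable_fun setT f ->
  \int[leb3]_y f (y + a) = \int[leb3]_y f y.
Proof. by move=> mf; have := integral_translate a measurableT mf; rewrite preimage_setT. Qed.

Lemma measurable_translate_preimage a D : measurable D -> measurable (translate a @^-1` D).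
Proof.
by move=> mD; rewrite -[X in measurable X]setTI; exact: measurable_translate.
Qed.

End SquareIntegrable.

Section Indicators.
Context {T : Type} {R : realType}.
Implicit Types (A B F G : set T) (y : T).

Lemma indic_setCI A B y :
  \1_(~` A `&` B) y = \1_B y + (-1) * \1_(A `&` B) y :> R.
Proof.
rewrite !indicE !in_setI in_setC.
by case: (y \in A); case: (y \in B); rewrite /= ?mulr0 ?mulr1 ?addr0 ?subrr.
Qed.

Lemma indic_setUI A B F y : ~ (A y /\ F y) ->
  \1_((A `|` F) `&` B) y = \1_(A `&` B) y + \1_(F `&` B) y :> R.
Proof.
rewrite !indicE !in_setI in_setU => AF; have : ~~ ((y \in A) && (y \in F)).
  by apply/negP => /andP[]; rewrite !inE => *; apply: AF.
by case: (y \in A); case: (y \in F); case: (y \in B); rewrite /= ?addr0 ?add0r.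
Qed.

Lemma sqr_indicB_le A B F y : A `<=` F ->
  `|(\1_(F `&` B) y - \1_(A `&` B) y) ^+ 2| <= \1_B y :> R.
Proof.
move=> AF; rewrite ger0_norm ?sqr_ge0// !indicE !in_setI.
by case: (y \in A); case: (y \in F); case: (y \in B);
  rewrite /= ?subrr ?subr0 ?sub0r ?sqrrN ?expr0n ?expr1n//= ler01.
Qed.

Lemma indicB_eq0 A B F y : (F y <-> A y) ->
  \1_(F `&` B) y - \1_(A `&` B) y = 0 :> R.
Proof.
move=> AF; rewrite !indicE !in_setI.
have -> : (y \in F) = (y \in A) by apply/idP/idP; rewrite !inE => /AF.
exact: subrr.
Qed.

Lemma indicI_in A B y : B y -> \1_(A `&` B) y = \1_A y :> R.
Proof. by move=> By; rewrite !indicE in_setI (mem_set By) andbT. Qed.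

Lemma indicI_notin A B y : ~ B y -> \1_(A `&` B) y = 0 :> R.
Proof. by move=> By; rewrite !indicE in_setI (memNset By) andbF. Qed.

End Indicators.

Lemma Rintegral0 d (T : measurableType d) (R : realType)
  (mu : {measure set T -> \bar R}) (D : set T) : \int[mu]_(x in D) (0 : R) = 0.
Proof. by rewrite /Rintegral integral0. Qed.

Import HBSimple HBNNSimple.

(** * Continuity of translations in L2 *)

Section TranslationContinuity.
Context {R : realType}.
Implicit Types (f g h u v w : R3 R -> R) (y : R3 R) (A D : set (R3 R)).
Context (z : nat -> R3 R).
Hypothesis z1 : forall n, `|z n| <= 1.
Hypothesis z0 : z n @[n --> \oo] --> (0 : R3 R).

(* The functions [w] with [w (y + z n)] converging to [w] in L2 form a closed subspace, which
   contains the indicators of boxes, hence of Borel sets by a Dynkin argument. *)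
Let sqT u := sq_integrable setT u.
Let modulus n u : R := \int[leb3]_y ((u (y + z n) - u y) ^+ 2).
Let tcont u : Prop := sqT u /\ forall e : R, 0 < e -> \forall n \near \oo, modulus n u <= e.

Let sq_modulus n u : sqT u -> sqT (fun y => u (y + z n) - u y).
Proof. by move=> hu; apply: sq_integrableB => //; exact: sq_integrable_translateT. Qed.

Let modulusD n u v : sqT u -> sqT v ->
  modulus n (fun y => u y + v y) <= 2 * modulus n u + 2 * modulus n v.
Proof.
move=> hu hv; have [_ iu] := sq_modulus n hu; have [_ iv] := sq_modulus n hv.
have [_ iuv] := sq_modulus n (sq_integrableD measurableT hu hv).
rewrite /modulus -!RintegralZl// -RintegralD//; try exact: integrable_realZ.
apply: le_Rintegral => //; first by apply: integrable_realD => //; exact: integrable_realZ.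
by move=> y _ /=; have := sqr_ge0 (u (y + z n) - u y - (v (y + z n) - v y)); nra.
Qed.

Let tcontD u v : tcont u -> tcont v -> tcont (fun y => u y + v y).
Proof.
move=> [su hu] [sv hv]; split; first exact: sq_integrableD.
move=> e e0; have e4 : 0 < e / 4 by lra.
near=> n; apply: le_trans (modulusD n su sv) _.
have : modulus n u <= e / 4 by near: n; exact: hu.
have : modulus n v <= e / 4 by near: n; exact: hv.
lra.
Unshelve. all: by end_near. Qed.

Let tcontZ k u : tcont u -> tcont (fun y => k * u y).
Proof.
move=> [su hu]; split; first exact: sq_integrableZ.
move=> e e0; have k0 : 0 < k ^+ 2 + 1 by rewrite ltr_wpDl ?sqr_ge0.
near=> n.
have -> : modulus n (fun y => k * u y) = k ^+ 2 * modulus n u.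
  rewrite /modulus -RintegralZl//; last exact: (sq_modulus n su).2.
  by apply: eq_Rintegral => y _; rewrite -mulrBr exprMn.
have : modulus n u <= e / (k ^+ 2 + 1) by near: n; apply: hu; exact: divr_gt0.
rewrite ler_pdivlMr// => h; apply: le_trans h.
have : 0 <= modulus n u by apply: Rintegral_ge0 => y _; exact: sqr_ge0.
nra.
Unshelve. all: by end_near. Qed.

Let tcont0 : tcont (fun=> 0).
Proof.
split; first exact: sq_integrable0.
move=> e e0; near=> n; rewrite /modulus; under eq_Rintegral do rewrite subrr expr0n /=.
by rewrite /Rintegral integral0 ltW.
Unshelve. all: by end_near. Qed.

Let tcont_sum (I : Type) (s : seq I) (F : I -> R3 R -> R) :
  (forall i, tcont (F i)) -> tcont (fun y => \sum_(i <- s) F i y).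
Proof.
move=> h; elim: s => [|i s IHs].
  by under eq_fun do rewrite big_nil; exact: tcont0.
by under eq_fun do rewrite big_cons; exact: tcontD.
Qed.

Let tcont_closed u : sqT u ->
  (forall e : R, 0 < e -> exists2 v, tcont v & \int[leb3]_y ((u y - v y) ^+ 2) <= e) ->
  tcont u.
Proof.
move=> su h; split => // e e0.
(* Three terms, each at most [e / 12], get the factor 3 of the inequality
   [(a + b + c)^2 <= 3 (a^2 + b^2 + c^2)]. *)
have e12 : 0 < e / 12 by lra.
have [v [sv hv] uv] := h _ e12.
near=> n.
have suv := sq_integrableB measurableT su sv.
have suvn := sq_integrable_translateT (z n) suv.
have e1 := integral_translateT (z n) (measurable_funX 2 suv.1).
have [_ iv] := sq_modulus n sv; have [_ iu] := sq_modulus n su.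
suff : modulus n u <= 3 * \int[leb3]_y ((u (y + z n) - v (y + z n)) ^+ 2) +
    (3 * modulus n v + 3 * \int[leb3]_y ((u y - v y) ^+ 2)).
  rewrite e1 => /le_trans; apply.
  have : modulus n v <= e / 12 by near: n; exact: hv.
  lra.
have i1 := integrable_realZ measurableT 3 suvn.2.
have i2 := integrable_realZ measurableT 3 iv.
have i3 := integrable_realZ measurableT 3 suv.2.
rewrite /modulus -!RintegralZl//; try exact: suvn.2; try exact: suv.2.
rewrite -RintegralD// -RintegralD//; last exact: integrable_realD.
apply: le_Rintegral => //; first by apply: integrable_realD => //; exact: integrable_realD.
move=> y _ /=; set a := u (y + z n); set b := v (y + z n); set c := u y; set d := v y.
have := sqr_ge0 (a - b - (b - d)); have := sqr_ge0 (b - d - (d - c)).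
have := sqr_ge0 (a - b - (d - c)); nra.
Unshelve. all: by end_near. Qed.

(* Boxes are regular: their boundary is null. *)
Let regular A : Prop :=
  measurable A /\ {ae leb3, forall y, \forall n \near \oo, A (y + z n) <-> A y}.

Let regularI A B : regular A -> regular B -> regular (A `&` B).
Proof.
move=> [mA hA] [mB hB]; split; first exact: measurableI.
apply: filterS2 hA hB => y; apply: filterS2 => n [a1 a2] [b1 b2].
by split => -[? ?]; split; auto.
Qed.

(** Off the two null planes which bound the slab, membership does not change under translations
    shorter than the distance of [c y] to the end points. *)
Let regular_slab (c : R3 R -> R) (a b : R) : measurable_fun setT c ->
  (forall y y', c (y + y') = c y + c y') -> (forall y, `|c y| <= `|y|) ->
  (forall t, leb3 (c @^-1` [set t]) = 0%E) -> regular (c @^-1` `]a, b]%classic).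
Proof.
move=> mc cD cn c0.
have mpre (X : set R) : measurable X -> measurable (c @^-1` X).
  by move=> mX; rewrite -[X in measurable X]setTI; exact: mc.
split; first by apply: mpre; exact: measurable_itv.
exists (c @^-1` [set a] `|` c @^-1` [set b]); split.
- by apply: measurableU; apply: mpre; exact: measurable_set1.
- by rewrite measureU0 //; apply: mpre; exact: measurable_set1.
move=> y; apply: contra_notP => /not_orP[ya yb].
have e0 : 0 < Num.min `|c y - a| `|c y - b|.
  by rewrite lt_min !normr_gt0 !subr_eq0; apply/andP; split; apply/eqP.
have : \forall n \near \oo, `|z n| < Num.min `|c y - a| `|c y - b|.
  by have /cvgr0_norm_lt := z0; exact.
apply: filterS => n; rewrite lt_min => /andP[h1 h2].
have {}h1 := le_lt_trans (cn _) h1; have {}h2 := le_lt_trans (cn _) h2.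
rewrite /= !in_itv/= cD.
have cmp (t : R) : `|c (z n)| < `|c y - t| -> (t < c y + c (z n)) = (t < c y).
  have [ht|ht] := ltP t (c y); rewrite ltr_norml.
    by rewrite gtr0_norm ?subr_gt0// => /andP[? ?]; lra.
  rewrite ler0_norm ?subr_le0// => /andP[? ?]; apply/negbTE; rewrite -leNgt; lra.
by rewrite !leNgt !cmp.
Qed.

Let null1 (t : R) : leb3 ((fun y : R3 R => y.1.1 : R) @^-1` [set t]) = 0%E.
Proof.
rewrite (_ : _ @^-1` _ = ([set t] `*` setT) `*` setT); last first.
  by apply/seteqP; split => [y /=|y [[]]].
apply: etrans; first by apply: product_measure1E => //; apply: measurableX.
rewrite [X in (X * _)%E](_ : _ = 0%E) ?mul0e//.
apply: etrans; first by apply: product_measure1E.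
by have /= -> := lebesgue_measure_set1 t; rewrite mul0e.
Qed.

Let null2 (t : R) : leb3 ((fun y : R3 R => y.1.2 : R) @^-1` [set t]) = 0%E.
Proof.
rewrite (_ : _ @^-1` _ = (setT `*` [set t]) `*` setT); last first.
  by apply/seteqP; split => [y /=|y [[]]].
apply: etrans; first by apply: product_measure1E => //; apply: measurableX.
rewrite [X in (X * _)%E](_ : _ = 0%E) ?mul0e//.
apply: etrans; first by apply: product_measure1E.
by have /= -> := lebesgue_measure_set1 t; rewrite mule0.
Qed.

Let null3 (t : R) : leb3 ((fun y : R3 R => y.2 : R) @^-1` [set t]) = 0%E.
Proof.
rewrite (_ : _ @^-1` _ = setT `*` [set t]); last first.
  by apply/seteqP; split => [y /=|y []].
apply: etrans; first by apply: product_measure1E.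
by have /= -> := lebesgue_measure_set1 t; rewrite mule0.
Qed.

Let coord c : Prop := [\/ c = (fun y : R3 R => y.1.1 : R),
  c = (fun y : R3 R => y.1.2 : R) | c = (fun y : R3 R => y.2 : R)].

Let regular_coord c (a b : R) : coord c -> regular (c @^-1` `]a, b]%classic).
Proof.
have n1 (y : R3 R) : [/\ `|y.1.1| <= `|y|, `|y.1.2| <= `|y| & `|y.2| <= `|y|].
  by rewrite !prod_normE !le_max !lexx ?orbT.
case=> ->; apply: regular_slab.
- exact: measurable_coord1.
- by [].
- by move=> y; have [] := n1 y.
- exact: null1.
- exact: measurable_coord2.
- by [].
- by move=> y; have [] := n1 y.
- exact: null2.
- exact: measurable_coord3.
- by [].
- by move=> y; have [] := n1 y.
- exact: null3.
Qed.

(** Half-open slabs make each coordinate measurable for the sigma-algebra generated by [regular];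
    the identity, as the pairing of the coordinates, is then measurable for it too. *)
Let measurable_regular : @measurable _ (R3 R) = <<s regular >>.
Proof.
apply/seteqP; split; last first.
  apply: smallest_sub; first exact: sigma_algebra_measurable.
  by move=> A [].
move=> A mA.
have mc c : coord c ->
    measurable_fun (setT : set (g_sigma_algebraType regular)) (c : _ -> measurableTypeR R).
  move=> hc; apply: (measurability (@ocitv R)) => //.
  move=> _ [_ [[a b] _ <-] <-]; rewrite setTI; apply: sub_gen_smallest.
  exact: regular_coord.
have m1 := mc _ (Or31 _ _ erefl); have m2 := mc _ (Or32 _ _ erefl).
have m3 := mc _ (Or33 _ _ erefl).
have := measurable_fun_pair (measurable_fun_pair m1 m2) m3.
move=> /(_ measurableT A mA); rewrite setTI.
rewrite (_ : _ @^-1` A = A)//; apply/seteqP.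
by split => -[[? ?] ?].
Qed.

(** A half-open variant of [box], assembled from the slabs that are known to be regular. *)
Let bset (r : R) : set (R3 R) := (fun y : R3 R => y.1.1 : R) @^-1` `]-r, r]%classic `&`
  (fun y : R3 R => y.1.2 : R) @^-1` `]-r, r]%classic `&` (fun y : R3 R => y.2 : R) @^-1` `]-r, r]%classic.

Let regular_bset r : regular (bset r).
Proof.
apply: regularI; last by apply: regular_coord; exact: Or33.
by apply: regularI; apply: regular_coord; [exact: Or31|exact: Or32].
Qed.

Let bset_box r : bset r `<=` box r.
Proof.
move=> y [[]]; rewrite /= !in_itv /= => /andP[/ltW a1 b1] /andP[/ltW a2 b2] /andP[/ltW a3 b3].
by split; [split|]; rewrite /= in_itv/=; apply/andP.
Qed.

Let box_bset r : box r `<=` bset (r + 1).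
Proof.
move=> y [[]]; rewrite /= !in_itv /= => /andP[a1 b1] /andP[a2 b2] /andP[a3 b3].
by split; [split|]; rewrite /= in_itv/=; apply/andP; split; lra.
Qed.

Let indic_supported A r : measurable A -> A `<=` box r ->
  leb3.-integrable setT (EFin \o (\1_A : R3 R -> R)).
Proof.
move=> mA AB; apply: (@integrable_supported _ r 1).
- exact: measurable_indic.
- by move=> y; rewrite indicE; case: (_ \in _); rewrite ?normr1 ?normr0.
- move=> y; rewrite indicE; case: (boolP (_ \in _)) => [|_]; last by rewrite eqxx.
  by rewrite inE => /AB /boxE.
Qed.

Let sqT_indic A r : measurable A -> A `<=` bset r -> sqT \1_A.
Proof.
move=> mA AB; apply: (@sq_integrable_le _ _ \1_A) => //.
- by move=> y _; rewrite !indicE; case: (_ \in _); rewrite ?expr1n ?expr0n.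
- by apply: (@indic_supported _ r) => //; apply: subset_trans AB _; exact: bset_box.
Qed.

(** Dominated convergence: regularity is the almost everywhere convergence of the translated
    indicators, and [|z n| <= 1] keeps them inside [box (r + 1)]. *)
Let tcont_regular A r : regular A -> A `<=` bset r -> tcont \1_A.
Proof.
move=> [mA rA] AB; split; first exact: sqT_indic AB.
have mI : measurable_fun setT (\1_A : R3 R -> R) by exact: measurable_indic.
have [] := @Rintegral_dominated_cvg _ _ R leb3 setT measurableT
  (fun n y => (\1_A (y + z n) - \1_A y) ^+ 2) (fun=> 0) \1_(box (r + 1)).
- move=> n; apply: measurable_funX; apply: measurable_funB => //.
  exact: measurable_translated.
- by [].
- apply: filterS rA => y hy _; apply: cvg_near_cst.
  apply: filterS hy => n hn.
  have -> : \1_A (y + z n) = \1_A y :> R.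
    by rewrite !indicE; congr ((nat_of_bool _)%:R); apply/idP/idP; rewrite !inE => /hn.
  by rewrite subrr expr0n.
- by apply: (@indic_supported _ (r + 1)) => //; exact: measurable_box.
- move=> n y _; rewrite [in leRHS]indicE.
  have [/mem_set ->|yb] := pselect (box (r + 1) y).
    rewrite ger0_norm ?sqr_ge0// !indicE.
    by case: (_ \in _); case: (_ \in _); rewrite /= ?subrr ?subr0 ?sub0r ?sqrrN ?expr0n ?expr1n//= ler01.
  have ry : r + 1 < `|y| by rewrite ltNge; apply/negP => /boxE.
  rewrite (memNset yb) !indicE !memNset ?subrr ?expr0n ?normr0//.
    by move=> /AB/bset_box/boxE; apply/negP; rewrite -ltNge; apply: lt_trans ry; rewrite ltrDl.
  move=> /AB/bset_box/boxE; apply/negP; rewrite -ltNge -(ltrD2r 1).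
  apply: lt_le_trans ry _; rewrite -[in leLHS](addrK (z n) y).
  by apply: le_trans (ler_normB _ _) _; rewrite lerD2l.
move=> _; rewrite /Rintegral integral0 /= => h e e0.
near=> n; apply: le_trans (ler_norm _) _; apply: ltW; near: n.
by move/cvgr0_norm_lt : h; exact.
Unshelve. all: by end_near. Qed.

Let tcont_indic A r : measurable A -> tcont \1_(A `&` bset r).
Proof.
rewrite measurable_regular; move: A.
have [mB hB] := regular_bset r.
apply: (dynkin_induction (G := regular) (P := fun A => tcont \1_(A `&` bset r))).
- exact: measurable_regular.
- exact: regularI.
- by rewrite setTI; apply: (@tcont_regular _ r) => //.
- by move=> A rA; apply: (@tcont_regular _ r); [exact: regularI|exact: subIsetr].
- move=> A mA hA.
  have -> : \1_(~` A `&` bset r) = (fun y => \1_(bset r) y + (-1) * \1_(A `&` bset r) y) :> (R3 R -> R).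
    by apply/funext => y; exact: indic_setCI.
  by apply: tcontD; [exact: (@tcont_regular _ r)|exact: tcontZ].
- move=> F mF tF hF.
  pose G N := \big[setU/set0]_(k < N) F k.
  have mG N : measurable (G N) by apply: bigsetU_measurable.
  have tG N : tcont \1_(G N `&` bset r).
    elim: N => [|N IHN]; first by rewrite /G big_ord0 set0I indic0; exact: tcont0.
    have -> : \1_(G N.+1 `&` bset r) = (fun y => \1_(G N `&` bset r) y + \1_(F N `&` bset r) y) :> (R3 R -> R).
      apply/funext => y; rewrite /G big_ord_recr /= -/(G N); apply: indic_setUI.
      rewrite /G -bigcup_mkord => -[[k /= kN Fk] FN].
      move/trivIsetP : tF => /(_ k N Logic.I Logic.I); rewrite (ltn_eqF kN) => /(_ erefl).
      by rewrite -subset0 => /(_ y); apply.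
    exact: tcontD.
  have mU : measurable (\bigcup_k F k) by exact: bigcup_measurable.
  (* The finite unions [G n] approximate the countable union in L2, with the indicator of [bset r]
     as dominating function. *)
  apply: tcont_closed.
    by apply: (@sqT_indic _ r); [exact: measurableI|exact: subIsetr].
  move=> e e0.
  have [] := @Rintegral_dominated_cvg _ _ R leb3 setT measurableT
    (fun n y => (\1_(\bigcup_k F k `&` bset r) y - \1_(G n `&` bset r) y) ^+ 2)
    (fun=> 0) \1_(bset r).
  + move=> n; apply: measurable_funX; apply: measurable_funB;
      by apply: measurable_indic; exact: measurableI.
  + by [].
  + apply: aeW => y _; apply: cvg_near_cst.
    have [[k _ Fk]|nF] := pselect ((\bigcup_k F k) y).
      exists k.+1 => // n /= kn.
      rewrite indicB_eq0 ?expr0n//; split => _; last by exists k.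
      by rewrite /G -bigcup_mkord; exists k.
    near=> n; rewrite indicB_eq0 ?expr0n//; split => //.
    by rewrite /G -bigcup_mkord => -[k _ Fk]; exists k.
  + by apply: (@indic_supported _ r) => //; exact: bset_box.
  + move=> n y _; apply: sqr_indicB_le => x.
    by rewrite /G -bigcup_mkord => -[k _ Fk]; exists k.
  move=> _; rewrite Rintegral0 => /cvgr0_norm_lt /(_ _ e0) [N _ /(_ N (leqnn N))] h.
  by exists \1_(G N `&` bset r) => //; apply: le_trans (ler_norm _) (ltW h).
Unshelve. all: by end_near. Qed.

Let tcont_nonneg w r : sqT w -> supported_in r w -> (forall y, 0 <= w y) -> tcont w.
Proof.
move=> sw wr w0; apply: tcont_closed => // e e0.
have mw : measurable_fun setT (EFin \o w) by apply/measurable_EFinP; exact: sw.1.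
have w0' y : [set: R3 R] y -> (0 <= (EFin \o w) y)%E by rewrite /= lee_fin.
pose f n := nnsfun_approx measurableT mw n.
have fw y : f n y @[n --> \oo] --> w y.
  by have := @cvg_nnsfun_approx _ _ _ _ measurableT _ mw w0' y Logic.I; move/fine_cvg.
have f_le n y : f n y <= w y.
  have nd : nondecreasing_seq (fun n => f n y).
    by move=> a b ab; have /lefP := nd_nnsfun_approx measurableT mw ab; exact.
  have cf : cvgn (fun n => f n y) by apply/cvg_ex; exists (w y); exact: fw.
  have := nondecreasing_cvgn_le nd cf n.
  by rewrite (cvg_lim (@Rhausdorff R) (fw y)).
have f_ge n y : 0 <= f n y by exact: fun_ge0.
have tf n : tcont (f n).
  (* Since [0 <= f n <= w], the simple function vanishes off [bset (r + 1)], so its level sets may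
     be cut by that bounded set. The radius grows by 1 because [bset] lacks some faces of [box]. *)
  have -> : (f n : R3 R -> R) = (fun y => \sum_(v <- finmap.enum_fset (fset_set (range (f n))))
      v * \1_((f n @^-1` [set v]) `&` bset (r + 1)) y).
    apply/funext => y; have [yb|yb] := pselect (bset (r + 1) y).
      rewrite [LHS]fimfunE fsbig_finite//.
      by apply: eq_bigr => v _; rewrite indicI_in.
    rewrite big1 => [|v _]; last by rewrite indicI_notin// mulr0.
    apply/eqP; rewrite eq_le f_ge andbT; apply: le_trans (f_le n y) _.
    have [->//|/wr wy] := eqVneq (w y) 0.
    by case: yb; apply: box_bset; apply/boxE.
  apply: tcont_sum => v; apply: tcontZ; apply: tcont_indic.
  by rewrite -[X in measurable X]setTI; exact: measurable_funP.
have [] := @Rintegral_dominated_cvg _ _ R leb3 setT measurableT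
  (fun n y => (w y - f n y) ^+ 2) (fun=> 0) (fun y => w y ^+ 2).
- move=> n; apply: measurable_funX; apply: measurable_funB; first exact: sw.1.
  exact: measurable_funP.
- by [].
- apply: aeW => y _; have h : w y - f n y @[n --> \oo] --> (0 : R).
    by rewrite -[X in _ --> X](subrr (w y)); apply: cvgB; [exact: cvg_cst|exact: fw].
  have -> : (fun n => (w y - f n y) ^+ 2) = (fun n => w y - f n y) \* (fun n => w y - f n y).
    by apply/funext => n; rewrite expr2.
  by rewrite -[X in _ --> X](mulr0 (0 : R)); exact: (cvgM h h).
- exact: sw.2.
- move=> n y _; rewrite ger0_norm ?sqr_ge0//; have := f_le n y; have := f_ge n y.
  by move: (w0 y); nra.
move=> _; rewrite Rintegral0 => /cvgr0_norm_lt /(_ _ e0) [N _ /(_ N (leqnn N))] h.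
by exists (f N) => //; apply: le_trans (ler_norm _) (ltW h).
Qed.

(** Stated along sequences, as it rests on dominated convergence. The positive and negative parts
    are treated separately, since nonnegative functions are approximated from below by simple
    ones. *)
Lemma translation_continuity w r : sq_integrable setT w -> supported_in r w ->
  forall e : R, 0 < e ->
  \forall n \near \oo, \int[leb3]_y ((w (y + z n) - w y) ^+ 2) <= e.
Proof.
move=> sw wr; suff : tcont w by case.
have sub (v : R3 R -> R) : sqT v -> sqT (fun y => Num.max (v y) 0).
  move=> [mv iv]; apply: (@sq_integrable_le _ _ (fun y => v y ^+ 2)) => //.
    by apply: measurable_funrpos.
  by move=> y _; case: (leP (v y) 0) => h; rewrite ?expr0n ?sqr_ge0.
have supp (v : R3 R -> R) : supported_in r v -> supported_in r (fun y => Num.max (v y) 0).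
  by move=> vr y h; apply: vr; apply: contraNneq h => ->; rewrite maxxx.
have sN : sqT (fun y => -1 * w y) by exact: sq_integrableZ.
have suppN : supported_in r (fun y => -1 * w y).
  by move=> y; rewrite mulN1r oppr_eq0; exact: wr.
have -> : w = (fun y => Num.max (w y) 0 + -1 * Num.max (-1 * w y) 0).
  apply/funext => y; rewrite !mulN1r; case: (leP (w y) 0) => h.
    by rewrite (max_idPl _) ?oppr_ge0// opprK add0r.
  by rewrite (max_idPr _) ?oppr_le0 ?ltW// oppr0 addr0.
apply: tcontD; first by apply: (@tcont_nonneg _ r); [exact: sub|exact: supp|move=> y; rewrite le_max lexx orbT].
apply: tcontZ; apply: (@tcont_nonneg _ r); [exact: sub|exact: supp|].
by move=> y; rewrite le_max lexx orbT.
Qed.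

End TranslationContinuity.

(** * Mollification *)

Section Mollification.
Context {R : realType}.
Implicit Types (f g h u v w m sigma : R3 R -> R) (y z x a : R3 R) (D : set (R3 R)) (r s : R).

Let leb3s_sigma_finite : sigma_finite setT (@leb3s R).
Proof.
exists (fun n => box n%:R).
  apply/esym/seteqP; split => // y _; exists (Num.bound `|y|) => //.
  by apply/boxE/ltW/archi_boundP.
by move=> n; split; [exact: measurable_box|exact: leb3_box_lty].
Qed.

HB.instance Definition _ := Measure_isSigmaFinite.Build _ _ _ (@leb3s R)
  leb3s_sigma_finite.

(** By Tonelli, [K] is integrable for the product measure as soon as its inner L1 norms are
    dominated by an integrable function, here [c * |w|]. *)
Lemma fubini_bound (K : R3 R * R3 R -> R) w (c : R) :
  measurable_fun setT K -> leb3.-integrable setT (EFin \o w) ->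
  (forall y, leb3.-integrable setT (EFin \o (fun t => K (y, t)))) ->
  (forall t, leb3.-integrable setT (EFin \o (fun y => K (y, t)))) ->
  (forall y, \int[leb3]_t `|K (y, t)| <= c * `|w y|) ->
  [/\ leb3.-integrable setT (EFin \o (fun y => \int[leb3]_t K (y, t))),
      leb3.-integrable setT (EFin \o (fun t => \int[leb3]_y K (y, t))) &
  \int[leb3]_y (\int[leb3]_t K (y, t)) = \int[leb3]_t (\int[leb3]_y K (y, t))].
Proof.
move=> mK iw iK1 iK2 Kw.
have mK' : measurable_fun setT (EFin \o K) by exact/measurable_EFinP.
have iabs y : leb3.-integrable setT (EFin \o (fun t => `|K (y, t)|)).
  by have := integrable_abse (iK1 y).
have bound : (\int[leb3s]_y \int[leb3s]_t `|(K (y, t))%:E| < +oo)%E.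
  apply: (@le_lt_trans _ _ (\int[leb3s]_y (c * `|w y|)%:E)%E).
    apply: ge0_le_integral => //.
    - by move=> y _; apply: integral_ge0 => t _; exact: abse_ge0.
    - have mKa : measurable_fun setT (fun p => `|(K p)%:E|%E) by exact: measurableT_comp.
      have := @measurable_fun_fubini_tonelli_F _ _ _ _ R leb3s _ mKa.
      by apply => p; exact: abse_ge0.
    - apply/measurable_EFinP; apply: measurable_funM => //.
      by apply: measurableT_comp => //; apply/measurable_EFinP; exact: measurable_int iw.
    - move=> y _; have /= <- := @fineK _ _ (integrable_fin_num measurableT (iabs y)).
      by rewrite lee_fin; exact: Kw.
  have := integrable_lty measurableT (integrable_realZ measurableT c (f := fun y => `|w y|) (integrable_abse iw)).
  by [].
have iK : (leb3s \x leb3s)%E.-integrable setT (EFin \o K).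
  exact/(integrable12ltyP leb3s leb3s mK').
pose K' (p : R3 R * R3 R) := K (p.2, p.1).
have mK'' : measurable_fun setT (EFin \o K').
  apply/measurable_EFinP; apply: (measurableT_comp mK).
  by apply: measurable_fun_pair; [exact: measurable_snd|exact: measurable_fst].
have iK' : (leb3s \x leb3s)%E.-integrable setT (EFin \o K').
  exact/(integrable21ltyP leb3s leb3s mK'').
have E1 y : (\int[leb3]_t (K (y, t))%:E)%E = (\int[leb3]_t K (y, t))%:E.
  by rewrite fineK//; exact: integrable_fin_num (iK1 y).
have E2 t : (\int[leb3]_y (K (y, t))%:E)%E = (\int[leb3]_y K (y, t))%:E.
  by rewrite fineK//; exact: integrable_fin_num (iK2 t).
split.
- have := integrable_fubini_F iK; apply: eq_integrable => // y _.
  exact: E1.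
- have := integrable_fubini_F iK'; apply: eq_integrable => // t _.
  exact: E2.
have := Fubini iK => /= F; rewrite /Rintegral; congr fine.
apply: etrans; first by apply: eq_integral => y _; exact: esym (E1 y).
apply: etrans; first exact: F.
by apply: eq_integral => t _; exact: E2.
Qed.

Lemma L2loc_box r m : L2loc m -> sq_integrable (box r) m.
Proof.
move=> [mm h]; split => //; apply/integrableP; split.
  by apply/measurable_EFinP; apply: measurable_funTS; exact: measurable_funX.
have := h _ (@compact_box _ r).
by under eq_integral => y _ do rewrite -[(_ ^+ 2)%R]ger0_norm ?sqr_ge0//.
Qed.

Lemma Rintegral_supported r f : supported_in r f ->
  \int[leb3]_y f y = \int[leb3]_(y in box r) f y.
Proof. by move=> fr; rewrite [RHS]Rintegral_mkcond supported_restrict. Qed.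

Lemma integrable_supported_box r f : supported_in r f ->
  leb3.-integrable (box r) (EFin \o f) -> leb3.-integrable setT (EFin \o f).
Proof.
move=> fr; have := @integrable_mkcond _ _ _ leb3 _ (EFin \o f) (measurable_box r).
by rewrite restrict_EFin (supported_restrict fr) => <-.
Qed.

Lemma sq_integrable_supported r f : supported_in r f ->
  sq_integrable (box r) f -> sq_integrable setT f.
Proof.
move=> fr [mf fi]; split => //; apply: (@integrable_supported_box r) => //.
by move=> y; rewrite sqrf_eq0; exact: fr.
Qed.

Lemma integrable_of_supported r w : sq_integrable setT w -> supported_in r w ->
  leb3.-integrable setT (EFin \o w).
Proof.
move=> sw wr; apply: (@integrable_supported_box r) => //.
apply: sq_integrable_integrable; [exact: measurable_box|exact: leb3_box_lty|].
by apply: (@sq_integrableS _ setT) => //; exact: measurable_box.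
Qed.

Lemma test_sq_integrable sigma : test_function sigma -> sq_integrable setT sigma.
Proof.
move=> ts; have [ss [r r0 sr]] := (test_functionP sigma).1 ts.
have [M M0 hM] := bounded_of_test ts.
apply: (@sq_integrable_supported r) => //.
apply: (@sq_integrable_le _ _ (fun=> M ^+ 2)).
- exact: measurable_box.
- exact: measurable_smooth.
- by move=> y _; rewrite -real_normK ?num_real// ler_sqr ?nnegrE.
- by have [] := sq_integrable_cst M (measurable_box r) (leb3_box_lty r).
Qed.

Lemma L2locP m : L2loc m <-> forall r, sq_integrable (box r) m.
Proof.
split=> [lm r|lm]; first exact: L2loc_box.
split=> [|K cK]; first by have [] := lm 0.
have [r Kr] := compact_sub_box cK.
have mm := (lm 0).1.
have mK : measurable K.
  exact: measurable_compact.
have [_ im] := sq_integrableS (measurable_box r) mK Kr (lm r).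
have := integrable_lty mK im; by [].
Qed.

Lemma L2loc_translate a m : L2loc m -> L2loc (fun y => m (y + a)).
Proof.
move=> /L2locP lm; apply/L2locP => r.
have h := sq_integrable_translate a (measurable_box (r + `|a|)) (lm (r + `|a|)).
apply: sq_integrableS h; first by apply: measurable_translate_preimage; exact: measurable_box.
  exact: measurable_box.
move=> y /boxE yr; apply/boxE; apply: le_trans (ler_normD _ _) _.
by rewrite lerD2r.
Qed.

Lemma RintegralZ_R3 (k : R) f : leb3.-integrable setT (EFin \o f) ->
  \int[leb3]_y (k * f y) = k * \int[leb3]_y f y.
Proof. by move=> fi; rewrite RintegralZl. Qed.

Lemma L2loc_mul_integrable r w m z : sq_integrable setT w -> supported_in r w ->
  L2loc m -> leb3.-integrable setT (EFin \o (fun y => w y * m (y + z))).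
Proof.
move=> sw wr lm; apply: (@integrable_supported_box r).
  by move=> y; rewrite mulf_eq0 negb_or => /andP[/wr].
apply: sq_integrableM; first exact: measurable_box.
  by apply: (@sq_integrableS _ setT) => //; exact: measurable_box.
exact: L2loc_box (L2loc_translate z lm).
Qed.

Section Kernel.
Context (r s : R) (w m sigma : R3 R -> R).
Hypotheses (sw : sq_integrable setT w) (wr : supported_in r w) (lm : L2loc m).
Hypotheses (ts : test_function sigma) (ss : supported_in s sigma).

(** The truncation of [m] to the region seen by the kernel: [w y != 0] and [sigma (x - y) != 0]
    force [|x| <= r + s]. It makes the locally square integrable [m] integrable. *)
Let mt x : R := m x * \1_(box (r + s)) x.

Let mtE x y : w y != 0 -> sigma (x - y) != 0 -> m x = mt x.
Proof.
move=> /wr yr /ss xs; rewrite /mt indicE mem_set ?mulr1//; apply/boxE.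
by rewrite -(subrK y x) addrC; apply: le_trans (ler_normD _ _) _; exact: lerD.
Qed.

Let imt : leb3.-integrable setT (EFin \o mt).
Proof.
have mb := measurable_box (r + s) : measurable (box (r + s) : set (R3 R)).
have fs : supported_in (r + s) mt.
  move=> x; rewrite /mt indicE; case: (boolP (_ \in _)) => [|_]; last by rewrite mulr0 eqxx.
  by rewrite inE => /boxE.
apply: (@integrable_supported_box (r + s)) => //.
apply: (eq_integrable mb (EFin \o m)).
  by move=> x /= xb; rewrite /mt indicE xb mulr1.
by apply: sq_integrable_integrable => //; [exact: leb3_box_lty|exact: L2loc_box].
Qed.

Let msigma : measurable_fun setT sigma.
Proof. by apply: measurable_smooth; have /test_functionP[] := ts. Qed.

Let msub : measurable_fun setT (fun p : R3 R * R3 R => p.1 - p.2 : R3 R).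
Proof.
have c1 := @measurable_coord1 R; have c2 := @measurable_coord2 R; have c3 := @measurable_coord3 R.
have h (c : R3 R -> R) : measurable_fun setT c ->
    measurable_fun setT (fun p : R3 R * R3 R => c p.1 - c p.2 : measurableTypeR R).
  by move=> mc; apply: measurable_funB; exact: measurableT_comp.
apply: measurable_fun_pair; last exact: (h _ c3).
by apply: measurable_fun_pair; [exact: (h _ c1)|exact: (h _ c2)].
Qed.

Let mmt : measurable_fun setT mt.
Proof.
apply: measurable_funM; first exact: lm.1.
by apply: measurable_indic; exact: measurable_box.
Qed.

Let bsigma (f : R3 R -> R) (g : R3 R -> R3 R) : measurable_fun setT (fun x => sigma (g x)) ->
  leb3.-integrable setT (EFin \o f) ->
  leb3.-integrable setT (EFin \o (fun x => sigma (g x) * f x)).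
Proof.
move=> mg fi; have [M M0 hM] := bounded_of_test ts.
have mf : measurable_fun setT f by apply/measurable_EFinP; exact: measurable_int fi.
apply: (le_integrable measurableT _ _ (integrable_realZ measurableT M fi)) => [|x _].
  by apply/measurable_EFinP; exact: measurable_funM.
by rewrite /= lee_fin normrM normrM (ger0_norm M0) ler_wpM2r.
Qed.

Let bsigma_le (f : R3 R -> R) (g : R3 R -> R3 R) M : (forall y, `|sigma y| <= M) ->
  measurable_fun setT (fun x => sigma (g x)) -> leb3.-integrable setT (EFin \o f) ->
  \int[leb3]_x `|sigma (g x) * f x| <= M * \int[leb3]_x `|f x|.
Proof.
move=> hM mg fi.
have i1 := integrable_abse (bsigma mg fi); have i2 := integrable_abse fi.
rewrite -RintegralZ_R3//; apply: le_Rintegral => //; first exact: integrable_realZ.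
by move=> x _; rewrite normrM ler_wpM2r.
Qed.

Let msub1 y : measurable_fun setT (fun x => sigma (x - y)).
Proof. exact: measurable_translated. Qed.

Let msub2 x : measurable_fun setT (fun y => sigma (x - y)).
Proof.
rewrite (_ : (fun _ => _) = (fun y => sigma (-1 *: y + x))); last first.
  by apply/funext => y; rewrite scaleN1r addrC.
apply: measurable_smooth; apply: smooth_affine.
by have /test_functionP[] := ts.
Qed.

(** Moves the mollification from [m] onto [w]; the truncation [mt] supplies the integrability under
    which the integrals are exchanged. *)
Lemma kernel_swap :
  leb3.-integrable setT (EFin \o (fun y => w y * \int[leb3]_x (sigma (x - y) * m x))) /\
  \int[leb3]_y (w y * \int[leb3]_x (sigma (x - y) * m x)) =
  \int[leb3]_x (m x * \int[leb3]_y (sigma (x - y) * w y)).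
Proof.
have [M M0 hM] := bounded_of_test ts.
have iw := integrable_of_supported sw wr.
pose K (p : R3 R * R3 R) := w p.1 * (sigma (p.2 - p.1) * mt p.2).
have mK : measurable_fun setT K.
  apply: measurable_funM; first by apply: measurableT_comp sw.1 _; exact: measurable_fst.
  apply: measurable_funM; last by apply: measurableT_comp mmt _; exact: measurable_snd.
  apply: (measurableT_comp msigma).
  apply: (measurableT_comp msub (g := fun p : R3 R * R3 R => (p.2, p.1))).
  by apply: measurable_fun_pair; [exact: measurable_snd|exact: measurable_fst].
have i1 y : leb3.-integrable setT (EFin \o (fun x => K (y, x))).
  exact: (integrable_realZ measurableT (w y) (bsigma (msub1 y) imt)).
have i2 x : leb3.-integrable setT (EFin \o (fun y => K (y, x))).
  have -> : (fun y => K (y, x)) = (fun y => mt x * (sigma (x - y) * w y)).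
    by apply/funext => y; rewrite /K /=; ring.
  exact: (integrable_realZ measurableT (mt x) (bsigma (msub2 x) iw)).
have [] := fubini_bound (c := M * \int[leb3]_x `|mt x|) mK iw i1 i2.
  move=> y; rewrite (eq_Rintegral _ (g := fun x => `|w y| * `|sigma (x - y) * mt x|)); last first.
    by move=> x _; rewrite /K /= normrM.
  rewrite RintegralZ_R3; last exact: integrable_abse (bsigma (msub1 y) imt).
  by rewrite [leRHS]mulrC ler_wpM2l//; exact: (bsigma_le hM (msub1 y) imt).
move=> iF _ E.
have EF y : w y * \int[leb3]_x (sigma (x - y) * m x) = \int[leb3]_t K (y, t).
  apply: etrans _ (esym (RintegralZ_R3 (w y) (bsigma (msub1 y) imt))).
  have [->|wy] := eqVneq (w y) 0; first by rewrite !mul0r.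
  congr (_ * _); apply: eq_Rintegral => x _.
  have [->|sx] := eqVneq (sigma (x - y)) 0; first by rewrite !mul0r.
  by rewrite (mtE wy sx).
split; first by under eq_fun do rewrite EF.
transitivity (\int[leb3]_y \int[leb3]_t K (y, t)).
  by apply: eq_Rintegral => y _; exact: EF.
rewrite E; apply: eq_Rintegral => x _.
rewrite -RintegralZ_R3; last exact: bsigma (msub2 x) iw.
apply: eq_Rintegral => y _; rewrite /K /=.
have [->|wy] := eqVneq (w y) 0; first by rewrite !(mul0r, mulr0).
have [->|sx] := eqVneq (sigma (x - y)) 0; first by rewrite !(mul0r, mulr0).
by rewrite (mtE wy sx); ring.
Qed.

(** The substitution [x = y + z] turns the pairing of [w] with a mollification of [m] into the
    integral of [sigma] against the correlation of [w] and [m]. *)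
Lemma kernel_correlation :
  leb3.-integrable setT (EFin \o (fun z => sigma z * \int[leb3]_y (w y * m (y + z)))) /\
  \int[leb3]_y (w y * \int[leb3]_x (sigma (x - y) * m x)) =
  \int[leb3]_z (sigma z * \int[leb3]_y (w y * m (y + z))).
Proof.
have [M M0 hM] := bounded_of_test ts.
have iw := integrable_of_supported sw wr.
pose K (p : R3 R * R3 R) := w p.1 * (sigma p.2 * mt (p.2 + p.1)).
have madd : measurable_fun setT (fun p : R3 R * R3 R => p.2 + p.1 : R3 R).
  have c1 := @measurable_coord1 R; have c2 := @measurable_coord2 R; have c3 := @measurable_coord3 R.
  have h (c : R3 R -> R) : measurable_fun setT c ->
      measurable_fun setT (fun p : R3 R * R3 R => c p.2 + c p.1 : measurableTypeR R).
    by move=> mc; apply: measurable_funD; exact: measurableT_comp.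
  apply: measurable_fun_pair; last exact: (h _ c3).
  by apply: measurable_fun_pair; [exact: (h _ c1)|exact: (h _ c2)].
have mK : measurable_fun setT K.
  apply: measurable_funM; first by apply: measurableT_comp sw.1 _; exact: measurable_fst.
  apply: measurable_funM; last exact: measurableT_comp mmt madd.
  by apply: (measurableT_comp msigma); exact: measurable_snd.
have imty y : leb3.-integrable setT (EFin \o (fun z => mt (z + y))).
  by have := integrable_translate y measurableT mmt imt; rewrite preimage_setT.
have i1 y : leb3.-integrable setT (EFin \o (fun x => K (y, x))).
  exact: (integrable_realZ measurableT (w y) (bsigma (g := id) msigma (imty y))).
have i3 z := L2loc_mul_integrable z sw wr lm.
have wmt' y z : w y != 0 -> sigma z != 0 -> m (z + y) = mt (z + y).
  by move=> wy sz; apply: mtE wy _; rewrite addrK.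
have wmt y z : sigma z * (w y * m (y + z)) = K (y, z).
  rewrite /K /=; have [->|wy] := eqVneq (w y) 0; first by rewrite !(mul0r, mulr0).
  have [->|sz] := eqVneq (sigma z) 0; first by rewrite !(mul0r, mulr0).
  by rewrite -wmt'// [y + z]addrC; ring.
have i2 z : leb3.-integrable setT (EFin \o (fun y => K (y, z))).
  under eq_fun do rewrite -wmt; exact: integrable_realZ.
have E2 z : \int[leb3]_y K (y, z) = sigma z * \int[leb3]_y (w y * m (y + z)).
  by rewrite -RintegralZ_R3//; apply: eq_Rintegral => y _; rewrite wmt.
have [] := fubini_bound (c := M * \int[leb3]_x `|mt x|) mK iw i1 i2.
  move=> y; rewrite (eq_Rintegral _ (g := fun x => `|w y| * `|sigma x * mt (x + y)|)); last first.
    by move=> x _; rewrite /K /= normrM.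
  rewrite RintegralZ_R3; last exact: integrable_abse (bsigma (g := id) msigma (imty y)).
  rewrite [leRHS]mulrC ler_wpM2l//.
  apply: le_trans (bsigma_le (g := id) hM msigma (imty y)) _.
  have := integral_translateT y (measurableT_comp (@normr_measurable R setT) mmt).
  by move=> /= ->.
move=> _ iT E; split; first by move: iT; under eq_fun do rewrite E2.
under [RHS]eq_Rintegral => z _ do rewrite -E2.
rewrite -E; apply: eq_Rintegral => y _.
apply: etrans _ (esym (RintegralZ_R3 (w y) (bsigma (g := id) msigma (imty y)))).
have [->|wy] := eqVneq (w y) 0; first by rewrite !mul0r.
congr (_ * _).
have := integral_translateT y (f := fun x => sigma (x - y) * m x).
move=> <-; last by apply: measurable_funM; [exact: msub1|exact: lm.1].
apply: eq_Rintegral => x _; rewrite addrK.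
have [->|sx] := eqVneq (sigma x) 0; first by rewrite !mul0r.
by rewrite -wmt'.
Qed.

End Kernel.

Lemma correlation_continuous r w m (z : nat -> R3 R) :
  sq_integrable setT w -> supported_in r w -> L2loc m ->
  (forall n, `|z n| <= 1) -> z n @[n --> \oo] --> (0 : R3 R) ->
  forall e : R, 0 < e -> \forall n \near \oo,
    `|\int[leb3]_y (w y * m (y + z n)) - \int[leb3]_y (w y * m y)| <= e.
Proof.
move=> sw wr lm z1 z0 e e0.
have mb : measurable (box (r + 1) : set (R3 R)) by exact: measurable_box.
have [mm imm] := @L2loc_box (r + 1) _ lm.
pose M := \int[leb3]_(y in box (r + 1)) (m y ^+ 2).
have M0 : 0 <= M by apply: Rintegral_ge0 => y _; exact: sqr_ge0.
(* The weight in [|a * b| <= t / 2 * b^2 + t^-1 / 2 * a^2]: the first term integrates to at most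
   [t * M / 2 <= e / 2], the second to at most [e / 2] once the modulus of [w] is below [e * t]. The
   summand 1 covers [M = 0]. *)
pose t := e / (M + 1).
have t0 : 0 < t by apply: divr_gt0 => //; lra.
have tM : t * M <= e.
  by rewrite /t mulrAC ler_pdivrMr; [nra|lra].
have nz1 n : `|- z n| <= 1 by rewrite normrN.
have nz0 : - z n @[n --> \oo] --> (0 : R3 R) by rewrite -oppr0; exact: cvgN.
near=> n.
have hn : \int[leb3]_y ((w (y - z n) - w y) ^+ 2) <= e * t.
  by near: n; apply: (translation_continuity nz1 nz0 sw wr); exact: mulr_gt0.
have swn : sq_integrable setT (fun y => w (y - z n) - w y).
  by apply: sq_integrableB => //; exact: sq_integrable_translateT.
have supp : supported_in (r + 1) (fun y => w (y - z n) - w y).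
  move=> y; have [w0|/wr yr _] := eqVneq (w (y - z n)) 0; last first.
    by rewrite -[in leLHS](subrK (z n) y); apply: le_trans (ler_normD _ _) _; exact: lerD.
  by rewrite w0 sub0r oppr_eq0 => /wr /le_trans; apply; rewrite lerDl.
(* The translation is moved from [m], which is only locally square integrable, to [w], whose
   translates converge in L2. *)
have -> : \int[leb3]_y (w y * m (y + z n)) = \int[leb3]_y (w (y - z n) * m y).
  rewrite -(integral_translateT (z n) (f := fun y => w (y - z n) * m y)); last first.
    by apply: measurable_funM; [exact: measurable_translated sw.1|exact: lm.1].
  by apply: eq_Rintegral => y _; rewrite addrK.
have i0 := L2loc_mul_integrable 0 sw wr lm.
have {}i0 : leb3.-integrable setT (EFin \o (fun y => w y * m y)).
  by move: i0; under eq_fun do rewrite addr0.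
have i1 : leb3.-integrable setT (EFin \o (fun y => (w (y - z n) - w y) * m y)).
  by have := L2loc_mul_integrable 0 swn supp lm; under eq_fun do rewrite addr0.
have i2 : leb3.-integrable setT (EFin \o (fun y => w (y - z n) * m y)).
  have := integrable_realD measurableT i1 i0.
  by under eq_fun do rewrite -mulrDl subrK.
rewrite -RintegralB//; under eq_Rintegral do rewrite -mulrBl.
have suppm : supported_in (r + 1) (fun y => (w (y - z n) - w y) * m y).
  by move=> y; rewrite mulf_eq0 negb_or => /andP[/supp].
apply: le_trans (le_normr_Rintegral _ i1) _ => //.
rewrite (Rintegral_supported (r := r + 1)); last by move=> y; rewrite normr_eq0; exact: suppm.
have swnb := (sq_integrableS measurableT mb (@subsetT _ _) swn).2.
have j1 := integrable_realZ mb (t / 2) imm.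
have j2 := integrable_realZ mb (t^-1 / 2) swnb.
apply: (@le_trans _ _ (\int[leb3]_(y in box (r + 1))
    (t / 2 * m y ^+ 2 + t^-1 / 2 * (w (y - z n) - w y) ^+ 2))).
  apply: le_Rintegral => //.
  - exact: integrableS measurableT mb (@subsetT _ _) (integrable_abse i1).
  - exact: integrable_realD.
  - move=> y _; set a := w (y - z n) - w y; rewrite normrM.
    rewrite -(real_normK (num_real (m y))) -(real_normK (num_real a)).
    have := normr_ge0 a; have := normr_ge0 (m y).
    set b := `|m y|; set c := `|a| => b0 c0.
    have ht : t * t^-1 = 1 by rewrite mulfV// gt_eqF.
    have : 0 <= t^-1 / 2 * (t * b - c) ^+ 2.
      by rewrite mulr_ge0 ?sqr_ge0// divr_ge0// invr_ge0 ltW.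
    have -> (ti : R) : ti / 2 * (t * b - c) ^+ 2 =
        (t * ti) * t / 2 * b ^+ 2 - (t * ti) * b * c + ti / 2 * c ^+ 2 by field.
    by rewrite ht; lra.
rewrite RintegralD// !RintegralZl// -/M.
have suppsq : supported_in (r + 1) (fun y => (w (y - z n) - w y) ^+ 2).
  by move=> y; rewrite sqrf_eq0; exact: supp.
rewrite -(Rintegral_supported suppsq).
have : t^-1 / 2 * \int[leb3]_y (w (y - z n) - w y) ^+ 2 <= e / 2.
  rewrite mulrAC ler_pM2r; last by rewrite invr_gt0.
  by rewrite ler_pdivrMl// mulrC.
nra.
Unshelve. all: by end_near. Qed.

Lemma leb3_box_gt0 r : 0 < r -> (0 < leb3 (box r))%E.
Proof.
move=> r0; have Er : lebesgue_measure (`[- r, r]%classic : set (measurableTypeR R)) = (2 * r)%:E.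
  rewrite lebesgue_measure_itv/= lte_fin ifT; last by rewrite gtrN.
  by rewrite -EFinB; congr EFin; ring.
have E2 := @product_measure1E _ _ _ _ R (@lebesgue_measure R) (@lebesgue_measure R)
  _ _ (measurable_itv `[- r, r]) (measurable_itv `[- r, r]).
have E3 := @product_measure1E _ _ _ _ R leb2 (@lebesgue_measure R)
  _ _ (measurableX (measurable_itv `[- r, r]) (measurable_itv `[- r, r])) (measurable_itv `[- r, r]).
apply: lt_le_trans (_ : leb3 (box r) >= (2 * r * (2 * r) * (2 * r))%:E)%E; last first.
  rewrite le_eqVlt; apply/orP; left; apply/eqP/esym.
  apply: etrans; first exact: E3.
  rewrite [X in (X * _)%E](_ : _ = (2 * r * (2 * r))%:E); first by rewrite [X in (_ * X)%E]Er -EFinM.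
  by apply: etrans; [exact: E2|rewrite [X in (X * _)%E]Er [X in (_ * X)%E]Er -EFinM].
by rewrite lte_fin !mulr_gt0.
Qed.

End Mollification.

(** * Local div-curl lemma and the fundamental lemma of the calculus of variations *)

Section DivCurl.
Context {R : realType}.
Implicit Types (f g h u v w m T : R3 R -> R) (y z x a : R3 R) (i j : 'I_3) (r s : R).

Lemma test_mollifier (s : R) : 0 < s -> test_function (mollifier s).
Proof.
move=> s0; apply/test_functionP; split; first exact: smooth_mollifier.
exists s; first exact: ltW.
move=> y yn0; apply: ltW; rewrite -mollifier_gt0//.
by rewrite lt_def yn0 mollifier_ge0.
Qed.

(** Were [T 0] positive, [T] would be positive on a ball by sequential continuity, and testing it
    with a bump supported there would give a positive integral. *)
Let vanishing_le T :
  (forall sigma, test_function sigma ->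
    leb3.-integrable setT (EFin \o (fun z => sigma z * T z)) /\
    \int[leb3]_z (sigma z * T z) = 0) ->
  (forall z : nat -> R3 R, (forall n, `|z n| <= 1) -> z n @[n --> \oo] --> (0 : R3 R) ->
    forall e : R, 0 < e -> \forall n \near \oo, `|T (z n) - T 0| <= e) ->
  T 0 <= 0.
Proof.
move=> hT cT; rewrite leNgt; apply/negP => T0.
have [d d0 Td] : exists2 d : R, 0 < d & forall z, `|z| < d -> 0 < T z.
  apply: contrapT => hd.
  have hz (n : nat) : exists z, `|z| < n.+1%:R^-1 /\ T z <= 0.
    apply: contrapT => hz; apply: hd; exists n.+1%:R^-1; first by rewrite invr_gt0.
    by move=> z zn; rewrite ltNge; apply/negP => Tz; apply: hz; exists z.
  have [z hzn] := choice hz.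
  have z1 n : `|z n| <= 1.
    by apply: le_trans (ltW (hzn n).1) _; rewrite invf_le1 ?ler1n.
  have z0 : z n @[n --> \oo] --> (0 : R3 R).
    apply/cvgr0Pnorm_lt => e e0; near=> n; apply: lt_trans (hzn n).1 _.
    by near: n; exact: (near_infty_natSinv_lt (PosNum e0)).
  have T02 : 0 < T 0 / 2 by lra.
  have [N _ /(_ N (leqnn N))] := cT z z1 z0 _ T02.
  by rewrite ler_norml => /andP[h _]; have := (hzn N).2; lra.
have [iT eT] := hT _ (test_mollifier d0).
have fpos z : 0 <= mollifier d z * T z.
  have [zd|zd] := ltP `|z| d; first by rewrite mulr_ge0 ?mollifier_ge0// ltW// Td.
  have -> : mollifier d z = 0.
    by apply/eqP; rewrite eq_le mollifier_ge0 andbT leNgt mollifier_gt0// -leNgt.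
  by rewrite mul0r.
have : (\int[leb3]_z `|(mollifier d z * T z)%:E|)%E = 0%E.
  under eq_integral => z _ do rewrite /= ger0_norm ?fpos//.
  rewrite -[LHS]fineK; first by rewrite -/(Rintegral _ _ _) eT.
  exact: integrable_fin_num iT.
move/(ae_eq_integral_abs leb3 measurableT (measurable_int _ iT)).
move=> [N [mN N0 hN]].
have : (leb3 (box (d / 2)) <= leb3 N)%E.
  apply: le_measure; rewrite ?inE//; first exact: measurable_box.
  move=> z /boxE zd; apply: hN => /= /(_ Logic.I) /eqP; rewrite eqe.
  have zd' : `|z| < d by lra.
  by rewrite gt_eqF// mulr_gt0 ?Td// mollifier_gt0.
by rewrite N0; apply/negP; rewrite -ltNge leb3_box_gt0//; lra.
Unshelve. all: by end_near. Qed.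

Lemma vanishing_at0 T :
  (forall sigma, test_function sigma ->
    leb3.-integrable setT (EFin \o (fun z => sigma z * T z)) /\
    \int[leb3]_z (sigma z * T z) = 0) ->
  (forall z : nat -> R3 R, (forall n, `|z n| <= 1) -> z n @[n --> \oo] --> (0 : R3 R) ->
    forall e : R, 0 < e -> \forall n \near \oo, `|T (z n) - T 0| <= e) ->
  T 0 = 0.
Proof.
move=> hT cT; apply/eqP; rewrite eq_le vanishing_le//=.
rewrite -oppr_le0; apply: (vanishing_le (T := fun z => - T z)) => [sigma ts|z z1 z0 e e0].
  have [iT eT] := hT _ ts.
  rewrite (_ : (fun _ => _) = (fun z => -1 * (sigma z * T z))); last first.
    by apply/funext => z; ring.
  by split; [exact: integrable_realZ|rewrite RintegralZ_R3// eT mulr0].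
by apply: filterS (cT z z1 z0 e e0) => n; rewrite -opprD normrN.
Qed.

(* The continuous function [z |-> \sum_k \int w_k(y) m_k(y + z) dy] is orthogonal to every test
   function, hence vanishes at [0]. *)
Lemma mollification (I : finType) (r : R) (w m : I -> R3 R -> R) :
  (forall k, sq_integrable setT (w k)) -> (forall k, supported_in r (w k)) ->
  (forall k, L2loc (m k)) ->
  (forall sigma, test_function sigma ->
    \sum_k \int[leb3]_y (w k y * \int[leb3]_x (sigma (x - y) * m k x)) = 0) ->
  \sum_k \int[leb3]_y (w k y * m k y) = 0.
Proof.
move=> sw wr lm h.
pose T z := \sum_k \int[leb3]_y (w k y * m k (y + z)).
have T0 : T 0 = \sum_k \int[leb3]_y (w k y * m k y).
  by apply: eq_bigr => k _; apply: eq_Rintegral => y _; rewrite addr0.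
rewrite -T0; apply: vanishing_at0 => [sigma ts|z z1 z0 e e0].
  have [_ [s _ ss]] := (test_functionP sigma).1 ts.
  have c k := kernel_correlation (sw k) (wr k) (lm k) ts ss.
  have E : (fun z => sigma z * T z) =
      (fun z => \sum_k (sigma z * \int[leb3]_y (w k y * m k (y + z)))).
    by apply/funext => z; rewrite mulr_sumr.
  split; rewrite E; first by apply: integrable_real_sum => // k _; exact: (c k).1.
  rewrite Rintegral_sum//; last by move=> k _; exact: (c k).1.
  by apply: etrans (h _ ts); apply: eq_bigr => k _; rewrite (c k).2.
have I0 : 0 < #|I|%:R + 1 :> R by rewrite ltr_wpDl.
have e' : 0 < e / (#|I|%:R + 1) by exact: divr_gt0.
have : \forall n \near \oo, forall k,
    `|\int[leb3]_y (w k y * m k (y + z n)) - \int[leb3]_y (w k y * m k y)| <= e / (#|I|%:R + 1).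
  apply: filter_forall => k.
  exact: (correlation_continuous (sw k) (wr k) (lm k) z1 z0).
apply: filterS => n hn; rewrite T0 /T -sumrB.
apply: le_trans (ler_norm_sum _ _ _) _.
apply: (@le_trans _ _ (\sum_(k : I) (e / (#|I|%:R + 1)))); first exact: ler_sum.
rewrite sumr_const -[X in X <= _]mulr_natr mulrAC ler_pdivrMr// ler_pM2l//.
by rewrite lerDl.
Qed.

(** Orthogonality to the translates of test functions makes every mollification of [m] vanish.
    [mollification], with [w] the restriction of [m] to a box, then says that [m ^+ 2] has integral
    0 over that box. *)
Lemma L2loc_null m : L2loc m ->
  (forall phi, test_function phi -> \int[leb3]_y (phi y * m y) = 0) ->
  {ae leb3, forall y, m y = 0}.
Proof.
move=> lm h.
have hr (n : nat) : {ae leb3, forall y, `|y| <= n%:R -> m y = 0}.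
  pose w y : R := \1_(box n%:R) y * m y.
  have mb : measurable (box n%:R : set (R3 R)) by exact: measurable_box.
  have wr : supported_in n%:R w.
    move=> y; rewrite /w indicE; case: (boolP (_ \in _)) => [|_]; last by rewrite mul0r eqxx.
    by rewrite inE => /boxE.
  have sw : sq_integrable setT w.
    apply: (sq_integrable_supported wr); apply: (@sq_integrable_bounded _ _ _ _ 1) => //.
      by move=> y; rewrite indicE; case: (_ \in _); rewrite ?normr1 ?normr0.
    exact: L2loc_box.
  have e0 : \sum_(k : 'I_1) \int[leb3]_y (w y * m y) = 0.
    apply: (@mollification _ n%:R (fun=> w) (fun=> m)) => // sigma ts.
    rewrite big1// => _ _; under eq_Rintegral => y _.
      rewrite (h (fun x => sigma (x - y))); last first.
        have := test_function_affine (- y) (oner_neq0 R) ts.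
        by under eq_fun do rewrite scale1r.
      rewrite mulr0; over.
    exact: Rintegral0.
  move: e0; rewrite big_ord1 => e0.
  have wm : (fun y => w y * m y) = (fun y => w y ^+ 2).
    by apply/funext => y; rewrite /w indicE; case: (_ \in _); rewrite /= ?mul0r ?expr0n ?mul1r.
  have i2 := sw.2.
  have : (\int[leb3]_y `|(w y ^+ 2)%:E|)%E = 0%E.
    under eq_integral => y _ do rewrite /= ger0_norm ?sqr_ge0//.
    rewrite -[LHS]fineK; first by rewrite -/(Rintegral _ _ _) -wm e0.
    exact: integrable_fin_num i2.
  move/(ae_eq_integral_abs leb3 measurableT (measurable_int _ i2)).
  apply: filterS => y /= /(_ Logic.I) [] /eqP; rewrite sqrf_eq0 => /eqP wy0 /boxE yn.
  by move: wy0; rewrite /w indicE (mem_set yn) mul1r.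
have := ae_foralln hr; apply: filterS => y hy.
by apply: (hy (Num.bound `|y|)); apply/ltW/archi_boundP.
Qed.

Lemma L2loc_test_integrable f phi : L2loc f -> test_function phi ->
  leb3.-integrable setT (EFin \o (fun y => f y * phi y)).
Proof.
move=> lf tphi; have [_ [r _ pr]] := (test_functionP phi).1 tphi.
have := L2loc_mul_integrable 0 (test_sq_integrable tphi) pr lf.
by under eq_fun do rewrite addr0 mulrC.
Qed.

(* Integrating by parts with [m] replaced by a mollification of [m], which is still divergence
   free; [mollification] makes this enough. *)
Lemma div_curl_local (m h : 'I_3 -> R3 R -> R) f chi :
  (forall j, L2loc (m j)) -> (forall j, L2loc (h j)) -> L2loc f ->
  (forall phi, test_function phi -> \sum_j \int[leb3]_y (m j y * partial j phi y) = 0) ->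
  (forall j phi, test_function phi ->
    \int[leb3]_y (f y * partial j phi y) = - \int[leb3]_y (h j y * phi y)) ->
  test_function chi ->
  \sum_j \int[leb3]_y ((chi y * h j y + f y * partial j chi y) * m j y) = 0.
Proof.
move=> lm lh lf mdiv fgrad tchi.
have [schi [r r0 chir]] := (test_functionP chi).1 tchi.
have tdchi j := test_function_partial j tchi.
have dchir j : supported_in r (partial j chi) by exact: supported_partial.
have mb : measurable (box r : set (R3 R)) by exact: measurable_box.
have prod u v : supported_in r u -> test_function u -> L2loc v ->
    supported_in r (fun y => u y * v y) /\ sq_integrable setT (fun y => u y * v y).
  move=> ur tu lv; have supp : supported_in r (fun y => u y * v y).
    by move=> y; rewrite mulf_eq0 negb_or => /andP[/ur].
  split=> //; apply: (sq_integrable_supported supp).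
  have [M _ hM] := bounded_of_test tu.
  apply: (sq_integrable_bounded mb _ hM); last exact: L2loc_box.
  by apply: measurable_smooth; have /test_functionP[] := tu.
pose w j y := chi y * h j y + partial j chi y * f y.
have wE j y : (chi y * h j y + f y * partial j chi y) * m j y = w j y * m j y.
  by rewrite /w [f y * _]mulrC.
under eq_bigr => j _ do under eq_Rintegral => y _ do rewrite wE.
have [fchir sfchi] := prod _ _ chir tchi lf.
have sw j : sq_integrable setT (w j) /\ supported_in r (w j).
  split.
    apply: sq_integrableD => //; first by have [] := prod _ _ chir tchi (lh j).
    by have [] := prod _ _ (dchir j) (tdchi j) lf.
  move=> y wy; have [c0|/chir//] := eqVneq (chi y) 0.
  by apply: (dchir j); apply: contraNneq wy => d0; rewrite /w c0 d0 !mul0r addr0.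
apply: (@mollification _ r) => [j|j|//|sigma tsigma].
- exact: (sw j).1.
- exact: (sw j).2.
have [ssigma [s s0 sigmas]] := (test_functionP sigma).1 tsigma.
(* [w] is the weak gradient of [chi * f]. The sign from the integration by parts cancels against the
   sign from differentiating [sigma (x - y)] in [y]. *)
have trans j x : \int[leb3]_y (sigma (x - y) * w j y) =
    \int[leb3]_y (partial j sigma (x - y) * (chi y * f y)).
  have sE y : sigma (x - y) = sigma (-1 *: y + x) by rewrite scaleN1r addrC.
  have xyE y : x - y = -1 *: y + x by rewrite scaleN1r addrC.
  have ssx : smooth (fun y => sigma (-1 *: y + x)) by exact: smooth_affine.
  pose phi y := chi y * sigma (-1 *: y + x).
  have tphi : test_function phi by exact: test_function_mulr.
  have dphi y : partial j phi y =
      - (chi y * partial j sigma (x - y)) + sigma (x - y) * partial j chi y.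
    by rewrite partialM// partial_affine// sE xyE; ring.
  have tdsx : test_function (fun y => partial j chi y * sigma (-1 *: y + x)).
    exact: test_function_mulr.
  have tcd : test_function (fun y => chi y * partial j sigma (-1 *: y + x)).
    apply: test_function_mulr; last exact: tchi.
    by apply: smooth_affine; exact: smooth_partial.
  have i1 := L2loc_test_integrable lf tdsx.
  have i2 := L2loc_test_integrable lf tcd.
  have i3 := L2loc_test_integrable (lh j) tphi.
  have := fgrad j _ tphi.
  under eq_Rintegral => y _.
    rewrite dphi (_ : f y * _ = f y * (partial j chi y * sigma (-1 *: y + x)) -
      f y * (chi y * partial j sigma (-1 *: y + x))); last first.
      by rewrite sE xyE; ring.
    over.
  rewrite RintegralB// => E.
  transitivity (\int[leb3]_y (h j y * phi y + f y * (partial j chi y * sigma (-1 *: y + x)))).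
    by apply: eq_Rintegral => y _; rewrite /w /phi sE; ring.
  rewrite RintegralD//.
  transitivity (\int[leb3]_y (f y * (chi y * partial j sigma (-1 *: y + x)))).
    by move: E; lra.
  by apply: eq_Rintegral => y _; rewrite xyE; ring.
have tds j := test_function_partial j tsigma.
have dss j : supported_in s (partial j sigma) by exact: supported_partial.
transitivity (\sum_j \int[leb3]_y ((chi y * f y) *
    \int[leb3]_x (partial j sigma (x - y) * m j x))).
  apply: eq_bigr => j _.
  rewrite (kernel_swap (sw j).1 (sw j).2 (lm j) tsigma sigmas).2.
  rewrite (kernel_swap sfchi fchir (lm j) (tds j) (dss j)).2.
  by apply: eq_Rintegral => x _; rewrite trans.
rewrite -Rintegral_sum//; last first.
  by move=> j _; exact: (kernel_swap sfchi fchir (lm j) (tds j) (dss j)).1.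
(* For fixed [y], the sum is the divergence of [m] tested on the translate [x |-> sigma (x - y)]. *)
rewrite (eq_Rintegral _ (g := fun=> 0)) ?Rintegral0// => y _.
rewrite -mulr_sumr; have tsy := test_function_affine (- y) (oner_neq0 R) tsigma.
have := mdiv _ tsy => E; rewrite -[RHS](mulr0 (chi y * f y)) -[in RHS]E; congr (_ * _).
apply: eq_bigr => j _; apply: eq_Rintegral => x _.
by rewrite partial_affine// mul1r scale1r mulrC.
Qed.

End DivCurl.

(** * The lattice and its cell *)

Section Grid.
Implicit Types (N : nat) (k : 'I_3 -> int).

(* The index [m] of [grid N] stands for the lattice vector with integer
   coordinates [m i - N], so that [grid N] covers [-N, N]^3. *)
Local Notation grid N := {ffun 'I_3 -> 'I_N.*2.+1}.

Definition gridz N (m : grid N) i : int := (m i)%:Z - N%:Z.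

Lemma gridz_inj N : injective (@gridz N).
Proof.
move=> m m' h; apply/ffunP => i; apply: val_inj.
by have /addIr[] := congr1 (fun k => k i) h.
Qed.

Lemma gridz_surj N k : (forall i, `|k i| <= N%:Z) -> exists m : grid N, gridz m = k.
Proof.
move=> kN; exists [ffun i => inord (absz (k i + N%:Z))].
apply/funext => i; rewrite /gridz ffunE inordK; last first.
  by have := kN i; rewrite -addnn; lia.
by have := kN i; lia.
Qed.

End Grid.

Section Lattice.
Context {R : realType} (g : 'I_3 -> R3 R).
Hypothesis g_indep : lin_indep g.
Implicit Types (y z a : R3 R) (i j : 'I_3) (k : 'I_3 -> int) (f h p : R3 R -> R).

Lemma vecD y z : vec (y + z) = vec y + vec z.
Proof. by apply/matrixP => -[[|[|[|//]]] ?] j; rewrite !mxE. Qed.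

Lemma vecZ (c : R) y : vec (c *: y) = c *: vec y.
Proof. by apply/matrixP => -[[|[|[|//]]] ?] j; rewrite !mxE. Qed.

Lemma vec_inj : injective (@vec R).
Proof.
move=> [[y1 y2] y3] [[z1 z2] z3] /matrixP h.
have := h 0 0; have := h 1 0; have := h (inord 2) 0; rewrite !mxE /=.
by rewrite inordK//= => -> -> ->.
Qed.

Let G : 'M[R]_3 := \matrix_(i, j) vec (g i) j ord0.

Let Gunit : G \in unitmx.
Proof. by rewrite -row_free_unit. Qed.

(** The coordinates in the basis [g]. The generators are the rows of [G], hence the transpose and
    the product on the right. *)
Definition lcoord i y : R := ((vec y)^T *m invmx G) ord0 i.

Lemma lcoordD i y z : lcoord i (y + z) = lcoord i y + lcoord i z.
Proof. by rewrite /lcoord vecD linearD mulmxDl mxE. Qed.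

Lemma lcoordZ i c y : lcoord i (c *: y) = c * lcoord i y.
Proof. by rewrite /lcoord vecZ linearZ -scalemxAl mxE. Qed.

Lemma lcoord0 i : lcoord i 0 = 0.
Proof. by rewrite -(scale0r (0 : R3 R)) lcoordZ mul0r. Qed.

Lemma lcoordN i y : lcoord i (- y) = - lcoord i y.
Proof. by rewrite -scaleN1r lcoordZ mulN1r. Qed.

Lemma lcoordB i y z : lcoord i (y - z) = lcoord i y - lcoord i z.
Proof. by rewrite lcoordD lcoordN. Qed.

Lemma lcoord_sum i (I : Type) (s : seq I) (F : I -> R3 R) :
  lcoord i (\sum_(l <- s) F l) = \sum_(l <- s) lcoord i (F l).
Proof.
elim: s => [|l s IHs]; first by rewrite !big_nil lcoord0.
by rewrite !big_cons lcoordD IHs.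
Qed.

Lemma lcoord_g i j : lcoord i (g j) = (i == j)%:R.
Proof.
rewrite /lcoord (_ : (vec (g j))^T = row j G); last first.
  by apply/matrixP => a b; rewrite (ord1 a) !mxE.
by rewrite -row_mul mulmxV// rowE mulmx1 mxE eqxx eq_sym.
Qed.

Lemma lcoord_comb i (s : 'I_3 -> R) : lcoord i (\sum_j s j *: g j) = s i.
Proof.
rewrite lcoord_sum (bigD1 i)//= lcoordZ lcoord_g eqxx mulr1 big1 ?addr0// => j ji.
by rewrite lcoordZ lcoord_g eq_sym (negbTE ji) mulr0.
Qed.

Lemma lcoord_decomp y : y = \sum_i lcoord i y *: g i.
Proof.
apply: vec_inj; apply: (can_inj (@trmxK _ _ _)).
have vs (s : seq 'I_3) (F : 'I_3 -> R3 R) : vec (\sum_(l <- s) F l) = \sum_(l <- s) vec (F l).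
  elim: s => [|l s IHs]; last by rewrite !big_cons vecD IHs.
  by rewrite !big_nil -(scale0r (0 : R3 R)) vecZ scale0r.
rewrite vs raddf_sum /=.
rewrite -[LHS](mulmxKV Gunit) mulmx_sum_row; apply: eq_bigr => i _.
rewrite vecZ linearZ /=; congr (_ *: _).
by apply/matrixP => a b; rewrite (ord1 a) !mxE.
Qed.

Lemma lcoord_linear i (c : R) y z : lcoord i (c *: y + z) = c * lcoord i y + lcoord i z.
Proof. by rewrite lcoordD lcoordZ. Qed.

Lemma lcoord_bound : exists2 c : R, 0 <= c & forall i y, `|lcoord i y| <= c * `|y|.
Proof.
exists (\sum_(a : 'I_3) \sum_(b : 'I_3) `|invmx G a b|).
  by apply: sumr_ge0 => a _; exact: sumr_ge0.
move=> i y; rewrite /lcoord mxE; apply: le_trans (ler_norm_sum _ _ _) _.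
rewrite mulr_suml; apply: ler_sum => a _; rewrite normrM mulrC.
apply: ler_pM => //.
  rewrite (bigD1 i)//= lerDl; exact: sumr_ge0.
rewrite !mxE !prod_normE; case: a => -[|[|[|//]]] ha /=; rewrite !le_max !lexx ?orbT//.
Qed.

Lemma continuous_lcoord i : continuous (lcoord i).
Proof.
have [c c0 hc] := lcoord_bound; move=> y; apply/cvgrPdist_lt => e e0.
have c1 : 0 < c + 1 by lra.
near=> z; rewrite -lcoordB; apply: le_lt_trans (hc i _) _.
apply: (@le_lt_trans _ _ ((c + 1) * `|y - z|)); first by rewrite ler_wpM2r//; lra.
rewrite mulrC -ltr_pdivlMr//; near: z.
have d0 : 0 < e / (c + 1) by exact: divr_gt0.
by apply: filterS (nbhsx_ballx y _ d0) => z; rewrite prod_norm_ball.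
Unshelve. all: by end_near. Qed.

Lemma measurable_lcoord i : measurable_fun setT (lcoord i).
Proof. apply: continuous_measurable_R3; exact: continuous_lcoord. Qed.

Lemma smooth_to_lcoord n i : smooth_to n (lcoord i).
Proof. by apply: smooth_to_linear; [exact: continuous_lcoord|move=> *; exact: lcoord_linear]. Qed.

Lemma cellE y : cell g y <-> forall i, 0 <= lcoord i y <= 1.
Proof.
split=> [[s s01 ->] i|h]; first by rewrite lcoord_comb.
by exists (lcoord^~ y) => //; exact: lcoord_decomp.
Qed.

(** The lattice translates of the half-open cell partition the space exactly, whereas those of
    [cell g] overlap along faces. *)
Definition hcell : set (R3 R) := [set y | forall i, 0 <= lcoord i y < 1].

Definition lat k : R3 R := \sum_i g i *~ k i.

Lemma lcoord_lat i k : lcoord i (lat k) = (k i)%:~R.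
Proof.
rewrite /lat (_ : \sum_j g j *~ k j = \sum_j (k j)%:~R *: g j) ?lcoord_comb//.
by apply: eq_bigr => j _; rewrite scaler_int.
Qed.

Lemma latD k k' : lat (fun i => k i + k' i) = lat k + lat k'.
Proof. by rewrite /lat -big_split; apply: eq_bigr => i _; rewrite mulrzDr. Qed.

Lemma latN k : lat (fun i => - k i) = - lat k.
Proof. by rewrite /lat -sumrN; apply: eq_bigr => i _; rewrite mulrNz. Qed.

Lemma hcell_sub : hcell `<=` cell g.
Proof. by move=> y yh; apply/cellE => i; have /andP[-> /ltW ->] := yh i. Qed.

Lemma cell_bounded : exists2 r : R, 0 <= r & cell g `<=` box r.
Proof.
exists (\sum_i `|g i|); first exact: sumr_ge0.
move=> y /cellE yc; apply/boxE; rewrite {1}(lcoord_decomp y).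
apply: le_trans (ler_norm_sum _ _ _) _; apply: ler_sum => i _.
have /andP[c0 c1] := yc i.
by rewrite normrZ ger0_norm// ler_piMl.
Qed.

Let measurable_forall (P : 'I_3 -> set (R3 R)) : (forall i, measurable (P i)) ->
  measurable [set y | forall i, P i y].
Proof.
move=> mP; rewrite (_ : [set _ | _] = P 0 `&` P 1 `&` P (inord 2)).
  by apply: measurableI => //; exact: measurableI.
apply/seteqP; split => [y h|y [[h0 h1] h2] [[|[|[|//]]] hi]].
- by split; [split|]; exact: h.
- by rewrite (_ : Ordinal hi = 0)//; exact: val_inj.
- by rewrite (_ : Ordinal hi = 1)//; exact: val_inj.
- by rewrite (_ : Ordinal hi = inord 2)//; apply: val_inj; rewrite /= inordK.
Qed.

Lemma measurable_cell : measurable (cell g).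
Proof.
rewrite (_ : cell g = [set y | forall i, (lcoord i @^-1` `[0, 1]%classic) y]).
  apply: measurable_forall => i; rewrite -[X in measurable X]setTI.
  by apply: measurable_lcoord => //; exact: measurable_itv.
by apply/seteqP; split => y /=; rewrite cellE => h i; have := h i; rewrite /= in_itv.
Qed.

Lemma measurable_hcell : measurable hcell.
Proof.
rewrite (_ : hcell = [set y | forall i, (lcoord i @^-1` `[0, 1[%classic) y]).
  apply: measurable_forall => i; rewrite -[X in measurable X]setTI.
  by apply: measurable_lcoord => //; exact: measurable_itv.
by apply/seteqP; split => y h i; have := h i; rewrite /= in_itv.
Qed.

Lemma leb3_cell_lty : (leb3 (cell g) < +oo)%E.
Proof.
have [r _ hr] := cell_bounded; apply: le_lt_trans (leb3_box_lty r).
by apply: le_measure; rewrite ?inE//; [exact: measurable_cell|exact: measurable_box].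
Qed.

(** The translates of a bounded piece of the face by [g i / (n + 1)] are disjoint, of equal measure,
    and contained in one box of finite measure. This replaces a change of variables. *)
Let face_null i r : leb3 (box r `&` lcoord i @^-1` [set 1]) = 0%E.
Proof.
set E := _ `&` _.
have mE : measurable E.
  apply: measurableI; first exact: measurable_box.
  by rewrite -[X in measurable X]setTI; apply: measurable_lcoord.
pose F (n : nat) : set (R3 R) := translate (- (n.+1%:R^-1 *: g i)) @^-1` E.
have mF n : measurable (F n) by exact: measurable_translate_preimage.
have FE n : leb3 (F n) = leb3 E by exact: leb3_translate.
have tF : trivIset setT F.
  apply/trivIsetP => a b _ _; apply: contra_neqP => /eqP/set0P[y [[_ ya] [_ yb]]].
  move: ya yb; rewrite /= /translate !lcoordB !lcoordZ !lcoord_g eqxx !mulr1 => ya yb.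
  have : a.+1%:R^-1 = b.+1%:R^-1 :> R.
    by apply: oppr_inj; apply: (addrI (lcoord i y)); rewrite ya yb.
  by move/invr_inj/eqP; rewrite eqr_nat => /eqP [].
have FB n : F n `<=` box (r + `|g i|).
  move=> y [/boxE yr _]; apply/boxE; rewrite -[y](subrK (n.+1%:R^-1 *: g i)).
  apply: le_trans (ler_normD _ _) _; apply: lerD => //.
  by rewrite normrZ ger0_norm// ler_piMl// invf_le1 ?ler1n.
have Eoo : (leb3 E < +oo)%E.
  apply: le_lt_trans (leb3_box_lty r); apply: le_measure; rewrite ?inE//.
    exact: measurable_box.
  by move=> y [].
have Ef : leb3 E \is a fin_num by rewrite ge0_fin_numE.
have bound (N : nat) : (N%:R%:E * leb3 E <= leb3 (box (r + `|g i|)))%E.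
  have -> : (N%:R%:E * leb3 E)%E = leb3 (\big[setU/set0]_(n < N) F n).
    apply/esym; apply: etrans; first exact: (measure_bigsetU leb3 mF tF).
    rewrite (eq_bigr (fun=> leb3 E)) => [|n _]; last exact: FE.
    by rewrite -(fineK Ef) sumEFin sumr_const card_ord -EFinM mulr_natl.
  apply: le_measure; rewrite ?inE; first exact: bigsetU_measurable.
    exact: measurable_box.
  by rewrite -bigcup_mkord; apply: bigcup_sub => n _; exact: FB.
have Bf : leb3 (box (r + `|g i|)) \is a fin_num by rewrite ge0_fin_numE// leb3_box_lty.
rewrite -(fineK Ef); congr EFin; apply/eqP; rewrite eq_le fine_ge0// andbT.
rewrite leNgt; apply/negP => e0.
have [N hN] : exists N : nat, fine (leb3 (box (r + `|g i|))) / fine (leb3 E) < N%:R.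
  exists (Num.bound (fine (leb3 (box (r + `|g i|))) / fine (leb3 E))).
  by apply: archi_boundP; rewrite divr_ge0// fine_ge0.
have := bound N; rewrite -(fineK Ef) -(fineK Bf) -EFinM lee_fin leNgt.
by rewrite -ltr_pdivrMr// hN.
Qed.

Lemma cell_boundary_null : leb3 (cell g `\` hcell) = 0%E.
Proof.
have [r _ hr] := cell_bounded.
have mD : measurable (cell g `\` hcell).
  by apply: measurableD; [exact: measurable_cell|exact: measurable_hcell].
pose E i := box r `&` lcoord i @^-1` [set 1].
have mE i : measurable (E i).
  apply: measurableI; first exact: measurable_box.
  by rewrite -[X in measurable X]setTI; apply: measurable_lcoord.
have sub : cell g `\` hcell `<=` E 0 `|` E 1 `|` E (inord 2).
  move=> y [yc yh]; apply: contrapT => hn; apply: yh => i.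
  have yr := hr _ yc.
  move: (yc) => /cellE /(_ i) /andP[-> c1] /=.
  rewrite lt_neqAle c1 andbT; apply/eqP => ci; apply: hn.
  case: i c1 ci => -[|[|[|//]]] hi _ ci.
  - by left; left; split => //=; rewrite (_ : 0 = Ordinal hi)//; exact: val_inj.
  - by left; right; split => //=; rewrite (_ : 1 = Ordinal hi)//; exact: val_inj.
  - by right; split => //=; rewrite (_ : inord 2 = Ordinal hi)//; apply: val_inj; rewrite /= inordK.
have E0 : leb3 (E 0 `|` E 1 `|` E (inord 2)) = 0%E.
  apply: etrans.
    by apply: measureU0; [exact: measurableU|exact: mE|exact: face_null].
  by apply: etrans; [apply: measureU0; [exact: mE|exact: mE|exact: face_null]|exact: face_null].
apply/eqP; rewrite eq_le measure_ge0 andbT -[leRHS]E0.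
by apply: le_measure sub; rewrite inE//; apply: measurableU => //; exact: measurableU.
Qed.

Lemma Rintegral_cell f : leb3.-integrable (cell g) (EFin \o f) ->
  \int[leb3]_(y in cell g) f y = \int[leb3]_(y in hcell) f y.
Proof.
move=> fi; rewrite /Rintegral; congr fine.
have mD : measurable (cell g `\` hcell).
  by apply: measurableD; [exact: measurable_cell|exact: measurable_hcell].
rewrite (negligible_integral mD measurable_cell fi cell_boundary_null).
by rewrite setDD setIC (setIidl hcell_sub).
Qed.

Local Notation grid N := {ffun 'I_3 -> 'I_N.*2.+1}.

Definition zpart y i : int := Num.floor (lcoord i y).

Lemma hcell_zpart y : hcell (y - lat (zpart y)).
Proof.
move=> i; rewrite lcoordB lcoord_lat /zpart subr_ge0 ltrBlDl.
by have := floor_itv (lcoord i y); rewrite intrD addrC.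
Qed.

Lemma hcell_lat_uniq y k : hcell (y - lat k) -> k = zpart y.
Proof.
move=> h; apply/funext => i; apply/esym; apply: floor_def.
by have := h i; rewrite lcoordB lcoord_lat subr_ge0 ltrBlDl intrD.
Qed.

(** Stated for all grids beyond a threshold, so that several functions can share one grid. *)
Lemma zpart_grid r : exists N, forall M, (N <= M)%N -> forall y, `|y| <= r ->
  exists m : grid M, gridz m = zpart y.
Proof.
have [c c0 hc] := lcoord_bound.
exists (Num.bound (c * `|r|)).+1 => M NM y yr; apply: gridz_surj => i.
have h : `|lcoord i y| < (Num.bound (c * `|r|))%:R.
  apply: le_lt_trans (hc i y) _; apply: le_lt_trans (archi_boundP _); last first.
    by rewrite mulr_ge0.
  by rewrite ler_wpM2l//; apply: le_trans yr (ler_norm r).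
have fl := floor_le (lcoord i y); have fg := floorD1_gt (lcoord i y).
move: h; rewrite ltr_norml => /andP[h1 h2].
have l1 : (zpart y i)%:~R < ((Num.bound (c * `|r|))%:Z)%:~R :> R by apply: le_lt_trans h2.
have l2 : (- (Num.bound (c * `|r|))%:Z)%:~R < (zpart y i + 1)%:~R :> R.
  by rewrite intrN; apply: lt_trans fg.
move: l1 l2; rewrite !ltr_int; lia.
Qed.

Lemma integral_hcell_translates f : measurable_fun setT f ->
  leb3.-integrable setT (EFin \o f) -> forall N,
  (forall y, f y != 0 -> exists m : grid N, gridz m = zpart y) ->
  \int[leb3]_y f y = \sum_(m : grid N) \int[leb3]_(y in hcell) f (y + lat (gridz m)).
Proof.
move=> mf fi N hN.
pose D (m : grid N) := translate (- lat (gridz m)) @^-1` hcell.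
have mD m : measurable (D m).
  by apply: measurable_translate_preimage; exact: measurable_hcell.
have DE m y : (y \in D m) = (zpart y == gridz m :> (_ -> _)) :> bool.
  by apply/idP/eqP => [/set_mem /hcell_lat_uniq //|zm]; apply/mem_set; rewrite /D /= /translate -zm; exact: hcell_zpart.
have E : f = (fun y => \sum_(m : grid N) (f \_ (D m)) y).
  apply/funext => y; have [f0|/hN[m zm]] := eqVneq (f y) 0.
    by rewrite f0 big1// => m _; rewrite patchE f0; case: ifP.
  rewrite (bigD1 m)//= patchE DE zm eqxx big1 ?addr0// => m' m'm.
  rewrite patchE DE -zm; case: eqP => // /gridz_inj mm'.
  by rewrite mm' eqxx in m'm.
have iD m : leb3.-integrable setT (EFin \o (f \_ (D m))).
  have := @integrable_mkcond _ _ _ leb3 _ (EFin \o f) (mD m).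
  rewrite restrict_EFin => <-; exact: integrableS fi.
rewrite [in LHS]E Rintegral_sum//; apply: eq_bigr => m _.
rewrite -Rintegral_mkcond.
have := integral_translate (- lat (gridz m)) measurable_hcell
  (f := fun y => f (y + lat (gridz m))).
move=> <-; last by apply: measurable_funTS; exact: measurable_translated.
by apply: eq_Rintegral => y _; rewrite /translate subrK.
Qed.

(** Finitely many translates cover [box 1]; if they were null, so would be the box. *)
Lemma leb3_hcell_gt0 : (0 < leb3 hcell)%E.
Proof.
rewrite lt_neqAle measure_ge0 andbT eq_sym; apply/negP => /eqP h0.
have [N hN] := zpart_grid 1.
pose D (m : grid N) := translate (- lat (gridz m)) @^-1` hcell.
have mD m : measurable (D m).
  by apply: measurable_translate_preimage; exact: measurable_hcell.
have D0 m : leb3 (D m) = 0%E.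
  by rewrite -h0; apply: leb3_translate; exact: measurable_hcell.
have sub : box 1 `<=` \big[setU/set0]_(m : grid N) D m.
  move=> y /boxE /(hN N (leqnn N)) [m zm].
  rewrite -bigcup_seq /=; exists m; first by rewrite /= mem_index_enum.
  by rewrite /D /= /translate zm; exact: hcell_zpart.
have : (leb3 (box 1) <= leb3 (\big[setU/set0]_(m : grid N) D m))%E.
  apply: le_measure sub; rewrite inE; first exact: measurable_box.
  exact: bigsetU_measurable.
rewrite (_ : leb3 (\big[setU/set0]_(m : grid N) D m) = 0%E).
  by apply/negP; rewrite -ltNge; exact: leb3_box_gt0.
have : forall s : seq (grid N), measurable (\big[setU/set0]_(m <- s) D m) /\
    leb3 (\big[setU/set0]_(m <- s) D m) = 0%E.
  elim=> [|m s [ms IHs]]; first by rewrite big_nil; split=> //; exact: measure0.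
  rewrite big_cons; split; first exact: measurableU.
  by apply: etrans; [apply: measureU0; [exact: mD|exact: ms|exact: IHs]|exact: D0].
by move=> /(_ (index_enum _)) [].
Qed.

Lemma cell_volE : ((cell_vol g)%:E = leb3 (cell g))%E.
Proof. by rewrite /cell_vol fineK// ge0_fin_numE// leb3_cell_lty. Qed.

Lemma cell_vol_gt0 : 0 < cell_vol g.
Proof.
rewrite -lte_fin cell_volE; apply: lt_le_trans leb3_hcell_gt0 _.
by apply: le_measure; rewrite ?inE; [exact: measurable_hcell|exact: measurable_cell|exact: hcell_sub].
Qed.

Lemma ae_translate a (P : R3 R -> Prop) :
  {ae leb3, forall y, P y} -> {ae leb3, forall y, P (y + a)}.
Proof.
move=> [A [mA A0 PA]]; exists (translate a @^-1` A); split.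
- exact: measurable_translate_preimage.
- by rewrite -A0; exact: leb3_translate.
- by move=> y /= hy; exact: PA.
Qed.

(** A countable intersection: the finite grids exhaust the multi-indices. *)
Lemma ae_lattice (P : ('I_3 -> int) -> R3 R -> Prop) :
  (forall k, {ae leb3, forall y, P k y}) -> {ae leb3, forall y, forall k, P k y}.
Proof.
move=> h.
have hN (N : nat) : {ae leb3, forall y, forall m : grid N, P (gridz m) y}.
  by apply: filter_forall => m; exact: h.
have := ae_foralln hN; apply: filterS => y hy k.
have [m <-] : exists m : grid (\sum_i absz (k i)), gridz m = k; last exact: hy.
apply: gridz_surj => i; rewrite (bigD1 i)//=; move: (\sum_(_ | _) _)%N => n; lia.
Qed.

Lemma ae_periodic (X : Type) (f h : R3 R -> X) :
  lattice_periodic g f -> lattice_periodic g h ->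
  {ae leb3, forall y, cell g y -> f y = h y} -> {ae leb3, forall y, f y = h y}.
Proof.
move=> pf ph fh.
have h1 : {ae leb3, forall y, forall k, [/\ cell g (y + lat k) -> f (y + lat k) = h (y + lat k),
    f (y + lat k) = f y & h (y + lat k) = h y]}.
  apply: ae_lattice => k; apply: filterS3 (ae_translate (lat k) fh) (pf k) (ph k).
  by move=> y h1 h2 h3; split.
apply: filterS h1 => y /(_ (fun i => - zpart y i)) [].
rewrite latN => h1 <- <-; apply: h1; apply: hcell_sub; exact: hcell_zpart.
Qed.

End Lattice.

(** * Unfolding over the lattice and the periodic div-curl lemma *)

Section Periodic.
Context {R : realType} (g : 'I_3 -> R3 R).
Hypothesis g_indep : lin_indep g.
Implicit Types (y z a : R3 R) (i j : 'I_3) (k : 'I_3 -> int) (f h p phi : R3 R -> R).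
Implicit Types (D : set (R3 R)) (r : R) (N : nat).

Local Notation grid N := {ffun 'I_3 -> 'I_N.*2.+1}.
Local Notation hcell := (hcell g).
Local Notation lat := (lat g).
Local Notation lcoord := (lcoord g).

Lemma ae_imp (P Q : R3 R -> Prop) : (forall y, P y -> Q y) ->
  {ae leb3, forall y, P y} -> {ae leb3, forall y, Q y}.
Proof. by move=> PQ; apply: filterS. Qed.

Lemma ae_imp2 (P Q S : R3 R -> Prop) : (forall y, P y -> Q y -> S y) ->
  {ae leb3, forall y, P y} -> {ae leb3, forall y, Q y} -> {ae leb3, forall y, S y}.
Proof. by move=> PQ; apply: filterS2. Qed.

Lemma ae_imp3 (P Q S T : R3 R -> Prop) : (forall y, P y -> Q y -> S y -> T y) ->
  {ae leb3, forall y, P y} -> {ae leb3, forall y, Q y} -> {ae leb3, forall y, S y} ->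
  {ae leb3, forall y, T y}.
Proof. by move=> PQ; apply: filterS3. Qed.

Lemma ae_eq_Rintegral D f h : measurable D -> measurable_fun D f -> measurable_fun D h ->
  {ae leb3, forall y, D y -> f y = h y} ->
  \int[leb3]_(y in D) f y = \int[leb3]_(y in D) h y.
Proof.
move=> mD mf mh fh; rewrite /Rintegral; congr fine; apply: ae_eq_integral => //.
- exact/measurable_EFinP.
- exact/measurable_EFinP.
- by apply: filterS fh => y hy Dy; rewrite hy.
Qed.

Lemma integrable_bounded_mul D phi p (M : R) : measurable D -> measurable_fun setT phi ->
  (forall y, `|phi y| <= M) -> leb3.-integrable D (EFin \o p) ->
  leb3.-integrable D (EFin \o (fun y => phi y * p y)).
Proof.
move=> mD mphi hM ip; apply: (le_integrable mD _ _ (integrable_realZ mD M ip)) => [|y Dy].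
  apply/measurable_EFinP; apply: measurable_funM; first exact: measurable_funTS.
  by apply/measurable_EFinP; exact: measurable_int ip.
rewrite /= lee_fin !normrM ler_wpM2r//; apply: le_trans (hM y) (ler_norm M).
Qed.

Definition L1loc p : Prop :=
  measurable_fun setT p /\ forall r, leb3.-integrable (box r) (EFin \o p).

Lemma L1loc_cell p : L1loc p -> leb3.-integrable (cell g) (EFin \o p).
Proof.
move=> [mp ip]; have [r _ hr] := cell_bounded g_indep.
by apply: integrableS (ip r) => //; [exact: measurable_box|exact: measurable_cell].
Qed.

Lemma L1loc_hcell p : L1loc p -> leb3.-integrable hcell (EFin \o p).
Proof.
move=> lp; apply: integrableS (L1loc_cell lp).
- exact: measurable_cell.
- exact: measurable_hcell.
- exact: hcell_sub.
Qed.

Lemma L2locM f h : L2loc f -> L2loc h -> L1loc (fun y => f y * h y).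
Proof.
move=> lf lh; split; first by apply: measurable_funM; [exact: lf.1|exact: lh.1].
by move=> r; apply: sq_integrableM; [exact: measurable_box|exact: L2loc_box|exact: L2loc_box].
Qed.

Lemma L2loc_cst (c : R) : L2loc (fun=> c : R).
Proof.
by apply/L2locP => r; apply: sq_integrable_cst; [exact: measurable_box|exact: leb3_box_lty].
Qed.

Lemma L2loc_L1loc f : L2loc f -> L1loc f.
Proof.
by move=> lf; have := L2locM (L2loc_cst 1) lf; under eq_fun do rewrite mul1r.
Qed.

(** The integral is split over the translates of the half-open cell, and periodicity of [p] brings
    every piece back to that cell. The bounded support of [phi] keeps the sum finite. *)
Lemma periodic_unfold phi p r (M : R) : measurable_fun setT phi ->
  (forall y, `|phi y| <= M) -> supported_in r phi ->
  lattice_periodic g p -> L1loc p ->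
  exists N0, forall N, (N0 <= N)%N ->
  \int[leb3]_y (phi y * p y) =
  \int[leb3]_(y in hcell) ((\sum_(m : grid N) phi (y + lat (gridz m))) * p y).
Proof.
move=> mphi hM phir pp lp; have [N0 hN0] := zpart_grid g_indep r.
exists N0 => N NN0.
have supp : supported_in r (fun y => phi y * p y).
  by move=> y; rewrite mulf_eq0 negb_or => /andP[/phir].
have mpp : measurable_fun setT (fun y => phi y * p y) by apply: measurable_funM => //; exact: lp.1.
rewrite (integral_hcell_translates g_indep mpp _ (N := N)); last 2 first.
- apply: (integrable_supported_box supp); apply: integrable_bounded_mul hM (lp.2 r) => //.
  exact: measurable_box.
- by move=> y /supp; exact: hN0.
have mh := measurable_hcell g.
have im (m : grid N) : leb3.-integrable hcell (EFin \o (fun y => phi (y + lat (gridz m)) * p y)).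
  apply: integrable_bounded_mul (L1loc_hcell lp) => //; first exact: measurable_translated.
transitivity (\sum_(m : grid N) \int[leb3]_(y in hcell) (phi (y + lat (gridz m)) * p y)).
  apply: eq_bigr => m _; apply: ae_eq_Rintegral => //.
  - apply: measurable_funTS; exact: (measurable_translated (lat (gridz m)) mpp).
  - apply: measurable_funTS; apply: measurable_funM; last exact: lp.1.
    exact: measurable_translated.
  - by apply: ae_imp (pp (gridz m)) => y hy _; congr (_ * _).
rewrite -Rintegral_sum//; apply: eq_Rintegral => y _; by rewrite mulr_suml.
Qed.

Lemma is_derive_sum_seq (I : Type) (s : seq I) (F dF : I -> R3 R -> R) y v :
  (forall l, is_derive y v (F l) (dF l y)) ->
  is_derive y v (fun y => \sum_(l <- s) F l y) (\sum_(l <- s) dF l y).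
Proof.
move=> h; elim: s => [|l s IHs].
  under eq_fun do rewrite big_nil; rewrite big_nil; exact: is_derive_cst.
under eq_fun do rewrite big_cons; rewrite big_cons; exact: is_deriveD.
Qed.

(* Its lattice translates sum to 1, by telescoping in each coordinate. *)
Definition unit_part y : R :=
  \prod_i (smooth_step (lcoord i y + 1) - smooth_step (lcoord i y)).

Lemma smooth_unit_part : smooth unit_part.
Proof.
have sprod n (s : seq 'I_3) (F : 'I_3 -> R3 R -> R) : (forall i, smooth_to n (F i)) ->
    smooth_to n (fun y => \prod_(i <- s) F i y).
  move=> h; elim: s => [|i s IHs].
    under eq_fun do rewrite big_nil; exact: smooth_to_cst.
  under eq_fun do rewrite big_cons; exact: smooth_toM.
apply/smoothP => n; apply: sprod => i.
have sc := smooth_to_lcoord g n i.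
apply: smooth_toD.
  by apply: smooth_to_step; apply: smooth_toD => //; exact: smooth_to_cst.
under eq_fun do rewrite -mulN1r.
by apply: smooth_toM; [exact: smooth_to_cst|exact: smooth_to_step].
Qed.

Lemma test_unit_part : test_function unit_part.
Proof.
apply/test_functionP; split; first exact: smooth_unit_part.
exists (\sum_i `|g i|); first exact: sumr_ge0.
move=> y; rewrite /unit_part prodf_seq_neq0 => /allP h.
rewrite {1}(lcoord_decomp g_indep y); apply: le_trans (ler_norm_sum _ _ _) _.
apply: ler_sum => i _; have := h i (mem_index_enum _) => /= ci.
rewrite normrZ ler_piMl// ler_norml; apply/andP; split.
  rewrite leNgt; apply: contraNN ci => ci.
  by rewrite !smooth_step_le0 ?subrr//; lra.
rewrite leNgt; apply: contraNN ci => ci.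
by rewrite !smooth_step_ge1 ?subrr//; lra.
Qed.

Lemma sum_unit_part N y : (forall i, `|lcoord i y| <= N%:R) ->
  \sum_(m : grid N) unit_part (y + lat (gridz m)) = 1.
Proof.
move=> yN.
pose F i (l : 'I_N.*2.+1) := smooth_step (lcoord i y + (l%:Z - N%:Z)%:~R + 1) -
  smooth_step (lcoord i y + (l%:Z - N%:Z)%:~R).
transitivity (\sum_(m : grid N) \prod_i F i (m i)).
  apply: eq_bigr => m _; apply: eq_bigr => i _.
  by rewrite /F lcoordD lcoord_lat.
(* The sum over the grid of products is a product of three one-dimensional sums, each of which
   equals 1. *)
rewrite -(bigA_distr_bigA F) big1// => i _.
pose G l := smooth_step (lcoord i y - N%:R + l%:R).
transitivity (\sum_(0 <= l < N.*2.+1) (G l.+1 - G l)).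
  rewrite big_mkord; apply: eq_bigr => l _; rewrite /F /G.
  have -> : (l%:Z - N%:Z)%:~R = l%:R - N%:R :> R by rewrite intrB.
  by congr (smooth_step _ - smooth_step _); rewrite -?natr1; ring.
rewrite telescope_sumr// /G; have := yN i; rewrite ler_norml => /andP[y1 y2].
(* The arguments left at the two ends are [lcoord i y + N + 1 >= 1] and [lcoord i y - N <= 0]. *)
rewrite smooth_step_ge1; last by rewrite -natr1 -addnn natrD; lra.
by rewrite smooth_step_le0 ?subr0//; lra.
Qed.

Lemma sum_partial_unit_part N y j : (1 < N)%N -> hcell y ->
  \sum_(m : grid N) partial j unit_part (y + lat (gridz m)) = 0.
Proof.
move=> N1 yh.
pose X y := \sum_(m : grid N) unit_part (y + lat (gridz m)).
have dX : is_derive y (unit_vec j) X (\sum_(m : grid N) partial j unit_part (y + lat (gridz m))).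
  apply: (@is_derive_sum_seq _ (index_enum (grid N)) (fun m y => unit_part (y + lat (gridz m)))
    (fun m y => partial j unit_part (y + lat (gridz m)))) => m.
  have := @is_derive_affine _ unit_part (unit_vec j) y (lat (gridz m)) 1 _ _.
  rewrite scale1r => /(_ _ (smooth_is_derive j _ smooth_unit_part)).
  by rewrite mul1r; under eq_fun do rewrite scale1r.
rewrite -(is_derive_partial dX); apply: is_derive_partial.
apply: (@near_eq_is_derive R (R3 R) R (cst 1) X).
(* Differentiating requires the sum to be 1 on a neighbourhood of [y]; [N >= 2] leaves the
   coordinates, which lie in [[0, 1)], room to move by 1. *)
have near2 i : \forall z \near y, `|lcoord i z| <= N%:R.
  have N2 : 2 <= N%:R :> R by rewrite ler_nat.
  have /cvgrPdist_lt/(_ 1 ltr01) := @continuous_lcoord _ g i y.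
  apply: filterS => z; rewrite ltr_norml => /andP[h1 h2].
  have /andP[h3 h4] := yh i.
  by rewrite ler_norml; apply/andP; split; lra.
have nearN : \forall z \near y, forall i, `|lcoord i z| <= N%:R
  by exact: (@filter_forall _ 'I_3 (fun i z => `|lcoord i z| <= N%:R) (nbhs y) _ near2).
apply: filterS nearN => z hz.
by rewrite /X sum_unit_part.
Qed.

(* [div_curl_local] for the cut-off [unit_part]: after unfolding over the lattice, the cut-off
   becomes 1 and its gradient 0. *)
Lemma div_curl_periodic (m h : 'I_3 -> R3 R -> R) f :
  (forall j, L2loc (m j)) -> (forall j, L2loc (h j)) -> L2loc f ->
  (forall j, lattice_periodic g (m j)) -> (forall j, lattice_periodic g (h j)) ->
  lattice_periodic g f ->
  (forall phi, test_function phi -> \sum_j \int[leb3]_y (m j y * partial j phi y) = 0) ->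
  (forall j phi, test_function phi ->
    \int[leb3]_y (f y * partial j phi y) = - \int[leb3]_y (h j y * phi y)) ->
  \sum_j \int[leb3]_(y in cell g) (h j y * m j y) = 0.
Proof.
move=> lm lh lf pm ph pf mdiv fgrad.
have tchi := test_unit_part; have tdchi j := test_function_partial j tchi.
have [schi [r _ chir]] := (test_functionP _).1 tchi.
have [M _ hM] := bounded_of_test tchi.
have pM (u v : R3 R -> R) : lattice_periodic g u -> lattice_periodic g v ->
    lattice_periodic g (fun y => u y * v y).
  by move=> pu pv k; apply: ae_imp2 (pu k) (pv k) => y e1 e2; congr (_ * _).
have mchi := measurable_smooth schi.
have chi_term j : \int[leb3]_y (unit_part y * (h j y * m j y)) =
    \int[leb3]_(y in cell g) (h j y * m j y).
  have lhm := L2locM (lh j) (lm j).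
  have [N0 hN0] := periodic_unfold mchi hM chir (pM _ _ (ph j) (pm j)) lhm.
  have := hN0 (maxn N0 1) (leq_maxl _ _).
  rewrite (Rintegral_cell g_indep); last exact: L1loc_cell.
  move=> ->; apply: eq_Rintegral => y /set_mem yh.
  rewrite sum_unit_part ?mul1r// => i; have /andP[c0 c1] := yh i.
  rewrite ger0_norm//; apply: le_trans (ltW c1) _.
  by rewrite ler1n leq_max orbT.
have dchi_term j : \int[leb3]_y (partial j unit_part y * (f y * m j y)) = 0.
  have lfm := L2locM lf (lm j).
  have [Mj _ hMj] := bounded_of_test (tdchi j).
  have [N0 hN0] := periodic_unfold (measurable_smooth (smooth_partial j schi)) hMj
    (@supported_partial _ _ _ j chir) (pM _ _ pf (pm j)) lfm.
  have := hN0 (maxn N0 2) (leq_maxl _ _).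
  move=> ->; rewrite (eq_Rintegral _ (g := fun=> 0)) ?Rintegral0// => y /set_mem yh.
  by rewrite sum_partial_unit_part ?mul0r// leq_max orbT.
have := div_curl_local lm lh lf mdiv fgrad tchi.
move=> E; rewrite -[RHS]E; apply: eq_bigr => j _; rewrite -chi_term.
have supp (u p : R3 R -> R) : test_function u -> L1loc p ->
    leb3.-integrable setT (EFin \o (fun y => u y * p y)).
  move=> tu lp; have [su [ru _ ur]] := (test_functionP _).1 tu.
  have [Mu _ hMu] := bounded_of_test tu.
  apply: (@integrable_supported_box _ ru).
    by move=> y; rewrite mulf_eq0 negb_or => /andP[/ur].
  apply: integrable_bounded_mul hMu (lp.2 ru); first exact: measurable_box.
  exact: measurable_smooth.
have i1 := supp _ _ tchi (L2locM (lh j) (lm j)).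
have i2 := supp _ _ (tdchi j) (L2locM lf (lm j)).
rewrite -[LHS]addr0 -(dchi_term j) -RintegralD//; apply: eq_Rintegral => y _; ring.
Qed.

End Periodic.

(** * Weak derivatives *)

Section WeakPartial.
Context {R : realType}.
Implicit Types (f h u v phi c : R3 R -> R) (y a : R3 R) (i j : 'I_3) (D : set (R3 R)) (k : R).

Lemma L2locZD k f h : L2loc f -> L2loc h -> L2loc (fun y => k * f y + h y).
Proof.
move=> lf lh; apply/L2locP => r; have mb := @measurable_box R r.
by apply: sq_integrableD => //; [apply: sq_integrableZ => //|]; exact: L2loc_box.
Qed.

Lemma L2loc0 : L2loc (fun=> 0 : R).
Proof. exact: L2loc_cst. Qed.

Lemma L2locZ k f : L2loc f -> L2loc (fun y => k * f y).
Proof. by move=> lf; have := L2locZD k lf L2loc0; under eq_fun do rewrite addr0. Qed.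

Lemma L2locD f h : L2loc f -> L2loc h -> L2loc (fun y => f y + h y).
Proof. by move=> lf lh; have := L2locZD 1 lf lh; under eq_fun do rewrite mul1r. Qed.

Lemma L2locB f h : L2loc f -> L2loc h -> L2loc (fun y => f y - h y).
Proof.
by move=> lf lh; have := L2locZD (-1) lh lf; under eq_fun do rewrite mulN1r addrC.
Qed.

Lemma L2loc_sum (I : Type) (s : seq I) (F : I -> R3 R -> R) :
  (forall l, L2loc (F l)) -> L2loc (fun y => \sum_(l <- s) F l y).
Proof.
move=> lF; elim: s => [|i s IHs].
  by under eq_fun do rewrite big_nil; exact: L2loc0.
by under eq_fun do rewrite big_cons; exact: L2locD.
Qed.

Lemma L2loc_ae f h : measurable_fun setT h -> {ae leb3, forall y, f y = h y} ->
  L2loc f -> L2loc h.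
Proof.
move=> mh fh [mf lf]; split => // K /[dup] cK /lf; apply: le_lt_trans.
have mK := measurable_compact cK.
rewrite le_eqVlt; apply/orP; left; apply/eqP; apply: ae_eq_integral => //.
- by apply/measurable_EFinP; apply: measurable_funTS; exact: measurable_funX.
- by apply/measurable_EFinP; apply: measurable_funTS; exact: measurable_funX.
- by apply: ae_imp fh => y -> _.
Qed.

Lemma L2loc_bounded c f (M : R) : measurable_fun setT c -> (forall y, `|c y| <= M) ->
  L2loc f -> L2loc (fun y => c y * f y).
Proof.
move=> mc cM lf; apply/L2locP => r; apply: sq_integrable_bounded cM _ => //.
- exact: measurable_box.
- exact: L2loc_box.
Qed.

Lemma L2loc_ae_bounded c f (M : R) : measurable_fun setT c ->
  {ae leb3, forall y, `|c y| <= M} -> L2loc f -> L2loc (fun y => c y * f y).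
Proof.
move=> mc cM lf.
(* Truncation turns the almost everywhere bound into an everywhere bound, and changes [c] on a null
   set only. *)
pose c' y := Num.max (- `|M|) (Num.min `|M| (c y)).
have mc' : measurable_fun setT c'.
  by apply: measurable_maxr; [exact: measurable_cst|apply: measurable_minr => //; exact: measurable_cst].
apply: (@L2loc_ae (fun y => c' y * f y)).
- by apply: measurable_funM => //; exact: lf.1.
- apply: ae_imp cM => y cM; congr (_ * _); rewrite /c'.
  have := le_trans cM (ler_norm M); rewrite ler_norml => /andP[h1 h2].
  by rewrite min_r// max_r.
- apply: (@L2loc_bounded _ _ `|M|) => // y; rewrite /c' ler_norml le_max lexx/=.
  by rewrite ge_max ge_min lexx/= andbT; apply: le_trans (normr_ge0 M); rewrite oppr_le0.
Qed.

Lemma L2loc_continuous f : continuous f -> L2loc f.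
Proof.
move=> cf; split; first exact: continuous_measurable_R3.
move=> K cK; have /compact_bounded [M [_ hM]] := continuous_compact (continuous_subspaceT cf) cK.
have fM y : K y -> `|f y| <= `|M| + 1.
  by move=> Ky; apply: hM; [rewrite (le_lt_trans (ler_norm M))// ltrDl|exists y].
have [r Kr] := compact_sub_box cK.
have mK := measurable_compact cK.
apply: le_lt_trans (_ : (\int[leb3]_(y in K) (((`|M| + 1) ^+ 2)%:E) < +oo)%E).
  apply: ge0_le_integral => //.
  - by move=> y _; rewrite lee_fin sqr_ge0.
  - apply/measurable_EFinP; apply: measurable_funTS; apply: measurable_funX.
    exact: continuous_measurable_R3.
  - move=> y Ky; rewrite lee_fin -real_normK ?num_real// ler_pXn2r ?nnegrE ?addr_ge0//.
    exact: fM.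
rewrite integral_cst// lte_mul_pinfty ?lee_fin ?sqr_ge0//.
apply: le_lt_trans (leb3_box_lty r); apply: le_measure => //; rewrite ?inE//.
exact: measurable_box.
Qed.

Definition weak_partial j f h : Prop := forall phi, test_function phi ->
  \int[leb3]_y (f y * partial j phi y) = - \int[leb3]_y (h y * phi y).

(** The product of [f] with a test function is a test function, and the integral of its derivative
    is 0. *)
Lemma weak_partial_smooth j f : smooth f -> weak_partial j f (partial j f).
Proof.
move=> sf phi tphi.
have tp := test_function_mulr sf tphi.
have lf := L2loc_continuous (smooth_continuous sf).
have ldf := L2loc_continuous (smooth_continuous (smooth_partial j sf)).
apply/eqP; rewrite eq_sym eqr_oppLR -subr_eq0 opprK addrC; apply/eqP.
have := integral_partial j tp; rewrite -RintegralD//.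
- move=> E; rewrite -[RHS]E; apply: eq_Rintegral => y _.
  by rewrite partialM; [ring|exact: tphi.1|exact: sf].
- by apply: L2loc_test_integrable; [exact: lf|exact: test_function_partial].
- exact: L2loc_test_integrable.
Qed.

Lemma weak_partialZD j k f h u v : L2loc f -> L2loc h -> L2loc u -> L2loc v ->
  weak_partial j f u -> weak_partial j h v ->
  weak_partial j (fun y => k * f y + h y) (fun y => k * u y + v y).
Proof.
move=> lf lh lu lv wf wh phi tphi; have tdphi := test_function_partial j tphi.
transitivity (k * \int[leb3]_y (f y * partial j phi y) + \int[leb3]_y (h y * partial j phi y)).
  rewrite -RintegralZ_R3; last exact: L2loc_test_integrable.
  rewrite -RintegralD//.
  - by apply: eq_Rintegral => y _; ring.
  - by apply: integrable_realZ => //; exact: L2loc_test_integrable.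
  - exact: L2loc_test_integrable.
rewrite wf// wh// mulrN -opprD; congr (- _).
rewrite -RintegralZ_R3; last exact: L2loc_test_integrable.
rewrite -RintegralD//.
- by apply: eq_Rintegral => y _; ring.
- by apply: integrable_realZ => //; exact: L2loc_test_integrable.
- exact: L2loc_test_integrable.
Qed.

Lemma weak_partial_ae j f h u : measurable_fun setT f -> measurable_fun setT u ->
  {ae leb3, forall y, f y = u y} -> weak_partial j f h -> weak_partial j u h.
Proof.
move=> mf mu fu wf phi tphi; rewrite -wf//.
have mp : measurable_fun setT (partial j phi).
  by apply: measurable_smooth; apply: smooth_partial; exact: tphi.1.
apply: ae_eq_Rintegral => //; [exact: measurable_funM|exact: measurable_funM|].
by apply: ae_imp fu => y -> _.
Qed.

(** The difference of the two derivatives is orthogonal to all test functions. *)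
Lemma weak_partial_uniq j f h u : L2loc h -> L2loc u ->
  weak_partial j f h -> weak_partial j f u -> {ae leb3, forall y, h y = u y}.
Proof.
move=> lh lu wh wu.
have : {ae leb3, forall y, h y - u y = 0}.
  apply: L2loc_null; first exact: L2locB.
  move=> phi tphi.
  transitivity (\int[leb3]_y (h y * phi y) - \int[leb3]_y (u y * phi y)).
    rewrite -RintegralB//; [|exact: L2loc_test_integrable|exact: L2loc_test_integrable].
    by apply: eq_Rintegral => y _; ring.
  by apply/eqP; rewrite subr_eq0 -eqr_opp -wh// -wu.
by apply: ae_imp => y /eqP; rewrite subr_eq0 => /eqP.
Qed.

Lemma weak_partial_translate j a f h : L2loc f -> L2loc h -> weak_partial j f h ->
  weak_partial j (fun y => f (y + a)) (fun y => h (y + a)).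
Proof.
move=> lf lh wf phi tphi.
pose psi y := phi (1 *: y + - a).
have tpsi : test_function psi by apply: test_function_affine => //; exact: oner_neq0.
have sphi := tphi.1.
have e1 : \int[leb3]_y (f (y + a) * partial j phi y) = \int[leb3]_y (f y * partial j psi y).
  rewrite -(@integral_translateT _ a (fun y => f y * partial j psi y)).
    apply: eq_Rintegral => y _; rewrite /psi partial_affine// mul1r scale1r.
    by congr (_ * partial j phi _); rewrite addrK.
  apply: measurable_funM; first exact: lf.1.
  by apply: measurable_smooth; apply: smooth_partial; exact: tpsi.1.
have e2 : \int[leb3]_y (h (y + a) * phi y) = \int[leb3]_y (h y * psi y).
  rewrite -(@integral_translateT _ a (fun y => h y * psi y)).
    by apply: eq_Rintegral => y _; rewrite /psi scale1r addrK.
  by apply: measurable_funM; [exact: lh.1|apply: measurable_smooth; exact: tpsi.1].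
by rewrite e1 e2; exact: wf.
Qed.

Lemma weak_partial_cst j k : weak_partial j (fun=> k) (fun=> 0).
Proof.
have := weak_partial_smooth j (smooth_cst k).
rewrite (_ : partial j (fun=> k) = fun=> 0)//; apply/funext => y.
apply: is_derive_partial; exact: is_derive_cst.
Qed.

Lemma weak_partial_linear j f : continuous f ->
  (forall k y z, f (k *: y + z) = k * f y + f z) ->
  weak_partial j f (fun=> f (unit_vec j)).
Proof.
move=> cf lf; have sf : smooth f by apply/smoothP => n; exact: smooth_to_linear.
have := weak_partial_smooth j sf.
rewrite (_ : partial j f = fun=> f (unit_vec j))//; apply/funext => y.
by apply: is_derive_partial; exact: is_derive_additive_homogeneous.
Qed.

End WeakPartial.

(** * Frobenius product and pairing of matrix fields *)

Section Frobenius.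
Context {R : realType} (m n : nat).
Implicit Types (M N P : 'M[R]_(m, n)) (k : R).

Lemma frobC M N : frob M N = frob N M.
Proof. by apply: eq_bigr => i _; apply: eq_bigr => j _; rewrite mulrC. Qed.

Lemma frobZDl k M N P : frob (k *: M + N) P = k * frob M P + frob N P.
Proof.
rewrite /frob mulr_sumr -big_split; apply: eq_bigr => i _.
rewrite mulr_sumr -big_split; apply: eq_bigr => j _; rewrite !mxE /=; ring.
Qed.

Lemma frob0l M : frob 0 M = 0.
Proof. by rewrite /frob big1// => i _; rewrite big1// => j _; rewrite mxE mul0r. Qed.

Lemma frobZl k M P : frob (k *: M) P = k * frob M P.
Proof. by rewrite -[k *: M]addr0 frobZDl frob0l addr0. Qed.

Lemma frobDl M N P : frob (M + N) P = frob M P + frob N P.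
Proof. by rewrite -[M]scale1r frobZDl scale1r mul1r. Qed.

Lemma frobBl M N P : frob (M - N) P = frob M P - frob N P.
Proof. by rewrite frobDl -scaleN1r frobZl mulN1r. Qed.

Lemma frobBr M N P : frob P (M - N) = frob P M - frob P N.
Proof. by rewrite !(frobC P) frobBl. Qed.

Lemma frob_ge0 M : 0 <= frob M M.
Proof. by apply: sumr_ge0 => i _; apply: sumr_ge0 => j _; rewrite -expr2 sqr_ge0. Qed.

Lemma sqr_entry_le_frob M i j : M i j ^+ 2 <= frob M M.
Proof.
rewrite /frob (bigD1 i)//= (bigD1 j)//= -expr2 -addrA lerDl addr_ge0//.
  by apply: sumr_ge0 => l _; rewrite -expr2 sqr_ge0.
by apply: sumr_ge0 => l _; apply: sumr_ge0 => l' _; rewrite -expr2 sqr_ge0.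
Qed.

Lemma frob_eq0 M : frob M M = 0 -> M = 0.
Proof.
move=> M0; apply/matrixP => i j; rewrite mxE; apply/eqP; rewrite -sqrf_eq0 eq_le sqr_ge0 andbT.
by rewrite -M0 sqr_entry_le_frob.
Qed.

End Frobenius.

Lemma frob_sym_part (R : realType) (M N : 'M[R]_3) : mx_sym M -> frob M (sym_part N) = frob M N.
Proof.
move=> sM; rewrite /sym_part frobC frobZl frobDl.
have -> : frob N^T M = frob N M.
  rewrite /frob exchange_big /=; apply: eq_bigr => i _; apply: eq_bigr => j _.
  by rewrite -{1}sM !mxE.
by rewrite (frobC M); field.
Qed.

Lemma mx_sym_sym_part (R : realType) (M : 'M[R]_3) : mx_sym (sym_part M).
Proof. by rewrite /mx_sym /sym_part linearZ linearD /= trmxK addrC. Qed.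

Lemma sym_part_sym (R : realType) (M : 'M[R]_3) : mx_sym M -> sym_part M = M.
Proof. move=> sM; apply/matrixP => i j; rewrite /sym_part sM !mxE; lra. Qed.

Lemma sym_partZD (R : realType) (k : R) (M N : 'M[R]_3) :
  sym_part (k *: M + N) = k *: sym_part M + sym_part N.
Proof.
by apply/matrixP => i j; rewrite !mxE; ring.
Qed.

Lemma mx_symZD (R : realType) (k : R) (M N : 'M[R]_3) :
  mx_sym M -> mx_sym N -> mx_sym (k *: M + N).
Proof. by move=> sM sN; rewrite /mx_sym linearD linearZ /= sM sN. Qed.

Section MatrixFields.
Context {R : realType} (m n : nat).
Implicit Types (F H K : R3 R -> 'M[R]_(m, n)) (k : R).

Lemma L2loc_mxZD k F H : L2loc_mx F -> L2loc_mx H -> L2loc_mx (fun y => k *: F y + H y).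
Proof.
move=> lF lH i j; under eq_fun do rewrite !mxE.
by apply: L2locZD; [exact: lF|exact: lH].
Qed.

Lemma L2loc_mx_cst (M : 'M[R]_(m, n)) : L2loc_mx (fun=> M).
Proof. by move=> i j; exact: L2loc_cst. Qed.

Lemma L2loc_mxB F H : L2loc_mx F -> L2loc_mx H -> L2loc_mx (fun y => F y - H y).
Proof.
move=> lF lH; have := L2loc_mxZD (-1) lH lF.
by under eq_fun do rewrite scaleN1r addrC.
Qed.

Lemma L1locZD k (p q : R3 R -> R) : L1loc p -> L1loc q -> L1loc (fun y => k * p y + q y).
Proof.
move=> [mp ip] [mq iq]; split.
  by apply: measurable_funD => //; apply: measurable_funM => //; exact: measurable_cst.
move=> r; have mb := @measurable_box R r.
by apply: integrable_realD => //; exact: integrable_realZ.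
Qed.

Lemma L1loc_sum (I : Type) (s : seq I) (p : I -> R3 R -> R) : (forall l, L1loc (p l)) ->
  L1loc (fun y => \sum_(l <- s) p l y).
Proof.
move=> lp; elim: s => [|l s IHs].
  by under eq_fun do rewrite big_nil; exact: L2loc_L1loc L2loc0.
under eq_fun do rewrite big_cons.
by have := L1locZD 1 (lp l) IHs; under eq_fun do rewrite mul1r.
Qed.

Lemma frob_L1loc F H : L2loc_mx F -> L2loc_mx H -> L1loc (fun y => frob (F y) (H y)).
Proof.
move=> lF lH; apply: L1loc_sum => i; apply: L1loc_sum => j.
by apply: L2locM; [exact: lF|exact: lH].
Qed.

End MatrixFields.

Lemma L2loc_mx_sym_part (R : realType) (F : mfield R) : L2loc_mx F ->
  L2loc_mx (fun y => sym_part (F y)).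
Proof.
move=> lF i j; under eq_fun do rewrite !mxE.
by apply: L2locZ; apply: L2locD; exact: lF.
Qed.

Section Pairing.
Context {R : realType} (g : 'I_3 -> R3 R).
Hypothesis g_indep : lin_indep g.
Let mcell := measurable_cell g_indep.

Section Shape.
Context (m n : nat).
Implicit Types (F H K : R3 R -> 'M[R]_(m, n)) (k : R).

Lemma frob_integrable F H : L2loc_mx F -> L2loc_mx H ->
  leb3.-integrable (cell g) (EFin \o (fun y => frob (F y) (H y))).
Proof. by move=> lF lH; apply: L1loc_cell => //; exact: frob_L1loc. Qed.

Lemma pairingC F H : pairing g F H = pairing g H F.
Proof. by apply: eq_Rintegral => y _; rewrite frobC. Qed.

Lemma pairingZDl k F H K : L2loc_mx F -> L2loc_mx H -> L2loc_mx K ->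
  pairing g (fun y => k *: F y + H y) K = k * pairing g F K + pairing g H K.
Proof.
move=> lF lH lK; have iFK := frob_integrable lF lK; have iHK := frob_integrable lH lK.
rewrite /pairing -RintegralZl// -RintegralD//; last exact: integrable_realZ.
by apply: eq_Rintegral => y _; rewrite frobZDl.
Qed.

Lemma pairingZDr k F H K : L2loc_mx F -> L2loc_mx H -> L2loc_mx K ->
  pairing g K (fun y => k *: F y + H y) = k * pairing g K F + pairing g K H.
Proof. by move=> lF lH lK; rewrite !(pairingC K) pairingZDl. Qed.

Lemma pairingBl F H K : L2loc_mx F -> L2loc_mx H -> L2loc_mx K ->
  pairing g (fun y => F y - H y) K = pairing g F K - pairing g H K.
Proof.
move=> lF lH lK.
rewrite (_ : (fun y => F y - H y) = (fun y => -1 *: H y + F y)).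
  by rewrite pairingZDl// mulN1r addrC.
by apply/funext => y; rewrite scaleN1r addrC.
Qed.

Lemma pairingBr F H K : L2loc_mx F -> L2loc_mx H -> L2loc_mx K ->
  pairing g K (fun y => F y - H y) = pairing g K F - pairing g K H.
Proof. by move=> lF lH lK; rewrite !(pairingC K) pairingBl. Qed.

Lemma pairing_ae F H K : L2loc_mx F -> L2loc_mx H -> L2loc_mx K ->
  {ae leb3, forall y, F y = H y} -> pairing g F K = pairing g H K.
Proof.
move=> lF lH lK FH; apply: ae_eq_Rintegral => //.
- by apply: measurable_funTS; exact: (frob_L1loc lF lK).1.
- by apply: measurable_funTS; exact: (frob_L1loc lH lK).1.
- by apply: ae_imp FH => y ->.
Qed.

Lemma pairing_ge0 F : 0 <= pairing g F F.
Proof. by apply: Rintegral_ge0 => y _; exact: frob_ge0. Qed.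

Lemma pairing_eq0 F : L2loc_mx F -> pairing g F F = 0 ->
  {ae leb3, forall y, cell g y -> F y = 0}.
Proof.
move=> lF F0; have iF := frob_integrable lF lF.
have mF : measurable_fun (cell g) (fun y => (frob (F y) (F y))%:E).
  by apply/measurable_EFinP; apply: measurable_funTS; exact: (frob_L1loc lF lF).1.
have : (\int[leb3]_(y in cell g) `|(frob (F y) (F y))%:E| = 0)%E.
  under eq_integral do rewrite gee0_abs ?lee_fin ?frob_ge0//.
  rewrite -[LHS]fineK; first by rewrite -[X in X%:E = _]/(pairing g F F) F0.
  exact: integrable_fin_num.
move/(ae_eq_integral_abs leb3 mcell mF).1.
by apply: ae_imp => y h Dy; apply: frob_eq0; have [] := h Dy.
Qed.

Lemma cell_intZD k F H : L2loc_mx F -> L2loc_mx H ->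
  cell_int g (fun y => k *: F y + H y) = k *: cell_int g F + cell_int g H.
Proof.
move=> lF lH; apply/matrixP => i j; rewrite !mxE.
have iF := L1loc_cell g_indep (L2loc_L1loc (lF i j)).
have iH := L1loc_cell g_indep (L2loc_L1loc (lH i j)).
rewrite -RintegralZl// -RintegralD//; last exact: integrable_realZ.
by apply: eq_Rintegral => y _; rewrite !mxE.
Qed.

Lemma cell_int_ae F H : L2loc_mx F -> L2loc_mx H -> {ae leb3, forall y, F y = H y} ->
  cell_int g F = cell_int g H.
Proof.
move=> lF lH FH; apply/matrixP => i j; rewrite !mxE; apply: ae_eq_Rintegral => //.
- by apply: measurable_funTS; exact: (lF i j).1.
- by apply: measurable_funTS; exact: (lH i j).1.
- by apply: ae_imp FH => y ->.
Qed.

Lemma cell_int_cst (M : 'M[R]_(m, n)) : cell_int g (fun=> M) = cell_vol g *: M.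
Proof.
by apply/matrixP => i j; rewrite !mxE Rintegral_cst// mulrC.
Qed.

Lemma pairing_cst F (M : 'M[R]_(m, n)) : L2loc_mx F ->
  pairing g F (fun=> M) = frob (cell_int g F) M.
Proof.
move=> lF.
have iF i j : leb3.-integrable (cell g) (EFin \o (fun y => F y i j)).
  exact: (L1loc_cell g_indep (L2loc_L1loc (lF i j))).
have iFM i j : leb3.-integrable (cell g) (EFin \o (fun y => F y i j * M i j)).
  have := integrable_realZ mcell (M i j) (iF i j).
  by under [X in EFin \o X]eq_fun do rewrite mulrC.
rewrite /pairing /frob Rintegral_sum//.
  apply: eq_bigr => i _; rewrite Rintegral_sum//; apply: eq_bigr => j _.
  by rewrite mxE RintegralZr.
by move=> i _; apply: integrable_real_sum.
Qed.

End Shape.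
End Pairing.

(** * Weak gradients of vector fields *)

Section Gradients.
Context {R : realType}.
Implicit Types (u v w : vfield R) (Du Dv : mfield R) (k : R) (a y : R3 R) (i j : 'I_3).

Lemma gradP u : H1loc u -> L2loc_mx (grad u) /\ weak_gradient u (grad u).
Proof. by move=> [_ [Du lDu wDu]]; apply: (@getPex _ [set Du | L2loc_mx Du /\ weak_gradient u Du]); exists Du. Qed.

Lemma L2loc_grad u : H1loc u -> L2loc_mx (grad u).
Proof. by move/gradP => []. Qed.

Lemma L2loc_sgrad u : H1loc u -> L2loc_mx (sgrad u).
Proof. by move=> hu; apply: L2loc_mx_sym_part; exact: L2loc_grad. Qed.

Lemma ae_matrix m n (F H : R3 R -> 'M[R]_(m, n)) :
  (forall (i : 'I_m) (j : 'I_n), {ae leb3, forall y, F y i j = H y i j}) -> {ae leb3, forall y, F y = H y}.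
Proof.
move=> FH; apply: (@ae_imp _ (fun y => forall (i : 'I_m) (j : 'I_n), F y i j = H y i j)).
  by move=> y h; apply/matrixP.
apply: filter_forall => i; apply: filter_forall => j; exact: FH.
Qed.

(** As [grad] is an arbitrary choice of weak gradient, its linearity, its periodicity and its values
    on explicit fields all reduce to this uniqueness. *)
Lemma grad_uniq u v Du Dv : L2loc_mx u -> L2loc_mx v -> {ae leb3, forall y, u y = v y} ->
  L2loc_mx Du -> weak_gradient u Du -> L2loc_mx Dv -> weak_gradient v Dv ->
  {ae leb3, forall y, Du y = Dv y}.
Proof.
move=> lu lv uv lDu wu lDv wv; apply: ae_matrix => i j.
apply: (@weak_partial_uniq _ j (fun y => v y i ord0)); [exact: lDu|exact: lDv| |exact: wv].
apply: (@weak_partial_ae _ j (fun y => u y i ord0)); [exact: (lu i ord0).1|exact: (lv i ord0).1| |exact: wu].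
by apply: ae_imp uv => y ->.
Qed.

Lemma grad_ae u Du : H1loc u -> L2loc_mx Du -> weak_gradient u Du ->
  {ae leb3, forall y, grad u y = Du y}.
Proof.
move=> hu lDu wDu; have [lg wg] := gradP hu.
by apply: (@grad_uniq u u) => //; [exact: hu.1|exact: hu.1|exact: aeW].
Qed.

Lemma weak_gradientZD k u v Du Dv : L2loc_mx u -> L2loc_mx v -> L2loc_mx Du -> L2loc_mx Dv ->
  weak_gradient u Du -> weak_gradient v Dv ->
  weak_gradient (fun y => k *: u y + v y) (fun y => k *: Du y + Dv y).
Proof.
move=> lu lv lDu lDv wu wv i j phi tphi.
have := @weak_partialZD _ j k _ _ _ _ (lu i ord0) (lv i ord0) (lDu i j) (lDv i j) (wu i j) (wv i j) phi tphi.
move=> E; transitivity (\int[leb3]_y ((k * u y i ord0 + v y i ord0) * partial j phi y)).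
  by apply: eq_Rintegral => y _; rewrite !mxE.
by rewrite E; congr (- _); apply: eq_Rintegral => y _; rewrite !mxE.
Qed.

Lemma H1locZD k u v : H1loc u -> H1loc v -> H1loc (fun y => k *: u y + v y).
Proof.
move=> hu hv; have [lg wg] := gradP hu; have [lg' wg'] := gradP hv.
split; first exact: (L2loc_mxZD k hu.1 hv.1).
exists (fun y => k *: grad u y + grad v y); first exact: L2loc_mxZD.
by apply: weak_gradientZD => //; [exact: hu.1|exact: hv.1].
Qed.

Lemma gradZD k u v : H1loc u -> H1loc v ->
  {ae leb3, forall y, grad (fun y => k *: u y + v y) y = k *: grad u y + grad v y}.
Proof.
move=> hu hv; have [lg wg] := gradP hu; have [lg' wg'] := gradP hv.
apply: grad_ae; [exact: H1locZD|exact: L2loc_mxZD|].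
by apply: weak_gradientZD => //; [exact: hu.1|exact: hv.1].
Qed.

Lemma sgradZD k u v : H1loc u -> H1loc v ->
  {ae leb3, forall y, sgrad (fun y => k *: u y + v y) y = k *: sgrad u y + sgrad v y}.
Proof.
by move=> hu hv; apply: ae_imp (gradZD k hu hv) => y h; rewrite /sgrad h sym_partZD.
Qed.

Lemma weak_gradient_cst (c : 'cV[R]_3) : weak_gradient (fun=> c) (fun=> 0).
Proof.
move=> i j phi tphi; have := weak_partial_cst j (c i ord0) tphi.
by move=> ->; congr (- _); apply: eq_Rintegral => y _; rewrite mxE.
Qed.

Lemma H1loc_cst (c : 'cV[R]_3) : H1loc (fun=> c).
Proof.
split; first exact: L2loc_mx_cst.
by exists (fun=> 0); [exact: L2loc_mx_cst|exact: weak_gradient_cst].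
Qed.

Lemma sgrad_cst (c : 'cV[R]_3) : {ae leb3, forall y, sgrad (fun=> c) y = 0}.
Proof.
apply: ae_imp (grad_ae (H1loc_cst c) (L2loc_mx_cst 0) (weak_gradient_cst c)).
by move=> y h; rewrite /sgrad h /sym_part trmx0 addr0 scaler0.
Qed.

Lemma weak_gradient_translate a u Du : L2loc_mx u -> L2loc_mx Du -> weak_gradient u Du ->
  weak_gradient (fun y => u (y + a)) (fun y => Du (y + a)).
Proof.
by move=> lu lDu wu i j; apply: (@weak_partial_translate _ j a) (wu i j); [exact: lu|exact: lDu].
Qed.

Lemma smooth_affine_field (A : 'M[R]_3) i : smooth (fun y => (A *m vec y) i ord0).
Proof.
apply/smoothP => n; have [s1 s2 s3] := @smooth_to_coord R n.
have sv j : smooth_to n (fun y : R3 R => vec y j ord0).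
  by case: j => -[|[|[|//]]] lj; under eq_fun do rewrite mxE.
under eq_fun do rewrite mxE; elim: (index_enum _) => [|j s IHs].
  by under eq_fun do rewrite big_nil; exact: smooth_to_cst.
under eq_fun do rewrite big_cons; apply: smooth_toD => //.
by apply: smooth_toM => //; exact: smooth_to_cst.
Qed.

Lemma weak_gradient_affine (A : 'M[R]_3) : weak_gradient (fun y => A *m vec y) (fun=> A).
Proof.
move=> i j; have := @weak_partial_linear _ j (fun y => (A *m vec y) i ord0) _ _.
have -> : (A *m vec (unit_vec j)) i ord0 = A i j.
  rewrite mxE (bigD1 j)//= big1.
    rewrite addr0 mxE.
    by case: j => -[|[|[|//]]] lj /=; rewrite mulr1.
  move=> l lj; rewrite mxE; move: lj.
  by case: j => -[|[|[|//]]] ?; case: l => -[|[|[|//]]] ? //= _; rewrite mulr0.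
apply.
  exact: smooth_continuous (smooth_affine_field A i).
by move=> k y z; rewrite vecD vecZ mulmxDr -scalemxAr !mxE.
Qed.

Lemma H1loc_affine (A : 'M[R]_3) : H1loc (fun y => A *m vec y).
Proof.
split; last by exists (fun=> A); [exact: L2loc_mx_cst|exact: weak_gradient_affine].
move=> i j; rewrite (ord1 j).
by apply: L2loc_continuous; apply: smooth_continuous; exact: smooth_affine_field.
Qed.

Lemma sgrad_affine (A : 'M[R]_3) v : mx_sym A -> H1loc v ->
  {ae leb3, forall y, sgrad (fun y => A *m vec y + v y) y = A + sgrad v y}.
Proof.
move=> sA hv; have [lg wg] := gradP hv.
rewrite (_ : (fun y => _) = (fun y => 1 *: (A *m vec y) + v y)); last first.
  by apply/funext => y; rewrite scale1r.
have := gradZD 1 (H1loc_affine A) hv.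
apply: ae_imp2 (grad_ae (H1loc_affine A) (L2loc_mx_cst A) (weak_gradient_affine A)) => y e1 e2.
by rewrite /sgrad e2 e1 sym_partZD scale1r sym_part_sym.
Qed.

End Gradients.

(** * Periodic and affine-periodic fields *)

Section AffinePeriodic.
Context {R : realType} (g : 'I_3 -> R3 R).
Hypothesis g_indep : lin_indep g.
Implicit Types (u v w phi : vfield R) (s t e : mfield R) (k : R) (A B S : 'M[R]_3).
Implicit Types (y : R3 R) (i j : 'I_3).

Lemma lattice_periodic_map (X Y : Type) (h : X -> Y) (f : R3 R -> X) :
  lattice_periodic g f -> lattice_periodic g (fun y => h (f y)).
Proof. by move=> pf k; apply: ae_imp (pf k) => y ->. Qed.

Lemma lattice_periodic_map2 (X Y Z : Type) (h : X -> Y -> Z) (f : R3 R -> X) (f' : R3 R -> Y) :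
  lattice_periodic g f -> lattice_periodic g f' -> lattice_periodic g (fun y => h (f y) (f' y)).
Proof. by move=> pf pf' k; apply: ae_imp2 (pf k) (pf' k) => y -> ->. Qed.

Lemma lattice_periodic_cst (X : Type) (c : X) : lattice_periodic g (fun=> c).
Proof. by move=> k; exact: aeW. Qed.

Lemma H1perZD k u v : H1per g u -> H1per g v -> H1per g (fun y => k *: u y + v y).
Proof.
move=> [pu hu] [pv hv]; split; last exact: H1locZD.
exact: (@lattice_periodic_map2 _ _ _ (fun x y : 'cV[R]_3 => k *: x + y)).
Qed.

Lemma H1per_cst (c : 'cV[R]_3) : H1per g (fun=> c).
Proof. by split; [exact: lattice_periodic_cst|exact: H1loc_cst]. Qed.

(** The translate of [grad v] is a weak gradient of the translate of [v], which is almost everywhere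
    [v] itself. *)
Lemma H1per_grad v : H1per g v -> lattice_periodic g (grad v).
Proof.
move=> [pv hv] k; have [lg wg] := gradP hv.
apply: (@grad_uniq _ (fun y => v (y + lat g k)) v).
- by move=> i j; apply: L2loc_translate (hv.1 i j).
- exact: hv.1.
- exact: pv.
- by move=> i j; apply: L2loc_translate (lg i j).
- by apply: weak_gradient_translate => //; exact: hv.1.
- exact: lg.
- exact: wg.
Qed.

Lemma LPofZD k A B u v : LPof g A u -> LPof g B v ->
  LPof g (k *: A + B) (fun y => k *: u y + v y).
Proof.
move=> [p hp eu] [q hq ev]; exists (fun y => k *: p y + q y); first exact: H1perZD.
move=> y; rewrite eu ev mulmxDl -scalemxAl scalerDr; exact: addrACA.
Qed.

Lemma LPZD k u v : LP g u -> LP g v -> LP g (fun y => k *: u y + v y).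
Proof.
move=> [A sA uA] [B sB vB]; exists (k *: A + B); [exact: mx_symZD|exact: LPofZD].
Qed.

Lemma LPof_H1loc A u : LPof g A u -> H1loc u.
Proof.
move=> [p [_ hp] eu]; have := H1locZD 1 (H1loc_affine A) hp.
by rewrite (_ : (fun _ => _) = u)//; apply/funext => y; rewrite eu scale1r.
Qed.

Lemma LP_H1loc u : LP g u -> H1loc u.
Proof. by move=> [A _]; exact: LPof_H1loc. Qed.

Lemma LPof_sgrad A u : mx_sym A -> LPof g A u -> exists2 v, H1per g v &
  {ae leb3, forall y, sgrad u y = A + sgrad v y}.
Proof.
move=> sA [p hp eu]; exists p => //; have := sgrad_affine sA hp.2.
by rewrite (_ : (fun _ => _) = u)//; apply/funext.
Qed.

Lemma H1per_LPof v : H1per g v -> LPof g 0 v.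
Proof. by move=> hv; exists v => // y; rewrite mul0mx add0r. Qed.

Lemma mx_sym0 : mx_sym (0 : 'M[R]_3).
Proof. exact: trmx0. Qed.

Lemma H1per_LP v : H1per g v -> LP g v.
Proof. by move=> hv; exists 0; [exact: mx_sym0|exact: H1per_LPof]. Qed.

Lemma L2per_sgrad u : LP g u -> L2per g (sgrad u).
Proof.
move=> [A sA uA]; have [v hv e] := LPof_sgrad sA uA; split.
- move=> k; have pv : lattice_periodic g (fun y => sgrad v y).
    exact: (lattice_periodic_map (@sym_part R) (H1per_grad hv)).
  by apply: ae_imp3 e (ae_translate (lat g k) e) (pv k) => y -> -> ->.
- exact: L2loc_sgrad (LPof_H1loc uA).
- by apply: aeW => y; exact: mx_sym_sym_part.
Qed.

Lemma L2perZD k s t : L2per g s -> L2per g t -> L2per g (fun y => k *: s y + t y).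
Proof.
move=> [ps ls ss] [pt lt st]; split; last first.
- by apply: ae_imp2 ss st => y; exact: mx_symZD.
- exact: L2loc_mxZD.
- exact: (@lattice_periodic_map2 _ _ _ (fun x y : 'M[R]_3 => k *: x + y)).
Qed.

Lemma L2perB s t : L2per g s -> L2per g t -> L2per g (fun y => s y - t y).
Proof.
move=> hs ht; have := L2perZD (-1) ht hs.
by under eq_fun do rewrite scaleN1r addrC.
Qed.

Lemma L2per_cst S : mx_sym S -> L2per g (fun=> S).
Proof.
by move=> sS; split; [exact: lattice_periodic_cst|exact: L2loc_mx_cst|exact: aeW].
Qed.

Lemma L2per_L2loc s : L2per g s -> L2loc_mx s.
Proof. by case. Qed.

Lemma LambdaZD s k u v : L2loc_mx s -> LP g u -> LP g v ->
  Lambda g s (fun y => k *: u y + v y) = k * Lambda g s u + Lambda g s v.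
Proof.
move=> ls hu hv; have h := @L2loc_sgrad R.
have [lu lv] : L2loc_mx (sgrad u) /\ L2loc_mx (sgrad v) by split; apply: h; exact: LP_H1loc.
have lw : L2loc_mx (sgrad (fun y => k *: u y + v y)).
  by apply: h; apply: LP_H1loc; exact: LPZD.
apply: etrans (pairingC g s _) _.
apply: etrans (pairing_ae g_indep lw (L2loc_mxZD k lu lv) ls (sgradZD k (LP_H1loc hu) (LP_H1loc hv))) _.
apply: etrans (pairingZDl g_indep k lu lv ls) _.
by congr (_ * _ + _); exact: pairingC.
Qed.

Lemma pairing_sum m n (F H : R3 R -> 'M[R]_(m, n)) : L2loc_mx F -> L2loc_mx H ->
  pairing g F H = \sum_i \sum_j \int[leb3]_(y in cell g) (F y i j * H y i j).
Proof.
move=> lF lH; have mc := measurable_cell g_indep.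
have i1 (i : 'I_m) (j : 'I_n) : leb3.-integrable (cell g) (EFin \o (fun y => F y i j * H y i j)).
  by apply: (L1loc_cell g_indep); apply: L2locM; [exact: lF|exact: lH].
rewrite /pairing /frob Rintegral_sum//; last by move=> i _; exact: integrable_real_sum.
by apply: eq_bigr => i _; rewrite Rintegral_sum.
Qed.

(** Symmetry of [s] replaces [sgrad] by [grad]; the periodic div-curl lemma then applies to each
    row. *)
Lemma pairing_div_free s v : L2per g s -> div_free s -> H1per g v ->
  pairing g s (sgrad v) = 0.
Proof.
move=> [ps ls ss] ds hv; have [lg wg] := gradP hv.2.
transitivity (pairing g (grad v) s).
  rewrite pairingC; apply: ae_eq_Rintegral; first exact: measurable_cell.
  - apply: measurable_funTS; apply: (frob_L1loc _ ls).1; exact: L2loc_sgrad hv.2.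
  - by apply: measurable_funTS; exact: (frob_L1loc lg ls).1.
  - by apply: ae_imp ss => y sy _; rewrite /sgrad frobC frob_sym_part// frobC.
rewrite pairing_sum// big1// => i _.
apply: (@div_curl_periodic _ _ g_indep (fun j y => s y i j) (fun j y => grad v y i j)
  (fun y => v y i ord0)).
- by move=> j; exact: ls.
- by move=> j; exact: lg.
- exact: hv.2.1.
- by move=> j; exact: (lattice_periodic_map (fun M : 'M[R]_3 => M i j) ps).
- by move=> j; exact: (lattice_periodic_map (fun M : 'M[R]_3 => M i j) (H1per_grad hv)).
- exact: (lattice_periodic_map (fun M : 'cV[R]_3 => M i ord0) hv.1).
- exact: ds.
- by move=> j; exact: wg.
Qed.

Lemma div_free_cst S : div_free (fun=> S).
Proof.
move=> i phi tphi; rewrite big1// => j _.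
by rewrite RintegralZ_R3 ?integral_partial ?mulr0//; apply: integrable_test; exact: test_function_partial.
Qed.

Lemma div_freeB s t : L2loc_mx s -> L2loc_mx t -> div_free s -> div_free t ->
  div_free (fun y => s y - t y).
Proof.
move=> ls lt ds dt i phi tphi; have td j := test_function_partial j tphi.
transitivity (\sum_j \int[leb3]_y (s y i j * partial j phi y) -
    \sum_j \int[leb3]_y (t y i j * partial j phi y)); last by rewrite ds// dt// subrr.
rewrite -sumrB.
apply: eq_bigr => j _; rewrite -RintegralB//.
- by apply: eq_Rintegral => y _; rewrite !mxE mulrBl.
- exact: (L2loc_test_integrable (ls i j) (td j)).
- exact: (L2loc_test_integrable (lt i j) (td j)).
Qed.

(** The periodic part of [u] contributes nothing, so that only the mean of [s] is seen. *)
Lemma Lambda_div_free s B u : L2per g s -> div_free s -> mx_sym B -> LPof g B u ->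
  Lambda g s u = frob (cell_int g s) B.
Proof.
move=> hs ds sB uB; have [v hv e] := LPof_sgrad sB uB; have ls := L2per_L2loc hs.
have lv := L2loc_sgrad hv.2; have lB := L2loc_mx_cst B.
rewrite /Lambda pairingC (pairing_ae g_indep (H := fun y => 1 *: B + sgrad v y) _ _ ls).
- rewrite (pairingZDl g_indep _ lB lv ls) mul1r pairingC (pairing_cst g_indep _ ls).
  by rewrite pairingC pairing_div_free// addr0.
- exact: L2loc_sgrad (LPof_H1loc uB).
- exact: L2loc_mxZD.
- by apply: ae_imp e => y ->; rewrite scale1r.
Qed.

Lemma eta_ofE S B u : mx_sym S -> mx_sym B -> LPof g B u ->
  eta_of g S u = cell_vol g * frob S B.
Proof.
move=> sS sB uB; rewrite /eta_of (Lambda_div_free _ _ sB uB).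
- by rewrite cell_int_cst// frobZl.
- exact: L2per_cst.
- exact: div_free_cst.
Qed.

Lemma Lambda_admissible S s u : mx_sym S -> admissible g S s -> LP g u ->
  Lambda g s u = eta_of g S u.
Proof.
move=> sS [hs ds es] [B sB uB]; rewrite (eta_ofE sS sB uB) (Lambda_div_free hs ds sB uB).
by rewrite -frobZl -es scalerA mulfV ?scale1r// gt_eqF// cell_vol_gt0.
Qed.

(** Subtracts the mean over the cell, in the shape [k *: u + v] which the linearity lemmas treat. *)
Definition centered u : vfield R := fun y => -1 *: ((cell_vol g)^-1 *: cell_int g u) + u y.

Lemma cell_int_centered u : L2loc_mx u -> cell_int g (centered u) = 0.
Proof.
move=> lu; rewrite /centered; set c := _ *: cell_int g u.
rewrite (cell_intZD g_indep (-1) (L2loc_mx_cst c) lu) cell_int_cst//.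
by rewrite scaleN1r /c scalerA mulfV ?scale1r ?addNr// gt_eqF// cell_vol_gt0.
Qed.

Lemma H1per_centered u : H1per g u -> H1per g (centered u).
Proof. exact: H1perZD (H1per_cst _). Qed.

Lemma LP_centered u : LP g u -> LP g (centered u).
Proof. exact: LPZD (H1per_LP (H1per_cst _)). Qed.

Lemma Lambda_centered s u : L2loc_mx s -> LP g u -> Lambda g s (centered u) = Lambda g s u.
Proof.
move=> ls hu; rewrite /centered; set c := _ *: cell_int g u.
have hc := H1per_LP (H1per_cst c).
apply: etrans (LambdaZD (-1) ls hc hu) _.
suff -> : Lambda g s (fun=> c) = 0 by rewrite mulr0 add0r.
apply: etrans (pairingC g s _) _.
apply: etrans (pairing_ae g_indep (L2loc_sgrad (H1loc_cst c)) (L2loc_mx_cst 0) ls (sgrad_cst c)) _.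
by rewrite /pairing; under eq_Rintegral do rewrite frob0l; exact: Rintegral0.
Qed.

End AffinePeriodic.

(** Compares sums over two grids of different sizes and origins: both enumerate, without repetition,
    every index at which the summand does not vanish. *)
Lemma sum_cover (V : nmodType) (I J : finType) (K : eqType) (a : I -> K) (b : J -> K)
    (F : K -> V) :
  injective a -> injective b -> (forall k, F k != 0 -> exists i, a i = k) ->
  (forall k, F k != 0 -> exists j, b j = k) -> \sum_i F (a i) = \sum_j F (b j).
Proof.
move=> ia ib ha hb.
have E (L : finType) (c : L -> K) : \sum_l F (c l) = \sum_(k <- [seq k <- codom c | F k != 0]) F k.
  rewrite big_filter [RHS]big_mkcond big_map -[LHS]big_enum /=.
  by apply: eq_bigr => l _; case: ifPn => // /negPn/eqP.
rewrite !E; apply: perm_big; apply: uniq_perm.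
- by rewrite filter_uniq// /codom map_inj_uniq// enum_uniq.
- by rewrite filter_uniq// /codom map_inj_uniq// enum_uniq.
- move=> k; rewrite !mem_filter; case: (boolP (F k != 0)) => //= Fk.
  have [i ai] := ha k Fk; have [j bj] := hb k Fk.
  by rewrite -{1}ai -bj !codom_f.
Qed.

Lemma continuous_sum (R : realType) (I : Type) (s : seq I) (F : I -> R3 R -> R) :
  (forall l, continuous (F l)) -> continuous (fun y => \sum_(l <- s) F l y).
Proof.
move=> cF; elim: s => [|l s IHs] y.
  by rewrite (_ : (fun _ => _) = cst 0); [exact: cvg_cst|apply/funext => z; rewrite big_nil].
rewrite (_ : (fun _ => _) = F l \+ (fun z => \sum_(l <- s) F l z)); last first.
  by apply/funext => z; rewrite big_cons.
by apply: continuousD; [exact: cF|exact: IHs].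
Qed.

(** * Periodized test functions and divergence free fields *)

Section Periodization.
Context {R : realType} (g : 'I_3 -> R3 R).
Hypothesis g_indep : lin_indep g.
Implicit Types (f phi psi : R3 R -> R) (y : R3 R) (i j : 'I_3) (r : R) (N : nat).
Local Notation grid N := {ffun 'I_3 -> 'I_N.*2.+1}.
Local Notation lat := (lat g).

(* The sum of the lattice translates of [f], provided that [grid N] covers every translate of
   the half-open cell which meets the support of [f]. *)
Definition periodize N f y : R :=
  \sum_(m : grid N) f (y - lat (zpart g y) + lat (gridz m)).

Lemma periodize_hcell N f y : hcell g y ->
  periodize N f y = \sum_(m : grid N) f (y + lat (gridz m)).
Proof.
move=> yh; rewrite /periodize; have lat0 : lat (fun=> 0) = 0 by rewrite /lat big1// => i _; rewrite mulr0z.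
suff -> : zpart g y = (fun=> 0) by apply: eq_bigr => m _; rewrite lat0 subr0.
by apply/esym/(hcell_lat_uniq g_indep); rewrite lat0 subr0.
Qed.

Lemma periodize_periodic N f k y : periodize N f (y + lat k) = periodize N f y.
Proof.
apply: eq_bigr => m _; congr (f (_ + _)).
suff -> : zpart g (y + lat k) = (fun i => zpart g y i + k i) by rewrite latD opprD addrACA subrr addr0.
apply/esym/(hcell_lat_uniq g_indep); rewrite latD opprD addrACA subrr addr0.
exact: hcell_zpart.
Qed.

Definition covers r N : Prop :=
  forall M, (N <= M)%N -> forall y, `|y| <= r -> exists m : grid M, gridz m = zpart g y.

Lemma zpart_lat k : zpart g (lat k) = k.
Proof.
apply/esym/(hcell_lat_uniq g_indep); rewrite subrr => i.
by rewrite lcoord0 lexx ltr01.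
Qed.

(** The shift [zpart g y] jumps across the faces of the cells. On a bounded set the sum may be taken
    over one fixed grid, where continuity and weak derivatives can be read off term by term. *)
Lemma periodize_box r N f (rho : R) : covers r N -> supported_in r f ->
  exists N0, forall N', (N0 <= N')%N ->
    forall y, `|y| <= rho -> periodize N f y = \sum_(m : grid N') f (y + lat (gridz m)).
Proof.
move=> cN fr; have [N0 hN0] := zpart_grid g_indep (r + rho); exists N0 => N' N0N' y yrho.
pose a (m : grid N) := [ffun i => gridz m i - zpart g y i].
pose b (m : grid N') := [ffun i => gridz m i].
pose F (k : {ffun 'I_3 -> int}) := f (y + lat k).
have latE (k : 'I_3 -> int) : lat [ffun i => k i] = lat k.
  by apply: eq_bigr => i _; rewrite ffunE.
have aE m : F (a m) = f (y - lat (zpart g y) + lat (gridz m)).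
  rewrite /F; congr f; rewrite -addrA; congr (_ + _).
  by rewrite /a latE latD latN addrC.
transitivity (\sum_m F (a m)); first by apply: eq_bigr => m _; rewrite aE.
transitivity (\sum_m F (b m)); last by apply: eq_bigr => m _; rewrite /F /b latE.
apply: sum_cover.
- move=> m m' /ffunP h; apply: gridz_inj; apply/funext => i.
  by have := h i; rewrite !ffunE => /addIr.
- by move=> m m' /ffunP h; apply: gridz_inj; apply/funext => i; have := h i; rewrite !ffunE.
- move=> k Fk; have [m hm] := cN N (leqnn N) (y + lat k) (fr _ Fk).
  exists m; apply/ffunP => i; rewrite ffunE hm.
  suff -> : zpart g (y + lat k) = (fun i => zpart g y i + k i) by rewrite addrC addKr.
  apply/esym/(hcell_lat_uniq g_indep); rewrite latD opprD addrACA subrr addr0.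
  exact: hcell_zpart.
- move=> k Fk; have [|m hm] := hN0 N' N0N' (lat k).
    rewrite -[lat k](addKr y) addrC; apply: le_trans (ler_normD _ _) _.
    by rewrite normrN lerD//; exact: fr.
  by exists m; apply/ffunP => i; rewrite ffunE hm zpart_lat.
Qed.

Lemma periodize_continuous r N f : covers r N -> supported_in r f -> smooth f ->
  continuous (periodize N f).
Proof.
move=> cN fr cf y; have [N' /(_ _ (leqnn N')) hN'] := periodize_box (`|y| + 1) cN fr.
pose s z := \sum_(m : grid N') f (z + lat (gridz m)).
have cs : continuous s.
  apply: continuous_sum => m z.
  have := smooth_continuous (smooth_affine 1 (lat (gridz m)) cf).
  by under eq_fun do rewrite scale1r; apply.
have E : {near nbhs y, s =1 periodize N f}.
  apply: filterS (nbhsx_ballx y _ ltr01) => z; rewrite prod_norm_ball => yz; rewrite /s -hN'//.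
  rewrite -[z](subKr y); apply: le_trans (ler_normB _ _) _; by rewrite lerD2l ltW.
rewrite /continuous_at -(nbhs_singleton E); apply: cvg_trans (cs y).
exact: near_eq_cvg.
Qed.

Lemma L2loc_periodize r N phi : covers r N -> supported_in r phi -> smooth phi ->
  L2loc (periodize N phi).
Proof.
by move=> cN phir sphi; apply: L2loc_continuous; exact: periodize_continuous cN phir sphi.
Qed.

Lemma weak_partial_sum j (I : Type) (s : seq I) (F dF : I -> R3 R -> R) :
  (forall l, L2loc (F l)) -> (forall l, L2loc (dF l)) ->
  (forall l, weak_partial j (F l) (dF l)) ->
  weak_partial j (fun y => \sum_(l <- s) F l y) (fun y => \sum_(l <- s) dF l y).
Proof.
move=> lF ldF wF.
have nilE (G : I -> R3 R -> R) : (fun y => \sum_(l <- [::]) G l y) = (fun=> 0 : R).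
  by apply/funext => y; rewrite big_nil.
have consE (G : I -> R3 R -> R) l t :
    (fun y => \sum_(l <- l :: t) G l y) = (fun y => 1 * G l y + \sum_(l <- t) G l y).
  by apply/funext => y; rewrite big_cons mul1r.
elim: s => [|l s IHs]; first by rewrite !nilE; exact: weak_partial_cst.
rewrite !consE.
exact: (weak_partialZD 1 (lF l) (L2loc_sum s lF) (ldF l) (L2loc_sum s ldF) (wF l) IHs).
Qed.

(** On the bounded support of the test function [psi], the periodization is a finite sum of
    translates of [phi]. *)
Lemma weak_partial_periodize r N phi j : covers r N -> supported_in r phi -> smooth phi ->
  weak_partial j (periodize N phi) (periodize N (partial j phi)).
Proof.
move=> cN phir sphi psi tpsi; have [_ [rho _ psir]] := (test_functionP _).1 tpsi.
have [N1 h1] := periodize_box rho cN phir.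
have [N2 h2] := periodize_box rho cN (@supported_partial _ _ _ j phir).
pose M := maxn N1 N2; have {}h1 := h1 M (leq_maxl _ _); have {}h2 := h2 M (leq_maxr _ _).
have lphi := L2loc_continuous (smooth_continuous sphi).
have ldphi := L2loc_continuous (smooth_continuous (smooth_partial j sphi)).
have := @weak_partial_sum j _ (index_enum (grid M)) (fun m y => phi (y + lat (gridz m)))
  (fun m y => partial j phi (y + lat (gridz m))) (fun m => L2loc_translate _ lphi)
  (fun m => L2loc_translate _ ldphi)
  (fun m => weak_partial_translate _ lphi ldphi (weak_partial_smooth j sphi)) psi tpsi.
have [rpsi rdpsi] : supported_in rho psi /\ supported_in rho (partial j psi).
  by split => //; exact: supported_partial.
move=> E; transitivity (\int[leb3]_y ((\sum_(m : grid M) phi (y + lat (gridz m))) * partial j psi y)).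
  apply: eq_Rintegral => y _; have [->|/rdpsi yr] := eqVneq (partial j psi y) 0; first by rewrite !mulr0.
  by rewrite h1.
rewrite E; congr (- _); apply: eq_Rintegral => y _.
have [->|/rpsi yr] := eqVneq (psi y) 0; first by rewrite !mulr0.
by rewrite h2.
Qed.

(* Periodized test functions are periodic fields, and unfolding turns their cell integrals into
   integrals over the whole space. *)
Lemma div_free_of_orthogonal (s : mfield R) : L2per g s ->
  (forall v, H1per0 g v -> pairing g s (sgrad v) = 0) -> div_free s.
Proof.
move=> [ps ls ss] orth i phi tphi; have sphi := tphi.1.
have [_ [r _ phir]] := (test_functionP _).1 tphi.
have [N0 hN0] := zpart_grid g_indep r.
have ldp j : L1loc (fun y => s y i j) by exact: L2loc_L1loc.
have pij j : lattice_periodic g (fun y => s y i j).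
  exact: (lattice_periodic_map (fun M : 'M[R]_3 => M i j) ps).
have unf j : exists N1, forall N, (N1 <= N)%N -> \int[leb3]_y (partial j phi y * s y i j) =
    \int[leb3]_(y in hcell g) ((\sum_(m : grid N) partial j phi (y + lat (gridz m))) * s y i j).
  have [M _ hM] := bounded_of_test (test_function_partial j tphi).
  exact: (periodic_unfold g_indep (measurable_smooth (smooth_partial j sphi)) hM
    (@supported_partial _ _ _ j phir) (pij j) (ldp j)).
(* One grid size beyond the threshold of [phi] and beyond those of the unfoldings in the three
   directions. *)
pose N := (N0 + \sum_j sval (cid (unf j)))%N.
have cN : covers r N by move=> M NM; apply: hN0; apply: leq_trans NM; exact: leq_addr.
have unf' j : \int[leb3]_y (s y i j * partial j phi y) =
    \int[leb3]_(y in cell g) (s y i j * periodize N (partial j phi) y).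
  rewrite (Rintegral_cell g_indep); last first.
    apply: (L1loc_cell g_indep); apply: L2locM; first exact: ls.
    exact: L2loc_periodize cN (@supported_partial _ _ _ j phir) (smooth_partial j sphi).
  transitivity (\int[leb3]_y (partial j phi y * s y i j)).
    by apply: eq_Rintegral => y _; rewrite mulrC.
  rewrite (svalP (cid (unf j)) N); last first.
    by rewrite /N (bigD1 j)//= addnCA leq_addr.
  by apply: eq_Rintegral => y /set_mem yh; rewrite periodize_hcell// mulrC.
(* A field carried by the single direction [i] extracts row [i] of [s], that is, the component [i]
   of its divergence. *)
pose v : vfield R := fun y => periodize N phi y *: delta_mx i ord0.
pose Dv : mfield R := fun y => \matrix_(i', j) ((i' == i)%:R * periodize N (partial j phi) y).
have lv : L2loc_mx v.
  move=> i' j'; under eq_fun do rewrite !mxE mulrC.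
  by apply: L2locZ; exact: L2loc_periodize cN phir sphi.
have lDv : L2loc_mx Dv.
  move=> i' j; under eq_fun do rewrite mxE; apply: L2locZ.
  exact: L2loc_periodize cN (@supported_partial _ _ _ j phir) (smooth_partial j sphi).
have wDv : weak_gradient v Dv.
  move=> i' j psi tpsi.
  have lp := L2loc_periodize cN phir sphi.
  have ldp' := L2loc_periodize cN (@supported_partial _ _ _ j phir) (smooth_partial j sphi).
  have := @weak_partialZD _ j (i' == i)%:R _ _ _ _ lp L2loc0 ldp' L2loc0
    (weak_partial_periodize j cN phir sphi) (weak_partial_cst j 0) psi tpsi.
  move=> E; apply: etrans (etrans _ E) _.
    by apply: eq_Rintegral => y _; rewrite !mxE eqxx andbT addr0 [_ * (_ == _)%:R]mulrC.
  by congr (- _); apply: eq_Rintegral => y _; rewrite mxE addr0.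
have hv : H1per g v.
  split; last by split => //; exists Dv.
  by move=> k; apply: aeW => y; rewrite /v (periodize_periodic N phi k y).
(* The hypothesis concerns fields of zero mean; centering [v] does not change its strain. *)
have Ev : pairing g s (sgrad v) = 0.
  rewrite -[LHS](Lambda_centered g_indep ls (H1per_LP hv)); apply: orth.
  by split; [exact: H1per_centered|exact: cell_int_centered].
have Dvs : pairing g s (sgrad v) = pairing g Dv s.
  rewrite pairingC; apply: ae_eq_Rintegral; first exact: measurable_cell.
  - by apply: measurable_funTS; exact: (frob_L1loc (L2loc_sgrad hv.2) ls).1.
  - by apply: measurable_funTS; exact: (frob_L1loc lDv ls).1.
  - apply: ae_imp2 ss (grad_ae hv.2 lDv wDv) => y sy e _.
    by rewrite /sgrad frobC frob_sym_part// frobC e.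
move: Ev; rewrite Dvs (pairing_sum g_indep lDv ls) (bigD1 i)//= [X in _ + X = 0]big1 ?addr0.
  move=> E; rewrite -[RHS]E; apply: eq_bigr => j _; rewrite unf'; apply: eq_Rintegral => y _.
  by rewrite mxE eqxx mul1r mulrC.
move=> i' i'i; rewrite big1// => j _.
rewrite (eq_Rintegral _ (g := fun=> 0)) ?Rintegral0// => y _.
by rewrite mxE (negbTE i'i) !mul0r.
Qed.

End Periodization.

(** * Elasticity tensors and compliances *)

Section IntegralNonMeasurable.
Context d (T : measurableType d) (R : realType) (mu : {measure set T -> \bar R}).
Implicit Types (f h : T -> \bar R) (D : set T).
Local Open Scope ereal_scope.
Import HBNNSimple.

(* [f] need not be measurable here: [compliance] takes unspecified values on a null set. *)
Lemma ae_eq_ge0_integral f h : (forall x, 0 <= f x) -> (forall x, 0 <= h x) ->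
  measurable_fun setT h -> {ae mu, forall x, f x = h x} -> \int[mu]_x f x = \int[mu]_x h x.
Proof.
move=> f0 h0 mh [N [mN N0 fhN]]; apply/eqP; rewrite eq_le; apply/andP; split.
  rewrite [leLHS]ge0_integralTE//; apply: ge_ereal_sup => _ [s sf <-].
  rewrite -integralT_nnsfun; apply: ae_ge0_le_integral => //.
  - by move=> x _; rewrite lee_fin.
  - exact/measurable_EFinP/measurable_funTS.
  - exists N; split => // x /= hx; apply: fhN => /= E; apply: hx => _; rewrite -E; exact: sf.
have mN' : measurable (~` N) by exact: measurableC.
rewrite (@ge0_negligible_integral _ _ _ mu setT N) ?setTD//.
rewrite ge0_integralE// [leRHS]ge0_integralTE//; apply: le_ereal_sup => _ [s sh <-].
exists s => // x; apply: le_trans (sh x) _; rewrite patchE; case: ifPn => // /set_mem xN.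
suff -> : f x = h x by [].
by apply: contrapT => fh; apply: xN; exact: fhN.
Qed.

Lemma ae_eq_integral_measurable f h D : measurable D -> measurable_fun D h ->
  {ae mu, forall x, D x -> f x = h x} -> \int[mu]_(x in D) f x = \int[mu]_(x in D) h x.
Proof.
move=> mD mh fh; rewrite integral_mkcond [RHS]integral_mkcond.
have mh' : measurable_fun setT (h \_ D) by apply/measurable_restrict => //; rewrite setTI.
have fh' : {ae mu, forall x, (f \_ D) x = (h \_ D) x}.
  by apply: filterS fh => x xh; rewrite !patchE; case: ifPn => // /set_mem /xh.
rewrite integralE [RHS]integralE; congr (_ - _).
  apply: ae_eq_ge0_integral => //; first exact: measurable_funepos.
  by apply: filterS fh' => x; rewrite !funeposE => ->.
apply: ae_eq_ge0_integral => //; first exact: measurable_funeneg.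
by apply: filterS fh' => x; rewrite !funenegE => ->.
Qed.

End IntegralNonMeasurable.

Section Tensor.
Context {R : realType}.
Implicit Types (T : tensor4 R) (x z M : 'M[R]_3) (k alpha : R).

Lemma tappZD T k x z : tapp T (k *: x + z) = k *: tapp T x + tapp T z.
Proof.
apply/matrixP => i j; rewrite !mxE mulr_sumr -big_split; apply: eq_bigr => k' _.
rewrite mulr_sumr -big_split; apply: eq_bigr => l _; rewrite !mxE /=; ring.
Qed.

Lemma tappB T x z : tapp T (x - z) = tapp T x - tapp T z.
Proof. by rewrite addrC -scaleN1r tappZD scaleN1r addrC. Qed.

(* The two symmetries and the coercivity of an elasticity tensor. *)
Definition elastic alpha T : Prop :=
  [/\ 0 < alpha, forall i j i' j' : 'I_3, T i j i' j' = T j i i' j' /\ T i j i' j' = T i' j' i j &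
    forall x, mx_sym x -> alpha * frob x x <= frob (tapp T x) x].

Lemma tapp_sym alpha T x : elastic alpha T -> mx_sym (tapp T x).
Proof.
move=> [_ sT _]; apply/matrixP => i j; rewrite !mxE.
by apply: eq_bigr => k _; apply: eq_bigr => l _; rewrite (sT i j k l).1.
Qed.

Lemma frob_tapp alpha T x z : elastic alpha T -> frob (tapp T x) z = frob (tapp T z) x.
Proof.
move=> [_ sT _]; rewrite /frob.
transitivity (\sum_i \sum_j \sum_k \sum_l T i j k l * x k l * z i j).
  apply: eq_bigr => i _; apply: eq_bigr => j _; rewrite mxE mulr_suml.
  by apply: eq_bigr => k _; rewrite mulr_suml.
transitivity (\sum_k \sum_l \sum_i \sum_j T i j k l * x k l * z i j).
  under eq_bigr do rewrite exchange_big /=; rewrite exchange_big /=.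
  apply: eq_bigr => k _; under eq_bigr do rewrite exchange_big /=.
  by rewrite exchange_big.
apply: eq_bigr => k _; apply: eq_bigr => l _; rewrite mxE mulr_suml.
apply: eq_bigr => i _; rewrite mulr_suml; apply: eq_bigr => j _.
by rewrite (sT i j k l).2; ring.
Qed.

Lemma elastic_inj alpha T x : elastic alpha T -> mx_sym x -> tapp T x = 0 -> x = 0.
Proof.
move=> [a0 _ cT] sx Tx; apply: frob_eq0; apply/eqP; rewrite eq_le frob_ge0 andbT.
by have := cT x sx; rewrite Tx frob0l pmulr_rle0.
Qed.

(* The extension of [tapp T] from symmetric matrices by the identity on antisymmetric ones,
   an automorphism of the space of matrices. *)
Definition tapp_ext T x : 'M[R]_3 := tapp T (sym_part x) + (x - sym_part x).

Lemma tapp_ext_is_linear T : linear (tapp_ext T).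
Proof.
move=> k x z; rewrite /tapp_ext sym_partZD tappZD !scalerDr scalerN opprD.
by apply/matrixP => i j; rewrite !mxE; ring.
Qed.

HB.instance Definition _ T :=
  GRing.isLinear.Build R 'M[R]_3 'M[R]_3 *:%R (tapp_ext T) (tapp_ext_is_linear T).

Definition tapp_mx T : 'M[R]_(3 * 3) := lin_mx (tapp_ext T).

Lemma tapp_mx_unit alpha T : elastic alpha T -> tapp_mx T \in unitmx.
Proof.
move=> eT; rewrite -row_free_unit; apply: inj_row_free => v v0.
rewrite -[v]vec_mxK; move: (vec_mx v) v0 (vec_mxK v) => x v0 xv.
have {v0} : tapp_ext T x = 0.
  by move: v0; rewrite -xv mul_vec_lin => /eqP; rewrite mxvec_eq0 => /eqP.
rewrite /tapp_ext => x0.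
have Tsym := tapp_sym (sym_part x) eT.
(* [tapp T (sym_part x)] is symmetric and [x - sym_part x] antisymmetric, so both vanish when their
   sum does. *)
have asym : x - sym_part x = 0.
  apply/matrixP => i j; move: x0 => /matrixP h; have h1 := h i j; have h2 := h j i.
  have h3 : tapp T (sym_part x) j i = tapp T (sym_part x) i j by rewrite -{1}Tsym mxE.
  by move: h1 h2; rewrite !mxE in h3 *; rewrite h3; lra.
have Tx0 : tapp T (sym_part x) = 0 by move: x0; rewrite asym addr0.
have sx := elastic_inj eT (@mx_sym_sym_part _ x) Tx0.
by move: asym; rewrite sx subr0 => ->; rewrite linear0.
Qed.

(* Through the adjugate rather than [invmx], so as to depend measurably on [T]. *)
Definition tapp_inv T M : 'M[R]_3 :=
  vec_mx (mxvec M *m ((\det (tapp_mx T))^-1 *: \adj (tapp_mx T))).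

Lemma tapp_inv_ext alpha T M : elastic alpha T -> tapp_ext T (tapp_inv T M) = M.
Proof.
move=> eT; have uT := tapp_mx_unit eT.
have := erefl (invmx (tapp_mx T)); rewrite {1}/invmx uT => invE.
by rewrite -mx_rV_lin -/(tapp_mx T) invE mulmxKV ?mxvecK.
Qed.

Lemma tapp_invP alpha T M : elastic alpha T -> mx_sym M ->
  mx_sym (tapp_inv T M) /\ tapp T (tapp_inv T M) = M.
Proof.
move=> eT sM; have := tapp_inv_ext M eT; set x := tapp_inv T M; rewrite /tapp_ext => E.
have Tsym := tapp_sym (sym_part x) eT.
have asym : x - sym_part x = 0.
  apply/matrixP => i j; move: E => /matrixP h; have h1 := h i j; have h2 := h j i.
  have h3 : tapp T (sym_part x) j i = tapp T (sym_part x) i j by rewrite -{1}Tsym mxE.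
  have h4 : M j i = M i j by rewrite -{1}sM mxE.
  by move: h1 h2 h4; rewrite !mxE in h3 *; rewrite h3; lra.
have xs : sym_part x = x by move/eqP: asym; rewrite subr_eq0 => /eqP.
by move: E; rewrite asym addr0 xs => ->; split => //; rewrite -xs; exact: mx_sym_sym_part.
Qed.

Lemma compliance_unique alpha T M x : elastic alpha T -> mx_sym M -> mx_sym x ->
  tapp T x = M -> compliance T M = x.
Proof.
move=> eT sM sx Tx.
have [sc Tc] : mx_sym (compliance T M) /\ tapp T (compliance T M) = M.
  by apply: (@getPex _ [set zeta | mx_sym zeta /\ tapp T zeta = M]); exists x.
apply/eqP; rewrite -subr_eq0; apply/eqP; apply: (elastic_inj eT).
  by rewrite addrC -scaleN1r; exact: mx_symZD.
by rewrite tappB Tc Tx subrr.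
Qed.

Lemma compliance_bound alpha T M x : elastic alpha T -> mx_sym x -> tapp T x = M ->
  frob x x <= alpha^-1 ^+ 2 * frob M M.
Proof.
move=> [a0 _ cT] sx Tx; have := cT x sx; rewrite Tx => h.
(* Expanding this square and inserting [alpha * |x|^2 <= frob M x] gives
   [alpha^2 * |x|^2 <= |M|^2]. *)
have := frob_ge0 (M - alpha *: x).
rewrite frobBl !frobBr !(frobC _ (alpha *: x)) !frobZl (frobC x (alpha *: x)) frobZl (frobC x M).
move: h; set xx := frob x x; set mm := frob M M; set mx := frob M x => h1 h2.
rewrite exprVn mulrC ler_pdivlMr ?exprn_gt0//; nra.
Qed.

End Tensor.

(** * Measurability of matrix operations *)

Section MeasurableMatrix.
Context {R : realType}.
Implicit Types (y : R3 R).

Definition measurable_mx m n (F : R3 R -> 'M[R]_(m, n)) : Prop :=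
  forall i j, measurable_fun setT (fun y => F y i j).

Lemma measurable_mx_mul m n p (F : R3 R -> 'M[R]_(m, n)) (H : R3 R -> 'M[R]_(n, p)) :
  measurable_mx F -> measurable_mx H -> measurable_mx (fun y => F y *m H y).
Proof.
move=> mF mH i j; under eq_fun do rewrite mxE.
by apply: measurable_sum => l; apply: measurable_funM.
Qed.

Lemma measurable_det n (F : R3 R -> 'M[R]_n) : measurable_mx F ->
  measurable_fun setT (fun y => \det (F y)).
Proof.
move=> mF; apply: measurable_sum => s; apply: measurable_funM; first exact: measurable_cst.
by apply: measurable_prod => i _; exact: mF.
Qed.

Lemma measurable_adj n (F : R3 R -> 'M[R]_n) : measurable_mx F ->
  measurable_mx (fun y => \adj (F y)).
Proof.
move=> mF i j; under eq_fun do rewrite mxE.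
apply: measurable_funM; first exact: measurable_cst.
by apply: measurable_det => i' j'; under eq_fun do rewrite !mxE; exact: mF.
Qed.

Lemma measurable_inv (f : R3 R -> R) : measurable_fun setT f ->
  measurable_fun setT (fun y => (f y)^-1).
Proof.
move=> mf.
(* Measurability of the inverse is drawn from that of real powers of a nonnegative base; the
   identity holds also where [f y = 0], both sides being 0. *)
rewrite (_ : (fun y => _) = (fun y => f y * (f y ^+ 2) `^ (-1))); last first.
  apply/funext => y; rewrite powR_inv1 ?sqr_ge0//.
  have [->|fy0] := eqVneq (f y) 0; first by rewrite invr0 mul0r.
  by rewrite expr2 invfM mulrA mulfV// mul1r.
apply: measurable_funM => //.
apply: (@measurableT_comp _ _ _ _ _ _ (@powR R ^~ (-1))); first exact: measurable_powR.
exact: measurable_funX.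
Qed.

End MeasurableMatrix.

Section Rigidity.
Context {R : realType} (g : 'I_3 -> R3 R) (C : R3 R -> tensor4 R).
Hypotheses (g_indep : lin_indep g) (C_rig : rigidity g C).
Implicit Types (s e t : mfield R) (y : R3 R).
Let mcell := measurable_cell g_indep.

Lemma rigidity_elastic : exists2 alpha : R, 0 < alpha &
  {ae leb3, forall y, elastic alpha (C y)}.
Proof.
have [alpha a0 cC] := rigidity_coercive C_rig; exists alpha => //.
by apply: ae_imp2 (rigidity_symmetric C_rig) cC => y sC cC'; split.
Qed.

Lemma L2loc_tapp e : L2loc_mx e -> L2loc_mx (fun y => tapp (C y) (e y)).
Proof.
move=> le i j; under eq_fun do rewrite mxE.
have [M hM] := rigidity_bounded C_rig.
apply: L2loc_sum => k; apply: L2loc_sum => l.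
apply: (@L2loc_ae_bounded _ _ _ M); [exact: rigidity_measurable C_rig i j k l| |exact: le].
by apply: ae_imp hM => y; apply.
Qed.

Lemma L2per_tapp e : L2per g e -> L2per g (fun y => tapp (C y) (e y)).
Proof.
move=> [pe le se]; split; last first.
- have [alpha _ eC] := rigidity_elastic.
  by apply: ae_imp eC => y; exact: tapp_sym.
- exact: L2loc_tapp.
- exact: (lattice_periodic_map2 (fun T x => tapp T x) (rigidity_periodic C_rig) pe).
Qed.

Lemma pairing_tappC e t : L2loc_mx e -> L2loc_mx t ->
  pairing g (fun y => tapp (C y) (e y)) t = pairing g (fun y => tapp (C y) (t y)) e.
Proof.
move=> le lt; have [alpha _ eC] := rigidity_elastic; apply: ae_eq_Rintegral => //.
- by apply: measurable_funTS; exact: (frob_L1loc (L2loc_tapp le) lt).1.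
- by apply: measurable_funTS; exact: (frob_L1loc (L2loc_tapp lt) le).1.
- by apply: ae_imp eC => y eC' _; exact: frob_tapp eC'.
Qed.

Lemma ae_le_Rintegral D (f h : R3 R -> R) : measurable D ->
  leb3.-integrable D (EFin \o f) -> leb3.-integrable D (EFin \o h) ->
  {ae leb3, forall y, D y -> f y <= h y} ->
  \int[leb3]_(y in D) f y <= \int[leb3]_(y in D) h y.
Proof.
move=> mD intf inth fh; rewrite -subr_ge0 -RintegralB//.
have ihf := integrable_realB mD inth intf.
have mhf : measurable_fun D (fun y => h y - f y).
  by apply/measurable_EFinP; exact: measurable_int ihf.
rewrite (@ae_eq_Rintegral _ D _ (fun y => `|h y - f y|))//; first by apply: Rintegral_ge0.
  exact: measurableT_comp.
by apply: ae_imp fh => y fh' Dy; rewrite ger0_norm// subr_ge0 fh'.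
Qed.

Lemma rigidity_definite e : L2per g e ->
  0 <= pairing g (fun y => tapp (C y) (e y)) e /\
  (pairing g (fun y => tapp (C y) (e y)) e = 0 -> {ae leb3, forall y, e y = 0}).
Proof.
move=> he; have [pe le se] := he; have [alpha a0 eC] := rigidity_elastic.
have h : alpha * pairing g e e <= pairing g (fun y => tapp (C y) (e y)) e.
  rewrite /pairing -RintegralZl//; last exact: frob_integrable.
  apply: ae_le_Rintegral => //.
  - by apply: integrable_realZ => //; exact: frob_integrable.
  - by apply: frob_integrable => //; exact: L2loc_tapp.
  - by apply: ae_imp2 eC se => y [_ _ cC] sy _; exact: cC.
split; first by apply: le_trans h; rewrite mulr_ge0 ?pairing_ge0// ltW.
(* The pairing controls [e] on the cell only; periodicity carries the conclusion to the whole
   space. *)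
move=> q0; apply: (ae_periodic g_indep pe (lattice_periodic_cst g 0)).
apply: pairing_eq0 => //; apply/eqP; rewrite eq_le pairing_ge0 andbT.
by move: h; rewrite q0 pmulr_rle0.
Qed.

Lemma measurable_tapp_mx : measurable_mx (fun y => tapp_mx (C y)).
Proof.
move=> p q; under eq_fun do rewrite !mxE /=.
case/mxvec_indexP: q => i j; under eq_fun do rewrite mxvecE !mxE.
apply: measurable_funD; last exact: measurable_cst.
apply: measurable_sum => k; apply: measurable_sum => l.
by apply: measurable_funM; [exact: rigidity_measurable C_rig i j k l|exact: measurable_cst].
Qed.

(** Exchanges the chosen [compliance] for the measurable representative [tapp_inv], so that every
    stress becomes [C t] with [t] in the same space. Local square integrability of [t] comes from
    [compliance_bound]. *)
Lemma compliance_field s : L2per g s -> exists t, [/\ L2per g t,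
  {ae leb3, forall y, tapp (C y) (t y) = s y} &
  {ae leb3, forall y, compliance (C y) (s y) = t y}].
Proof.
move=> [ps ls ss]; have [alpha a0 eC] := rigidity_elastic.
pose t y := tapp_inv (C y) (s y).
have tP : {ae leb3, forall y, mx_sym (t y) /\ tapp (C y) (t y) = s y}.
  by apply: ae_imp2 eC ss => y eC' sy; exact: tapp_invP eC' sy.
have mt : measurable_mx t.
  move=> i j; under eq_fun do rewrite mxE.
  apply: (@measurable_mx_mul _ 1 _ _ (fun y => mxvec (s y)) (fun y => _ *: \adj (tapp_mx (C y)))) => p q.
    rewrite (ord1 p); case/mxvec_indexP: q => k l; under eq_fun do rewrite mxvecE.
    exact: (ls k l).1.
  under eq_fun do rewrite mxE; apply: measurable_funM.
    by apply: measurable_inv; apply: measurable_det; exact: measurable_tapp_mx.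
  by apply: measurable_adj; exact: measurable_tapp_mx.
exists t; split; last first.
- by apply: ae_imp3 eC ss tP => y eC' sy [st Tt]; exact: compliance_unique eC' sy st Tt.
- by apply: ae_imp tP => y [].
split; last by apply: ae_imp tP => y [].
- exact: (lattice_periodic_map2 (fun T x => tapp_inv T x) (rigidity_periodic C_rig) ps).
move=> i j; split; first exact: mt.
move=> K cK; have [r Kr] := compact_sub_box cK.
have mK := measurable_compact cK.
have iss := (L1locZD (alpha^-1 ^+ 2) (frob_L1loc ls ls) (L2loc_L1loc L2loc0)).
apply: le_lt_trans (_ : (\int[leb3]_(y in K)
    (alpha^-1 ^+ 2 * frob (s y) (s y) + 0)%:E < +oo)%E).
  apply: ae_ge0_le_integral => //.
  - by move=> y _; rewrite lee_fin sqr_ge0.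
  - by apply/measurable_EFinP; apply: measurable_funTS; apply: measurable_funX; exact: mt.
  - by move=> y _; rewrite lee_fin addr0 mulr_ge0 ?sqr_ge0 ?frob_ge0.
  - by apply/measurable_EFinP; apply: measurable_funTS; exact: iss.1.
  - apply: ae_imp2 eC tP => y eC' [st Tt] _; rewrite lee_fin addr0.
    exact: le_trans (sqr_entry_le_frob _ i j) (compliance_bound eC' st Tt).
have /integrableP[_] := integrableS (@measurable_box R r) mK Kr (iss.2 r).
apply: le_lt_trans; apply: ge0_le_integral => //.
- by move=> y _; rewrite lee_fin addr0 mulr_ge0 ?sqr_ge0 ?frob_ge0.
- by apply/measurable_EFinP; apply: measurable_funTS; exact: iss.1.
- apply: measurableT_comp => //; apply/measurable_EFinP; apply: measurable_funTS; exact: iss.1.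
- by move=> y _; rewrite /= lee_fin ler_norm.
Qed.

Lemma stress_energyE s t : L2per g s -> L2per g t ->
  {ae leb3, forall y, tapp (C y) (t y) = s y} ->
  {ae leb3, forall y, compliance (C y) (s y) = t y} ->
  stress_energy g C s = 2^-1 * pairing g (fun y => tapp (C y) (t y)) t.
Proof.
move=> [_ ls _] [_ lt _] Ct cs; rewrite /stress_energy; congr (_ * _).
transitivity (pairing g t s).
  congr fine; apply: ae_eq_integral_measurable => //.
    by apply/measurable_EFinP; apply: measurable_funTS; exact: (frob_L1loc lt ls).1.
  by apply: ae_imp cs => y -> _.
rewrite pairingC; apply: pairing_ae => //; first exact: L2loc_tapp.
by apply: ae_imp Ct => y ->.
Qed.

End Rigidity.

(** * Duality *)

Section Duality.
Context {R : realType} (g : 'I_3 -> R3 R) (C : R3 R -> tensor4 R) (A S : 'M[R]_3) (uA : vfield R).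
Hypotheses (g_indep : lin_indep g) (C_rig : rigidity g C) (S_sym : mx_sym S).
Hypothesis uA_corrector : corrector g C A uA.
Implicit Types (s e t : mfield R) (u v w : vfield R) (y : R3 R) (k : R).

Let Cf e : mfield R := fun y => tapp (C y) (e y).

Let q e : R := pairing g (Cf e) e.

Let qB e t : L2loc_mx e -> L2loc_mx t ->
  q (fun y => e y - t y) = q e - 2 * pairing g (Cf t) e + q t.
Proof.
move=> le lt; have lC := L2loc_tapp C_rig.
have lCe := lC _ le; have lCt := lC _ lt.
rewrite /q (_ : Cf (fun y => e y - t y) = (fun y => Cf e y - Cf t y)); last first.
  by apply/funext => y; exact: tappB.
rewrite (pairingBl g_indep lCe lCt (L2loc_mxB le lt)).
rewrite (pairingBr g_indep le lt lCe) (pairingBr g_indep le lt lCt).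
by rewrite [pairing g (Cf e) t](pairing_tappC g_indep C_rig le lt) -/(Cf t); ring.
Qed.

(** The affine parts cancel in the difference, which is therefore a legitimate test field in both
    equations; the energy of the difference of the strains is then 0. *)
Lemma corrector_uniq u v : corrector g C A u -> corrector g C A v ->
  {ae leb3, forall y, sgrad u y = sgrad v y}.
Proof.
have arith (a b c d : R) : a - b = 0 -> c - d = 0 -> b = c -> a - 2 * c + d = 0 by lra.
move=> [[hu u0] [p hp eu] cu] [[hv v0] [p' hp' ev] cv].
have lu := LP_H1loc hu; have lv := LP_H1loc hv.
pose w : vfield R := fun y => -1 *: v y + u y.
have hw : H1per0 g w.
  split; last by rewrite /w (cell_intZD g_indep (-1) lv.1 lu.1) u0 v0 scaler0 addr0.
  rewrite (_ : w = (fun y => -1 *: p' y + p y)); first exact: H1perZD.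
  by apply/funext => y; rewrite /w eu ev !scaleN1r opprD addrACA addNr add0r.
have [su sv] := (L2per_sgrad hu, L2per_sgrad hv).
have lsu := L2per_L2loc su; have lsv := L2per_L2loc sv; have lC := L2loc_tapp C_rig.
have wE : {ae leb3, forall y, sgrad w y = sgrad u y - sgrad v y}.
  by apply: ae_imp (sgradZD (-1) lv lu) => y ->; rewrite scaleN1r addrC.
have lw := L2loc_sgrad hw.1.2.
have {}cu : pairing g (Cf (sgrad u)) (fun y => sgrad u y - sgrad v y) = 0.
  rewrite -(cu w hw) pairingC [RHS]pairingC; apply/esym.
  exact: (pairing_ae g_indep lw (L2loc_mxB lsu lsv) (lC _ lsu) wE).
have {}cv : pairing g (Cf (sgrad v)) (fun y => sgrad u y - sgrad v y) = 0.
  rewrite -(cv w hw) pairingC [RHS]pairingC; apply/esym.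
  exact: (pairing_ae g_indep lw (L2loc_mxB lsu lsv) (lC _ lsv) wE).
have [_ q0] := rigidity_definite g_indep C_rig (L2perB su sv).
have {q0} : {ae leb3, forall y, sgrad u y - sgrad v y = 0}.
  apply: q0; rewrite -/(Cf _) -/(q _) (qB lsu lsv).
  have E1 : q (sgrad u) - pairing g (Cf (sgrad u)) (sgrad v) = 0.
    by rewrite -[RHS]cu (pairingBr g_indep lsu lsv (lC _ lsu)).
  have E2 : pairing g (Cf (sgrad v)) (sgrad u) - q (sgrad v) = 0.
    by rewrite -[RHS]cv (pairingBr g_indep lsu lsv (lC _ lsv)).
  have E3 : pairing g (Cf (sgrad u)) (sgrad v) = pairing g (Cf (sgrad v)) (sgrad u).
    exact: (pairing_tappC g_indep C_rig lsu lsv).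
  exact: arith E1 E2 E3.
by apply: ae_imp => y /eqP; rewrite subr_eq0 => /eqP.
Qed.

Let sg : mfield R := sgrad uA.
Let sigma : mfield R := Cf sg.

Let hLP : LP g uA. Proof. by have [[]] := uA_corrector. Qed.
Let hsg : L2per g sg. Proof. exact: L2per_sgrad. Qed.
Let lsg : L2loc_mx sg. Proof. exact: (L2per_L2loc hsg). Qed.
Let hsigma : L2per g sigma. Proof. exact: L2per_tapp. Qed.
Let lsigma : L2loc_mx sigma. Proof. exact: (L2per_L2loc hsigma). Qed.

Lemma corrector_stress_admissible : S = homogenized g C A ->
  admissible g S (fun y => tapp (C y) (sgrad uA y)).
Proof.
move=> ->; split; first exact: hsigma.
  by apply: (div_free_of_orthogonal g_indep hsigma); have [_ _] := uA_corrector.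
(* [homogenized] is computed from a corrector of its own choice, possibly different from [uA]. *)
pose u := get [set u | corrector g C A u].
have cu : corrector g C A u by apply: (@getPex _ [set u | corrector g C A u]); exists uA.
have [[hu _] _ _] := cu; have lC := L2loc_tapp C_rig.
rewrite -[homogenized g C A]/((cell_vol g)^-1 *: cell_int g (Cf (sgrad u))).
apply: (congr1 (fun M => (cell_vol g)^-1 *: M)).
apply: (cell_int_ae g_indep lsigma (lC _ (L2per_L2loc (L2per_sgrad hu)))).
by apply: ae_imp (corrector_uniq uA_corrector cu) => y e; rewrite /sigma /Cf /sg e.
Qed.

Hypothesis sigma_admissible : admissible g S sigma.

Let sigma_eta v : LP g v -> Lambda g sigma v = eta_of g S v.
Proof. exact: Lambda_admissible. Qed.

Let stress_sigma : stress_energy g C sigma = 2^-1 * q sg.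
Proof.
apply: (stress_energyE g_indep C_rig hsigma hsg); first exact: aeW.
have [alpha _ eC] := rigidity_elastic C_rig; have [_ _ ss] := hsg; have [_ _ st] := hsigma.
by apply: ae_imp3 eC ss st => y eC' ss' st'; exact: compliance_unique eC' st' ss' _.
Qed.

(** Valid on all of [L2per g]: the last term measures the failure of the constraint along [uA], and
    it is the term that the Lagrangian can cancel. *)
Let stress_gap s : L2per g s -> exists t, [/\ L2per g t,
  {ae leb3, forall y, Cf t y = s y} &
  stress_energy g C s = stress_energy g C sigma + 2^-1 * q (fun y => t y - sg y) +
    (Lambda g s uA - eta_of g S uA)].
Proof.
move=> hs; have [t [ht Ct ct]] := compliance_field C_rig hs; exists t; split; [exact: ht|exact: Ct|].
have lt := L2per_L2loc ht; have ls := L2per_L2loc hs; have lC := L2loc_tapp C_rig.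
rewrite (stress_energyE g_indep C_rig hs ht Ct ct) stress_sigma -sigma_eta// (qB lt lsg).
have -> : Lambda g s uA = pairing g (Cf t) sg.
  by apply/esym; exact: (pairing_ae g_indep (lC _ lt) ls lsg Ct).
rewrite -/(Cf t) -/(q t) (pairing_tappC g_indep C_rig lt lsg) -/(Cf sg) -/sigma.
rewrite -[Lambda g sigma uA]/(q sg); lra.
Qed.

(** The constraint enters at the single field [uA], which lets this serve both the admissible
    stresses and the stresses of finite total energy. *)
Let stress_min s : L2per g s -> Lambda g s uA = eta_of g S uA ->
  stress_energy g C sigma <= stress_energy g C s /\
  (stress_energy g C s <= stress_energy g C sigma -> {ae leb3, forall y, s y = sigma y}).
Proof.
move=> hs es; have [t [ht Ct ->]] := stress_gap hs.
have [q0 qe] := rigidity_definite g_indep C_rig (L2perB ht hsg).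
rewrite es subrr addr0; split; first by rewrite lerDl mulr_ge0// invr_ge0.
move=> h; have {}qe : {ae leb3, forall y, t y - sg y = 0}.
  apply: qe; apply/eqP; rewrite eq_le q0 andbT.
  by move: h; rewrite gerDl pmulr_rle0// invr_gt0.
by apply: ae_imp2 Ct qe => y <- /eqP; rewrite subr_eq0 => /eqP e; rewrite /sigma /Cf e.
Qed.

Lemma stress_unique_minimizer :
  unique_minimizer (admissible g S) (fun s => (stress_energy g C s)%:E) sigma.
Proof.
have h s : admissible g S s -> Lambda g s uA = eta_of g S uA.
  by move=> hs; exact: Lambda_admissible.
split.
  split => // s hs; rewrite lee_fin; have [hs' _ _] := hs.
  by have [] := stress_min hs' (h s hs).
move=> s [hs smin]; have [hs' _ _] := hs; have [_ ] := stress_min hs' (h s hs).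
by apply; have := smin sigma sigma_admissible; rewrite lee_fin.
Qed.

Let total_sigma : total_energy g C S sigma = (stress_energy g C sigma)%:E.
Proof. by rewrite /total_energy /indic_of asboolT ?adde0. Qed.

Let total_min s : L2per g s -> (total_energy g C S sigma <= total_energy g C S s)%E /\
  ((total_energy g C S s <= total_energy g C S sigma)%E -> {ae leb3, forall y, s y = sigma y}).
Proof.
move=> hs; rewrite total_sigma /total_energy /indic_of; case: asboolP => [h|_].
  rewrite adde0 !lee_fin; exact: (stress_min hs (h uA hLP)).
by rewrite addey// leey; split.
Qed.

Lemma total_unique_minimizer : unique_minimizer (L2per g) (total_energy g C S) sigma.
Proof.
split; first by split => // s /total_min [].
by move=> s [hs smin]; have [_] := total_min hs; apply; exact: smin.
Qed.

Lemma strain_unique_minimizer :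
  unique_minimizer (compatible g) (fun e => (strain_energy g C S e)%:E) sg.
Proof.
have compat_sg : compatible g sg.
  split => // mu hmu; rewrite pairingC -[LHS]/(Lambda g mu uA).
  have [B sB uB] := hLP; rewrite (Lambda_admissible g_indep (@mx_sym0 R) hmu hLP).
  by rewrite (eta_ofE g_indep (@mx_sym0 R) sB uB) frob0l mulr0.
(* Compatible strains are orthogonal to [sigma - S]. The linear term of the strain energy thus
   becomes a pairing with [sigma], the image of [sg] under [C], and the square can be completed. *)
have sigmaS0 : admissible g 0 (fun y => sigma y - S).
  have [_ ds es] := sigma_admissible; split.
  - by apply: L2perB => //; exact: L2per_cst.
  - by apply: div_freeB => //; [exact: L2loc_mx_cst|exact: div_free_cst].
  - have := @cell_intZD _ _ g_indep _ _ (-1) (fun=> S) sigma (L2loc_mx_cst S) lsigma.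
    under eq_fun do rewrite scaleN1r addrC; move=> ->.
    rewrite cell_int_cst// scalerDr es scaleN1r scalerN scalerA mulVf ?scale1r ?addNr//.
    by rewrite gt_eqF// cell_vol_gt0.
have strainE e : compatible g e -> strain_energy g C S e =
    2^-1 * q (fun y => e y - sg y) - 2^-1 * q sg.
  move=> [he ce]; have le := L2per_L2loc he.
  have := ce _ sigmaS0; rewrite (pairingBr g_indep lsigma (L2loc_mx_cst S) le).
  rewrite (pairing_cst g_indep _ le) => /eqP; rewrite subr_eq0 => /eqP es.
  rewrite (qB le lsg) /strain_energy -/(Cf e) -/(q e) frobC -es [pairing g e sigma]pairingC; lra.
have d0 e : compatible g e -> 0 <= q (fun y => e y - sg y) /\
    (q (fun y => e y - sg y) = 0 -> {ae leb3, forall y, e y - sg y = 0}).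
  by move=> [he _]; exact: (rigidity_definite g_indep C_rig (L2perB he hsg)).
have q0 : q (fun y => sg y - sg y) = 0 by rewrite (qB lsg lsg) -/(q sg); lra.
split.
  split => // e he; rewrite lee_fin !strainE// q0; have [] := d0 e he; lra.
move=> e [he emin]; have [qe0 ] := d0 e he.
have := emin _ compat_sg; rewrite lee_fin !strainE// q0 => h qe.
have {}qe : {ae leb3, forall y, e y - sg y = 0} by apply: qe; lra.
by apply: ae_imp qe => y /eqP; rewrite subr_eq0 => /eqP.
Qed.

Lemma pairing_Cauchy_Schwarz m n (F H : R3 R -> 'M[R]_(m, n)) : L2loc_mx F -> L2loc_mx H ->
  `|pairing g F H| <= Num.sqrt (pairing g F F) * Num.sqrt (pairing g H H).
Proof.
move=> lF lH; rewrite -sqrtrM ?pairing_ge0// -sqrtr_sqr ler_wsqrtr//.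
set a := pairing g F F; set b := pairing g F H; set c := pairing g H H.
have P k : 0 <= k ^+ 2 * a + 2 * k * b + c.
  have := pairing_ge0 g (fun y => k *: F y + H y).
  have lk := L2loc_mxZD k lF lH.
  rewrite (pairingZDl g_indep k lF lH lk) (pairingZDr g_indep k lF lH lF) (pairingZDr g_indep k lF lH lH).
  rewrite [pairing g H F]pairingC -/a -/b -/c; nra.
have a0 : 0 <= a := pairing_ge0 g F; have c0 : 0 <= c := pairing_ge0 g H.
have [a00|an0] := eqVneq a 0.
  have [->|bn0] := eqVneq b 0; first by rewrite expr0n mulr_ge0.
  (* If [a = 0] and [b != 0], this [k] gives the polynomial the value [-1]. *)
  have := P (- (c + 1) / (2 * b)); rewrite a00 mulr0 add0r.
  rewrite (_ : 2 * _ * b = - (c + 1)); last by field.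
  lra.
(* The point at which the quadratic polynomial is minimal. *)
have := P (- b / a); rewrite (_ : _ + c = (a * c - b ^+ 2) / a); last by field.
by rewrite pmulr_lge0 ?invr_gt0 ?lt_def ?an0// subr_ge0.
Qed.

(** Boundedness is what lets [eta_of g S] compete in the supremum defining the Legendre-Fenchel
    transform. *)
Lemma eta_of_LPdual : LPdual g (eta_of g S).
Proof.
have lS := L2loc_mx_cst S; split; first by move=> k u v hu hv; exact: LambdaZD.
exists (Num.sqrt (pairing g (fun=> S) (fun=> S))) => u hu.
have [lu _] := LP_H1loc hu; have lgu := L2loc_grad (LP_H1loc hu).
have -> : eta_of g S u = pairing g (fun=> S) (grad u).
  by apply: eq_Rintegral => y _; rewrite /sgrad frob_sym_part.
apply: le_trans (pairing_Cauchy_Schwarz lS lgu) _.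
by rewrite ler_wpM2l ?sqrtr_ge0// ler_wsqrtr// lerDr pairing_ge0.
Qed.

Lemma indic_of_starE v : LP g v -> indic_of_star g S v = (eta_of g S v)%:E.
Proof.
move=> hv; apply/eqP; rewrite eq_le; apply/andP; split.
  apply: ge_ereal_sup => _ [eta _ <-]; rewrite /indic_of; case: asboolP => [h|_].
    by rewrite sube0 h.
  by rewrite addeC leNye.
apply: ereal_sup_ubound; exists (eta_of g S); first exact: eta_of_LPdual.
by rewrite /indic_of asboolT ?sube0.
Qed.

Lemma lagrangianE s v : LP g v ->
  lagrangian g C S s v = (stress_energy g C s + Lambda g s v - eta_of g S v)%:E.
Proof. by move=> hv; rewrite /lagrangian indic_of_starE. Qed.

Let lagrangian_sigma v : LP g v -> lagrangian g C S sigma v = (stress_energy g C sigma)%:E.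
Proof. by move=> hv; rewrite lagrangianE// sigma_eta// addrK. Qed.

(* When [Lambda s] and [eta_S] differ on some field, the Lagrangian is affine and not constant
   along it. *)
Lemma sup_lagrangian s : L2per g s ->
  ereal_sup [set lagrangian g C S s v | v in LP0 g] = total_energy g C S s.
Proof.
have arith (M a la ea lv ev : R) : lv - ev != 0 ->
    a + ((M - a - (la - ea)) / (lv - ev) * lv + la) -
      ((M - a - (la - ea)) / (lv - ev) * ev + ea) = M by move=> h; field.
move=> hs; have ls := L2per_L2loc hs; have lS := L2loc_mx_cst S.
rewrite /total_energy /indic_of; case: asboolP => [h|].
  rewrite (_ : [set lagrangian g C S s v | v in LP0 g] = [set (stress_energy g C s)%:E]).
    by rewrite ereal_sup1 adde0.
  apply/seteqP; split => [_ [v [hv _] <-]|_ ->].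
    by rewrite lagrangianE// h// addrK.
  exists uA; first by have [] := uA_corrector.
  by rewrite lagrangianE// h// addrK.
move=> /existsNP[v /not_implyP[hv /eqP vn]]; rewrite addey//.
apply: eq_infty => M.
pose d := Lambda g s v - eta_of g S v.
have d0 : d != 0 by rewrite subr_eq0.
(* The solution of the affine equation which gives the Lagrangian the prescribed value [M] at
   [k *: v + uA]; centering brings this field into [LP0 g] without changing the value. *)
pose k := (M - stress_energy g C s - (Lambda g s uA - eta_of g S uA)) / d.
pose w := centered g (fun y => k *: v y + uA y); have hw' := LPZD k hv hLP.
have hw : LP0 g w.
  by split; [exact: LP_centered|apply: (cell_int_centered g_indep); exact: (LP_H1loc hw').1].
apply: ereal_sup_ubound; exists w => //; rewrite (lagrangianE _ hw.1).
rewrite (Lambda_centered g_indep ls hw') -[eta_of g S w]/(Lambda g (fun=> S) w).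
rewrite (Lambda_centered g_indep lS hw') (LambdaZD g_indep _ ls hv hLP) (LambdaZD g_indep _ lS hv hLP).
exact: (congr1 EFin (arith _ _ _ _ _ _ d0)).
Qed.

Lemma inf_total_energy :
  ereal_inf [set total_energy g C S s | s in L2per g] = lagrangian g C S sigma uA.
Proof.
rewrite lagrangian_sigma// -total_sigma; apply/eqP; rewrite eq_le; apply/andP; split.
  by apply: ereal_inf_lbound; exists sigma.
by apply: le_ereal_inf_tmp => _ [s hs <-]; have [] := total_min hs.
Qed.

(* The supremum is attained at [- uA], which is written [-2 uA + uA] in the proof. *)
Lemma sup_inf_lagrangian : lagrangian g C S sigma uA =
  ereal_sup [set ereal_inf [set lagrangian g C S s v | s in L2per g] | v in LP0 g].
Proof.
rewrite lagrangian_sigma//; apply/eqP; rewrite eq_le; apply/andP; split; last first.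
  apply: ge_ereal_sup => _ [v [hv _] <-]; rewrite -(lagrangian_sigma hv).
  by apply: ereal_inf_lbound; exists sigma.
pose w : vfield R := fun y => -2 *: uA y + uA y.
have hw : LP g w by exact: LPZD.
have hw0 : LP0 g w.
  split => //; have lu := (LP_H1loc hLP).1.
  rewrite /w (cell_intZD g_indep (-2) lu lu).
  by have [[_ ->] _ _] := uA_corrector; rewrite scaler0 addr0.
apply: le_trans (ereal_sup_ubound _); last by exists w; [exact: hw0|reflexivity].
apply: le_ereal_inf_tmp => _ [s hs <-]; have [t [ht Ct E]] := stress_gap hs.
have [q0 _] := rigidity_definite g_indep C_rig (L2perB ht hsg).
rewrite (lagrangianE _ hw) lee_fin E (LambdaZD g_indep (-2) (L2per_L2loc hs) hLP hLP).
rewrite [eta_of g S w](LambdaZD g_indep (-2) (L2loc_mx_cst S) hLP hLP) -!/(eta_of g S _).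
move: q0; rewrite -/(Cf _) -/(q _); lra.
Qed.

End Duality.
Theorem theorem30 (R : realType) (g : 'I_3 -> R3 R) (C : R3 R -> tensor4 R)
    (A S : 'M[R]_3) (uA : vfield R)
    (g_indep : lin_indep g)
    (C_rigidity : rigidity g C)
    (A_sym : mx_sym A) (S_sym : mx_sym S)
    (S_eq : S = homogenized g C A)
    (uA_corrector : corrector g C A uA) :
  exists sigmaS : mfield R,
    [/\ unique_minimizer (admissible g S)
          (fun s => (stress_energy g C s)%:E) sigmaS,
        unique_minimizer (L2per g) (total_energy g C S) sigmaS,
        unique_minimizer (compatible g)
          (fun e => (strain_energy g C S e)%:E) (sgrad uA) &
        [/\ ereal_inf [set total_energy g C S s | s in L2per g]
            = ereal_inf [set ereal_sup [set lagrangian g C S s v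
                                       | v in LP0 g] | s in L2per g],
            ereal_inf [set ereal_sup [set lagrangian g C S s v
                                     | v in LP0 g] | s in L2per g]
            = lagrangian g C S sigmaS uA
          & lagrangian g C S sigmaS uA
            = ereal_sup [set ereal_inf [set lagrangian g C S s v
                                       | s in L2per g] | v in LP0 g]]].
Proof.
have adm := corrector_stress_admissible g_indep C_rigidity uA_corrector S_eq.
exists (fun y => tapp (C y) (sgrad uA y)); split.
- exact: (stress_unique_minimizer g_indep C_rigidity S_sym uA_corrector adm).
- exact: (total_unique_minimizer g_indep C_rigidity S_sym uA_corrector adm).
- exact: (strain_unique_minimizer g_indep C_rigidity S_sym uA_corrector adm).
(* The inner supremum is the total energy stress by stress, so both infima are taken over the same
   set. *)
have supE : [set ereal_sup [set lagrangian g C S s v | v in LP0 g] | s in L2per g] =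
    [set total_energy g C S s | s in L2per g].
  by apply: eq_imagel => s; exact: (sup_lagrangian g_indep S_sym uA_corrector).
rewrite supE; split => //.
- exact: (inf_total_energy g_indep C_rigidity S_sym uA_corrector adm).
- exact: (sup_inf_lagrangian g_indep C_rigidity S_sym uA_corrector adm).
Qed.
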